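(* Consider the stochastic program $\min_{x\in X}\mathbb{E}[f(x,\tilde\xi)]$ and the sequential sampling procedure with sampling method $s\in\{\mathcal{A},\mathcal{L}\}$ (antithetic variates, Latin hypercube sampling) and assessment procedure $a\in\{S,A\}$ (SRP, A2RP), as defined in the context. Suppose: (i) $f(\cdot,\tilde\xi)$ is continuous on $X$ with probability one; (ii) if $s=\mathcal{L}$: there is a positive real number $C$ with $\sup_{x\in X,\xi\in\Xi}|f(x,\xi)|\le C$; if $s=\mathcal{A}$: $\sup_{x\in X}\mathbb{E}[f(x,\tilde\xi)^2]<\infty$; (iii) $X\neq\emptyset$ and $X$ is compact; (iv) the components of $\tilde\xi$ are independent, with (analytically or numerically) invertible cumulative distribution functions; (v) the sequence of candidate solutions $\{x_k\}$ has at least one limit point in $X^*$, with probability one. Let $\varepsilon>\varepsilon'>0$, $h'>0$, $p>0$, $q>1$ and $0<\alpha<1$ be fixed. For each $h>h'$, let the sample sizes $n_k$, $k\ge1$, satisfy $$n_k\ \ge\ \Big(\frac{1}{h-h'}\Big)^2\big(c_{p,q}+2pk^q\big)\ \text{ if } s=\mathcal{L},\qquad \frac{n_k}{2}\ \ge\ \Big(\frac{1}{h-h'}\Big)^2\big(c_{p,q}+2pk^q\big)\ \text{ if } s=\mathcal{A},$$ where $c_{p,q}=\max\Big\{2\ln\Big(\sum_{j=1}^{\infty}\exp(-pj^q)\big/(\sqrt{2\pi}\,\alpha)\Big),\,1\Big\}$, with $n_k$ even if $(s,a)=(\mathcal{L},A)$ or $(\mathcal{A},S)$, and $n_k$ a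 multiple of $4$ if $(s,a)=(\mathcal{A},A)$. Let $$T=\inf_{k\ge1}\Big\{k:\ \texttt{GAP}^a_{s,n_k}(x_k)\le h'\sqrt{\texttt{SV}^a_{s,n_k}(x_k)}+\varepsilon'\Big\}.$$ Then for all $(s,a)=(\mathcal{A},S),(\mathcal{A},A),(\mathcal{L},S),(\mathcal{L},A)$: (i) $\mathbb{P}(T<\infty)=1$; (ii) $\displaystyle\liminf_{h\downarrow h'}\ \mathbb{P}\Big\{\mathcal{G}_{x_T}\le h\sqrt{\texttt{SV}^a_{s,n_T}(x_T)}+\varepsilon\Big\}\ \ge\ 1-\alpha.$
   Context: **Problem.** $X\subseteq\mathbb{R}^{d_x}$; $\tilde\xi$ is a random vector with distribution $P$ (not depending on $x$) and support $\Xi\subseteq\mathbb{R}^{d_\xi}$; $f:X\times\Xi\to\mathbb{R}$ is Borel measurable. $z^*=\min_{x\in X}\mathbb{E}[f(x,\tilde\xi)]$ is the optimal value and $X^*=\operatorname{argmin}_{x\in X}\mathbb{E}[f(x,\tilde\xi)]$ the set of optimal solutions. For $x\in X$ the optimality gap is $\mathcal{G}_x=\mathbb{E}[f(x,\tilde\xi)]-z^*\ge 0$. $F_j^{-1}$ denotes the inverse of the cumulative distribution function of the $j$-th component of $\tilde\xi$. **Antithetic variates (AV, $s=\mathcal{A}$).** An AV pair $(\tilde\xi_{\mathcal{A}},\tilde\xi_{\mathcal{A}'})$ is obtained by drawing $\tilde u$ uniformly on $(0,1)^{d_\xi}$ and applying the inverse transforms $F_j^{-1}$ componentwise to $\tilde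 u$ and to $\vec 1-\tilde u$ ($\vec 1$ is the vector of ones). Distinct AV pairs are i.i.d. A sample of (even) size $n$ consists of $n/2$ AV pairs. Put $g_{\mathcal{A}}(x,\tilde\xi)=\tfrac12\big(f(x,\tilde\xi_{\mathcal{A}})+f(x,\tilde\xi_{\mathcal{A}'})\big)$, and $g_{\mathcal{A}}(x,\tilde\xi^i)$ for its value at the $i$-th pair. **Latin hypercube sampling (LHS, $s=\mathcal{L}$).** An LHS sample $\{\tilde\xi^1_{\mathcal{L}},\dots,\tilde\xi^n_{\mathcal{L}}\}$ of size $n$ is formed as follows, independently for each dimension $j=1,\dots,d_\xi$: draw independent $\tilde u^i_j\sim U(\frac{i-1}{n},\frac in)$, $i=1,\dots,n$; draw an independent uniformly random permutation $(\pi^1_j,\dots,\pi^n_j)$ of $\{1,\dots,n\}$; set $\tilde\xi^i_{\mathcal{L},j}=F_j^{-1}\big(\tilde u_j^{\pi^i_j}\big)$. **Single Replication Procedure (SRP, $a=S$).** For $x\in X$ and a sample of size $n$: - LHS: let $x^*_{\mathcal{L},n}$ be an optimal solution of $\min_{y\in X}\frac1n\sum_{i=1}^n f(y,\tilde\xi^i_{\mathcal{L}})$ and $$\texttt{GAP}^S_{\mathcal{L},n}(x)=\frac1n\sum_{i=1}^n\big(f(x,\tilde\xi^i_{\mathcal{L}})-f(x^*_{\mathcal{L},n},\tilde\xi^i_{\mathcal{L}})\big),$$ $$\texttt{SV}^S_{\mathcal{L},n}(x)=\frac1{n-1}\sum_{i=1}^n\Big[\big(f(x,\tilde\xi^i_{\mathcal{L}})-f(x^*_{\mathcal{L},n},\tilde\xi^i_{\mathcal{L}})\big)-\texttt{GAP}^S_{\mathcal{L},n}(x)\Big]^2.$$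 - AV: let $x^*_{\mathcal{A},n}$ be an optimal solution of $\min_{y\in X}\frac2n\sum_{i=1}^{n/2}g_{\mathcal{A}}(y,\tilde\xi^i)$ and $$\texttt{GAP}^S_{\mathcal{A},n}(x)=\frac{1}{n/2}\sum_{i=1}^{n/2}\big[g_{\mathcal{A}}(x,\tilde\xi^i)-g_{\mathcal{A}}(x^*_{\mathcal{A},n},\tilde\xi^i)\big],$$ $$\texttt{SV}^S_{\mathcal{A},n}(x)=\frac{1}{n/2-1}\sum_{i=1}^{n/2}\Big[\big(g_{\mathcal{A}}(x,\tilde\xi^i)-g_{\mathcal{A}}(x^*_{\mathcal{A},n},\tilde\xi^i)\big)-\texttt{GAP}^S_{\mathcal{A},n}(x)\Big]^2.$$ **Averaged Two-Replication Procedure (A2RP, $a=A$).** With two independent samples of size $n/2$ each (by the same method $s$), giving SRP estimators indexed $1$ and $2$, $$\texttt{GAP}^A_{s,n}(x)=\tfrac12\big(\texttt{GAP}^{S,1}_{s,n/2}(x)+\texttt{GAP}^{S,2}_{s,n/2}(x)\big),\qquad \texttt{SV}^A_{s,n}(x)=\tfrac12\big(\texttt{SV}^{S,1}_{s,n/2}(x)+\texttt{SV}^{S,2}_{s,n/2}(x)\big).$$ **Sequential sampling procedure.** A sequence of (random) candidate solutions $x_1,x_2,\ldots\in X$ is given, generated by any method. A pair $(s,a)$ is fixed. Parameters satisfy $h>h'>0$, $\varepsilon>\varepsilon'>0$, $\alpha\in(0,1)$. At iteration $k=1,2,\dots$, a sample of size $n_k$ ($n_k\ge n_{k-1}$, $n_0=2$)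 is generated by method $s$ and $\texttt{GAP}^a_{s,n_k}(x_k)$, $\texttt{SV}^a_{s,n_k}(x_k)$ are computed from it. The samples used to assess solution quality are independent of those used to generate the candidate solutions. For LHS a completely new, independent sample is generated at each iteration; for AV one may either append new independent AV pairs to the previous ones or generate entirely new ones. The procedure stops at the iteration $T$ in the claim and outputs $x_T$. Sample sizes are always large enough for the estimators to be defined. The sample sizes $n_k$, and hence $T$, depend on $h$; in (ii) of the conclusion, $h'$ is fixed and $h$ decreases to $h'$. *)

(* Defs.v *)
From HB Require Import structures.
From mathcomp Require Import all_boot all_order all_algebra all_fingroup.
From mathcomp Require Import all_classical all_reals all_analysis.

Set Implicit Arguments.
Unset Strict Implicit.
Unset Printing Implicit Defensive.

Import Order.TTheory GRing.Theory Num.Theory.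
Import numFieldNormedType.Exports.

Local Open Scope classical_set_scope.
Local Open Scope ring_scope.

HB.instance Definition _ (R : realType) (m n : nat) :=
  @isMeasurable.Build (sigma_display (@open 'M[R]_(m, n))) 'M[R]_(m, n)
    <<s @open 'M[R]_(m, n) >> (@sigma_algebra0 _ setT _)
    (@sigma_algebraC _ _) (@sigma_algebra_bigcup _ setT _).

Section coordinates.
Context {R : realType} {d : nat}.

Definition coordinate (j : 'I_d) (v : 'rV[R]_d) : R := v ord0 j.

Lemma measurable_coordinate (j : 'I_d) : measurable_fun setT (coordinate j).
Proof.
apply: (measurability _ (measurable_realfun.RGenOpens.measurableE R)).
move=> _ [_ [a [b ->] <-]].
rewrite setTI; apply: sub_sigma_algebra.
have /continuousP := @coord_continuous R 1 d ord0 j.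
by apply; exact: interval_open.
Qed.

HB.instance Definition _ (j : 'I_d) :=
  isMeasurableFun.Build _ _ 'rV[R]_d R (coordinate j) (measurable_coordinate j).

Definition dsupport (mu : probability 'rV[R]_d R) : set 'rV[R]_d :=
  [set z | forall U : set 'rV[R]_d, open U -> U z -> (0 < mu U)%E].

Definition component_cdf (mu : probability 'rV[R]_d R) (j : 'I_d) (t : R) : R :=
  fine (cdf (coordinate j : {RV mu >-> R}) t).

End coordinates.

(** G inverts the CDF F.  A CDF is in general not injective where it equals 0
    or 1 (e.g. the uniform CDF), so F is inverted as a map from
    {t | 0 < F t < 1} onto ]0, 1[; G is irrelevant outside ]0, 1[. *)
Definition inverse_cdf (R : realType) (F G : R -> R) : Prop :=
  (forall u, 0 < u < 1 -> F (G u) = u) /\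
  (forall t, 0 < F t < 1 -> G (F t) = t).

Section independence.
Context {d : measure_display} {Omega : measurableType d} {R : realType}.
Variable P : probability Omega R.

Definition sigma_of d' (E : measurableType d') (Y : Omega -> E) :
  set (set Omega) := preimage_set_system setT Y measurable.

Definition sigma_of_fin (E : finType) (Y : Omega -> E) : set (set Omega) :=
  preimage_set_system setT Y setT.

Definition mutually_independent (I : choiceType) (D : set I)
    (G : I -> set (set Omega)) : Prop :=
  forall (s : seq I) (A : I -> set Omega), uniq s ->
    (forall i, i \in s -> D i /\ G i (A i)) ->
    P (\big[setI/setT]_(i <- s) A i) = (\prod_(i <- s) P (A i))%E.

Definition independent2 (G H : set (set Omega)) : Prop :=
  forall A B, G A -> H B -> P (A `&` B) = (P A * P B)%E.

(** A draw from the open interval: the values at the end points, where an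
    inverse CDF need not be defined, are excluded surely. *)
Definition uniform_on (a b : R) (U : {RV P >-> R}) : Prop :=
  (forall w, a < U w < b) /\
  exists ab : a < b, forall A : set R, measurable A ->
    distribution P U A = uniform_prob ab A.

Definition uniform_fin (E : finType) (Y : Omega -> E) : Prop :=
  forall e, measurable (Y @^-1` [set e]) /\
    P (Y @^-1` [set e]) = ((#|E|%:R)^-1)%:E.

End independence.

(** Antithetic variates (AV) and Latin hypercube sampling (LHS); Single (SRP)
    and Averaged Two-Replication (A2RP) Procedures. *)
Inductive sampling := Antithetic | LatinHypercube.
Inductive assessment := SRP | A2RP.

Definition replications (a : assessment) : nat :=
  if a is A2RP then 2 else 1.

(** The sample size n has to be a multiple of this number: the number of
    replications, doubled for AV because of the pairs. *)
Definition sample_divisor (s : sampling) (a : assessment) : nat :=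
  match s, a with
  | LatinHypercube, SRP => 1 | LatinHypercube, A2RP => 2
  | Antithetic, SRP => 2 | Antithetic, A2RP => 4
  end.

(** Number of observations (LHS points, AV pairs) in each replication; n is the
    total sample size. *)
Definition nobs (s : sampling) (a : assessment) (n : nat) : nat :=
  (n %/ sample_divisor s a)%N.

Section estimators.
Context {R : realType} {dx dxi : nat}.

(** Value of the i-th observation at y: f(y, xi^i) for LHS, g_A(y, xi^i) for
    AV.  A sample is a map z : nat -> bool -> 'rV[R]_dxi; for AV the i-th pair
    is (z i false, z i true), for LHS the i-th point is z i false. *)
Definition observation (s : sampling) (f : 'rV[R]_dx -> 'rV[R]_dxi -> R)
    (z : nat -> bool -> 'rV[R]_dxi) (y : 'rV[R]_dx) (i : nat) : R :=
  match s with
  | LatinHypercube => f y (z i false)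
  | Antithetic => 2^-1 * (f y (z i false) + f y (z i true))
  end.

(** Below, g y i is the i-th observation at y (see [observation]) and N the
    number of observations in the replication. *)
Definition saa_optimal (X : set 'rV[R]_dx) (N : nat)
    (g : 'rV[R]_dx -> nat -> R) (ystar : 'rV[R]_dx) : Prop :=
  X ystar /\ forall y, X y ->
    N%:R^-1 * (\sum_(i < N) g ystar i) <= N%:R^-1 * (\sum_(i < N) g y i).

Definition srp_gap (N : nat) (g : 'rV[R]_dx -> nat -> R)
    (x ystar : 'rV[R]_dx) : R :=
  N%:R^-1 * \sum_(i < N) (g x i - g ystar i).

Definition srp_sv (N : nat) (g : 'rV[R]_dx -> nat -> R)
    (x ystar : 'rV[R]_dx) : R :=
  (N%:R - 1)^-1 *
  \sum_(i < N) ((g x i - g ystar i) - srp_gap N g x ystar) ^+ 2.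

(** g r and ystar r are the observations and the sampling solution of the r-th
    replication (r = 0 for SRP, r = 0, 1 for A2RP). *)
Definition gap (a : assessment) (N : nat) (g : nat -> 'rV[R]_dx -> nat -> R)
    (x : 'rV[R]_dx) (ystar : nat -> 'rV[R]_dx) : R :=
  match a with
  | SRP => srp_gap N (g 0) x (ystar 0)
  | A2RP => 2^-1 * (srp_gap N (g 0) x (ystar 0) + srp_gap N (g 1) x (ystar 1))
  end.

Definition sv (a : assessment) (N : nat) (g : nat -> 'rV[R]_dx -> nat -> R)
    (x : 'rV[R]_dx) (ystar : nat -> 'rV[R]_dx) : R :=
  match a with
  | SRP => srp_sv N (g 0) x (ystar 0)
  | A2RP => 2^-1 * (srp_sv N (g 0) x (ystar 0) + srp_sv N (g 1) x (ystar 1))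
  end.

End estimators.

(** In the sequel xi k r i b : Omega -> 'rV[R]_d is the i-th observation of
    replication r at iteration k >= 1, b selecting the member of an AV pair;
    m k is the number of observations per replication at iteration k, and nr
    the number of replications.  Observations are numbered from 0. *)
Section sampling_schemes.
Context {d : measure_display} {Omega : measurableType d} {R : realType}.
Variable P : probability Omega R.
Context {dxi : nat}.
Variables (Finv : 'I_dxi -> R -> R) (nr : nat) (m : nat -> nat).
Variable xi : nat -> nat -> nat -> bool -> Omega -> 'rV[R]_dxi.

(** u b r i j is the j-th coordinate of the i-th uniform vector of batch b in
    replication r; iteration k uses the first m k vectors of batch [batch k].
    At iteration k + 1 one either keeps the batch (new pairs are appended to
    the previous ones) or starts the next one (entirely new pairs). *)
Definition av_scheme : Prop :=
  exists (batch : nat -> nat) (u : nat -> nat -> nat -> 'I_dxi -> {RV P >-> R}),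
    let used (t : nat * nat * nat * 'I_dxi) :=
      let: (b, r, i, _) := t in
      exists k, [/\ (1 <= k)%N, batch k = b, (r < nr)%N & (i < m k)%N] in
    [/\ (forall k, (1 <= k)%N ->
           batch k.+1 = batch k \/ batch k.+1 = (batch k).+1),
        (forall b r i j, used (b, r, i, j) -> uniform_on 0 1 (u b r i j)),
        mutually_independent P (used : set (nat * nat * nat * 'I_dxi))
          (fun t => let: (b, r, i, j) := t in
                    sigma_of (u b r i j : Omega -> R)) &
        forall k r i w, (1 <= k)%N -> (r < nr)%N -> (i < m k)%N ->
          xi k r i false w = \row_j Finv j (u (batch k) r i j w) /\
          xi k r i true w = \row_j Finv j (1 - u (batch k) r i j w)].

(** All the draws of all iterations and replications are independent: each
    iteration uses entirely new samples.  Iteration 0 is unused. *)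
Definition lhs_scheme : Prop :=
  exists (u : nat -> nat -> nat -> 'I_dxi -> {RV P >-> R})
         (perm : forall k, nat -> 'I_dxi -> Omega -> 'S_(m k)),
    let used (t : nat * nat * nat * 'I_dxi + nat * nat * 'I_dxi) :=
      match t with
      | inl (k, r, i, _) => [/\ (1 <= k)%N, (r < nr)%N & (i < m k)%N]
      | inr (k, r, _) => (1 <= k)%N /\ (r < nr)%N
      end in
    [/\ (forall k r i j, used (inl (k, r, i, j)) ->
           uniform_on (i%:R / (m k)%:R) (i.+1%:R / (m k)%:R) (u k r i j)),
        (forall k r j, used (inr (k, r, j)) -> uniform_fin P (perm k r j)),
        mutually_independent P
          (used : set (nat * nat * nat * 'I_dxi + nat * nat * 'I_dxi))
          (fun t => match t with
            | inl (k, r, i, j) => sigma_of (u k r i j : Omega -> R)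
            | inr (k, r, j) => sigma_of_fin (perm k r j)
            end) &
        forall k r (i : 'I_(m k)) w, (1 <= k)%N -> (r < nr)%N ->
          xi k r i false w = \row_j Finv j (u k r (perm k r j w i) j w)].

Definition sampling_scheme (s : sampling) : Prop :=
  match s with Antithetic => av_scheme | LatinHypercube => lhs_scheme end.

Definition samples_sigma (s : sampling) : set (set Omega) :=
  <<s [set A | exists (k r i : nat) (b : bool),
         [/\ (1 <= k)%N, (r < nr)%N, (i < m k)%N, (b -> s = Antithetic) & sigma_of (xi k r i b) A]] >>.

End sampling_schemes.

Definition candidates_sigma d (Omega : measurableType d) (R : realType)
    (dx : nat) (x : nat -> Omega -> 'rV[R]_dx) : set (set Omega) :=
  <<s [set A | exists k, (1 <= k)%N /\ sigma_of (x k) A] >>.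

Section stochastic_program.
Context {R : realType} {dx dxi : nat}.
Variables (X : set 'rV[R]_dx) (mu : probability 'rV[R]_dxi R).
Variable f : 'rV[R]_dx -> 'rV[R]_dxi -> R.

(** E[f(x, xi)], where f is only meaningful on X x dsupport mu. *)
Definition objective (x : 'rV[R]_dx) : R :=
  \int[mu]_(z in dsupport mu) f x z.

Definition optimal_value : R := inf (objective @` X).

Definition optimal_solutions : set 'rV[R]_dx :=
  [set x | X x /\ forall y, X y -> objective x <= objective y].

Definition optimality_gap (x : 'rV[R]_dx) : R := objective x - optimal_value.

Definition moment_condition (s : sampling) : Prop :=
  match s with
  | LatinHypercube => exists C : R, 0 < C /\
      forall x z, X x -> dsupport mu z -> `|f x z| <= C
  | Antithetic => (ereal_sup [set \int[mu]_(z in dsupport mu) ((f x z) ^+ 2)%:E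
                     | x in X] < +oo)%E
  end.

End stochastic_program.

Definition c_const (R : realType) (p q alpha : R) : R :=
  Num.max
    (2 * ln (fine (\sum_(1 <= j <oo) (expR (- p * j%:R `^ q))%:E)%E
             / (Num.sqrt (2 * pi) * alpha)))
    1.

Definition effective_size (R : realType) (s : sampling) (n : nat) : R :=
  match s with LatinHypercube => n%:R | Antithetic => n%:R / 2 end.

(** +oo when C k holds for no k >= 1. *)
Definition first_time (R : realType) (C : nat -> Prop) : \bar R :=
  ereal_inf [set (k%:R)%:E | k in [set k : nat | (1 <= k)%N /\ C k]].

(* Main.v *)
From HB Require Import structures.
Require Import Defs.
From mathcomp Require Import all_boot all_order all_algebra all_fingroup.
From mathcomp Require Import all_classical all_reals all_analysis.
From mathcomp Require Import measurable_realfun.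
From mathcomp Require Import ring lra.

(** Why the theorem is true.

    Since q > 1, the requirement on the sample sizes makes the sum over k of
    1/n_k at most a constant times (h - h')^2.  All estimates below are of
    Chebyshev type: an event that may spoil iteration k has probability at
    most a constant times 1/n_k.  Hence such events are summable, and the
    probability that one of them occurs at some iteration tends to 0 as h
    decreases to h'.  In particular the probability in the second claim tends
    to 1.

    A common property of the samples.  For both sampling methods each point
    has the law mu, and the joint law of points of different index is at most
    c = 1 + K/N times the product law ([design], [sampling_design]).  For
    antithetic pairs different pairs are independent.  Latin hypercube points
    are not: given the N^d cells of the grid, the pairs of cells that two
    points can occupy have equal probability (N(N-1))^-d, so the joint law is
    at most (N/(N-1))^d times the product law.  A pair domination with
    c = 1 + K/N bounds covariances by O(1/N), which yields the weak law with
    rate 1/N for every square integrable function ([design_lln]).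

    Finite stopping.  Along the sequence of candidates there are infinitely
    many k for which the optimality gap of x_k is at most epsilon'/16, because
    the objective is continuous and the candidates cluster at an optimal
    solution.  For such k the procedure stops unless an event of probability
    O(1/n_k) occurs ([small_gap_event], [stopping_event]), and by the lemma of
    Borel and Cantelli only finitely many of these events occur.  Under
    antithetic sampling the integrand need not have an integrable envelope,
    and the gap estimator need not converge uniformly.  However, the laws of large numbers
    for bounded Lipschitz functions of f(x, .) - f(y, .) are uniform in x and
    y ([uniform_lln]).  They show that the truncated differences have a small
    average and that few differences are truncated.  If the gap estimator is
    nevertheless large, then few indices carry it, and the Cauchy-Schwarz
    inequality forces the sample variance to be so large that the stopping
    criterion holds ([gap_le_sqrt_variance]).

    Coverage.  If the procedure stops at k and the assertion on the optimality
    gap of x_k fails, then the gap estimator is smaller than that optimality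
    gap by more than epsilon - epsilon'.  Comparing the sampling solution with
    a fixed optimal solution, this requires a large deviation of the sample
    mean at the optimal solution or at x_k.  The candidate x_k is random but
    independent of the sample, so its deviation can be estimated by
    discretising x_k on a finite net of X ([candidate_lln],
    [overestimation_event]); the number of points of the net does not enter,
    because the events that x_k lies in the different cells of the net have
    probabilities that add up to 1. *)

Set Implicit Arguments.
Unset Strict Implicit.
Unset Printing Implicit Defensive.

Import Order.TTheory GRing.Theory Num.Theory.
Import numFieldNormedType.Exports.

Local Open Scope classical_set_scope.
Local Open Scope ring_scope.

(** * Boxes in the space of row vectors *)

Section row_vectors.
Context {R : realType} {d : nat}.
Implicit Types (v : 'rV[R]_d).

Definition box (B : 'I_d -> set R) : set 'rV[R]_d :=
  [set v | forall j, B j (v ord0 j)].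

Lemma box_bigcap (B : 'I_d -> set R) :
  box B = \bigcap_(j in setT) (coordinate j @^-1` B j).
Proof.
by apply/seteqP; split => v /= vB => [j _|j]; [exact: vB j|exact: vB j I].
Qed.

Lemma measurable_box (B : 'I_d -> set R) :
  (forall j, measurable (B j)) -> measurable (box B).
Proof.
move=> mB; rewrite box_bigcap; apply: fin_bigcap_measurable => // j _.
by rewrite -[X in measurable X]setTI; exact: measurable_coordinate.
Qed.

Definition boxes : set (set 'rV[R]_d) :=
  [set A | exists2 B, (forall j, measurable (B j)) & A = box B].

Definition rational_box (c : 'rV[rat]_d * nat) : set 'rV[R]_d :=
  box (fun j => ball (ratr (c.1 ord0 j) : R) c.2.+1%:R^-1).

Lemma rational_box_nbhs (U : set 'rV[R]_d) v : open U -> U v ->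
  exists2 c, rational_box c v & rational_box c `<=` U.
Proof.
move=> oU Uv; have : nbhs v U by apply: open_nbhs_nbhs.
move=> /nbhs_ballP[e /= e0 eU].
have [k ke] : exists k : nat, (k.+1%:R^-1 : R) < e / 2.
  exists (Num.trunc (2 / e)); rewrite invf_plt ?posrE// ?divr_gt0// invf_div.
  exact: Num.Theory.truncnS_gt.
have qex (j : 'I_d) : exists q : rat, ball (ratr q : R) k.+1%:R^-1 (v ord0 j).
  have [|q] := @rat_in_itvoo R (v ord0 j - k.+1%:R^-1) (v ord0 j + k.+1%:R^-1).
    by rewrite ltrBlDr -addrA ltrDl addr_gt0.
  rewrite in_itv/= => /andP[q1 q2]; exists q.
  rewrite -ball_normE /= ltr_norml.
  by rewrite ltrBrDl q1 ltrBlDl.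
have [q Hq] := choice qex.
exists (\row_j q j, k); first by move=> j /=; rewrite mxE.
move=> w wq; apply: eU; split => // i j.
rewrite (ord1 i); have := Hq j; have := wq j.
rewrite /= mxE -!ball_normE /= => h1 h2.
rewrite (le_lt_trans (ler_distD (ratr (q j)) _ _))// (splitr e) ltrD//.
  by rewrite distrC (lt_trans h2).
exact: lt_trans ke.
Qed.

Lemma open_rational_boxes (U : set 'rV[R]_d) : open U ->
  U = \bigcup_(c in [set c | rational_box c `<=` U]) rational_box c.
Proof.
move=> oU; apply/seteqP; split => [v Uv|v [c cU cv]]; last exact: cU.
by have [c cv cU] := rational_box_nbhs oU Uv; exists c.
Qed.

(** The Borel sets are defined from the open sets; since there are countably
    many rational boxes, every open set is a countable union of boxes, and so
    the Borel structure is that of the product. *)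
Lemma measurable_boxes : @measurable _ 'rV[R]_d = <<s boxes >>.
Proof.
apply/seteqP; split.
  apply: smallest_sub; first exact: smallest_sigma_algebra.
  move=> U oU; rewrite (open_rational_boxes oU).
  rewrite bigcup_mkcond.
  have := @countable_bigcupT_measurable _ (g_sigma_algebraType boxes)
    ('rV[rat]_d * nat)%type.
  apply; first exact: countableP.
  move=> c; case: ifP => _; last exact: measurable0.
  apply: sub_sigma_algebra; exists (fun j => ball (ratr (c.1 ord0 j) : R) c.2.+1%:R^-1) => //.
  by move=> j; exact: measurable_ball.
apply: smallest_sub; first exact: sigma_algebra_measurable.
by move=> _ [B mB ->]; exact: measurable_box.
Qed.

Lemma setI_closed_boxes : setI_closed boxes.
Proof.
move=> _ _ [A mA ->] [B mB ->]; exists (fun j => A j `&` B j).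
  by move=> j; exact: measurableI.
apply/seteqP; split => v /= => [[vA vB] j//|vAB].
by split=> j; have [] := vAB j.
Qed.

Lemma boxesT : boxes setT.
Proof. by exists (fun=> setT) => //; apply/seteqP; split. Qed.

Lemma measurable_fun_row d' (T : measurableType d') (D : set T)
    (X : T -> 'rV[R]_d) :
  (forall j, measurable_fun D (fun w => X w ord0 j)) -> measurable_fun D X.
Proof.
move=> mX mD; apply: (@measurability _ _ _ 'rV[R]_d D X boxes) => //; first exact: measurable_boxes.
move=> _ [_ [B mB ->] <-].
have -> : D `&` X @^-1` box B =
    D `&` \bigcap_(j in setT) (D `&` (fun w => X w ord0 j) @^-1` B j).
  apply/seteqP; split => w /= [Dw wB]; split => // j; first by move=> _; split=> //; exact: wB.
  by have [] := wB j I.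
by apply: measurableI => //; apply: fin_bigcap_measurable => // j _; exact: mX.
Qed.

End row_vectors.

(** * Domination of integrals *)

Import HBNNSimple.

Section domination.
Context d dE (Omega : measurableType d) (E : measurableType dE) (R : realType).
Variables (P : {measure set Omega -> \bar R}) (mu : {measure set E -> \bar R}).
Local Open Scope ereal_scope.

(** A bound that is known on indicator functions passes to sums of indicator
    functions and, by monotone convergence, to nonnegative functions. It is
    used twice in a row to pass from the joint law of two points to products
    of functions of them. *)
Lemma weighted_integral_le (g : Omega -> R) (z : Omega -> E) (a : \bar R)
    (psi : E -> R) :
  measurable_fun setT g -> (forall w, (0 <= g w)%R) ->
  measurable_fun setT z -> 0 <= a ->
  (forall S, measurable S ->
     \int[P]_w (g w * \1_S (z w))%:E <= a * mu S) ->
  measurable_fun setT psi -> (forall x, (0 <= psi x)%R) ->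
  \int[P]_w (g w * psi (z w))%:E <= a * \int[mu]_x (psi x)%:E.
Proof.
move=> mg g0 mz a0 gz mpsi psi0.
have mpsiE : measurable_fun setT (EFin \o psi) by exact/measurable_EFinP.
pose h := nnsfun_approx measurableT mpsiE.
have h_le n x : (h n x <= psi x)%R.
  have ndh : nondecreasing_seq (fun n => (h n x)%:E).
    by move=> m k mk; rewrite lee_fin; have /lefP := nd_nnsfun_approx measurableT mpsiE mk.
  have hcv := cvg_nnsfun_approx measurableT mpsiE (fun x _ => psi0 x : 0 <= (psi x)%:E) (I : setT x).
  rewrite -lee_fin; apply: (cvge_to_ge hcv).
  by near=> k; apply: ndh; near: k; exact: nbhs_infty_ge.
have step n : \int[P]_w (g w * h n (z w))%:E <= a * \int[mu]_x (psi x)%:E.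
  apply: (@le_trans _ _ (a * \int[mu]_x (h n x)%:E)); last first.
    apply: lee_wpmul2l => //; apply: ge0_le_integral => //.
    - by move=> x _; rewrite lee_fin.
    - by apply/measurable_EFinP.
    - by move=> x _; rewrite lee_fin.
  pose s := finmap.enum_fset (fset_set (range (h n))).
  have hE x : h n x = (\sum_(r <- s) `|r| * \1_(h n @^-1` [set r]) x)%R.
    rewrite fimfunE fsbig_finite//=; apply: eq_big_seq => r.
    rewrite in_fset_set// inE => -[y _ <-].
    by rewrite ger0_norm.
  under eq_integral do rewrite hE mulr_sumr -sumEFin.
  under [X in _ <= _ * X]eq_integral do rewrite hE -sumEFin.
  have mI r : measurable (h n @^-1` [set r]) by [].
  rewrite ge0_integral_sum; last 3 first.
  - by [].
  - move=> r; apply/measurable_EFinP; apply: measurable_funM => //.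
    apply: measurable_funM => //.
    exact: measurableT_comp.
  - by move=> r w _; rewrite lee_fin !mulr_ge0.
  rewrite ge0_integral_sum; last 3 first.
  - by [].
  - move=> r; apply/measurable_EFinP; exact: measurable_funM.
  - by move=> r w _; rewrite lee_fin !mulr_ge0.
  rewrite ge0_sume_distrr; last first.
    by move=> r _; apply: integral_ge0 => x _; rewrite lee_fin mulr_ge0.
  apply: lee_sum => r _.
  under eq_integral do rewrite mulrCA EFinM.
  under [X in _ <= _ * X]eq_integral do rewrite EFinM.
  rewrite ge0_integralZl_EFin; last 4 first.
  - by [].
  - by move=> w _; rewrite lee_fin mulr_ge0.
  - apply/measurable_EFinP; apply: measurable_funM => //.
    exact: measurableT_comp.
  - exact: normr_ge0.
  rewrite ge0_integralZl_EFin; last 4 first.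
  - by [].
  - by move=> x _; rewrite lee_fin.
  - exact/measurable_EFinP.
  - exact: normr_ge0.
  rewrite integral_indic// setIT muleCA.
  by apply: lee_wpmul2l => //; exact: gz.
have cvI : \int[P]_w (g w * h n (z w))%:E @[n --> \oo] -->
    \int[P]_w (g w * psi (z w))%:E.
  rewrite [X in _ --> X](_ : _ = \int[P]_w (limn (fun n => (g w * h n (z w))%:E))).
    apply: cvg_monotone_convergence => //.
    - move=> n; apply/measurable_EFinP; apply: measurable_funM => //.
      exact: measurableT_comp.
    - by move=> n w _; rewrite lee_fin mulr_ge0.
    - move=> w _ m k mk; rewrite lee_fin ler_wpM2l//.
      by have /lefP := nd_nnsfun_approx measurableT mpsiE mk.
  apply: eq_integral => w _; apply/esym/cvg_lim => //.
  exact: (cvgeZl (y := (g w)%:E) _ (cvg_nnsfun_approx measurableT mpsiE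
    (fun x _ => psi0 x : 0 <= (psi x)%:E) (I : setT (z w)))).
apply: (cvge_to_le cvI).
by near=> n; exact: step.
Unshelve. all: by end_near. Qed.

End domination.

Lemma measurable_set_le d (T : measurableType d) (R : realType) (f g : T -> R) :
  measurable_fun setT f -> measurable_fun setT g ->
  measurable [set w | f w <= g w].
Proof.
move=> mf mg.
have := measurable_fun_ler mf mg => /(_ measurableT [set true]).
by rewrite setTI; apply.
Qed.

Lemma measurable_set_lt d (T : measurableType d) (R : realType) (f g : T -> R) :
  measurable_fun setT f -> measurable_fun setT g ->
  measurable [set w | f w < g w].
Proof.
move=> mf mg.
have := measurable_fun_ltr mf mg => /(_ measurableT [set true]).
by rewrite setTI; apply.
Qed.

(** * Samples with weakly dependent points *)

(** Each observation is the average of two members. Antithetic pairs have this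
    form, and a single point is treated as a pair of equal members. *)
Definition pair_mean (E : Type) (R : realType) (N : nat) (phi : E -> R)
    (z : nat -> bool -> E) : R :=
  N%:R^-1 * \sum_(i < N) (2^-1 * (phi (z i false) + phi (z i true))).

Lemma measurable_pair_mean d (Omega : measurableType d) dE
    (E : measurableType dE) (R : realType) (N : nat)
    (z : nat -> bool -> Omega -> E) (phi : E -> R) :
  measurable_fun setT phi ->
  (forall i b, (i < N)%N -> measurable_fun setT (z i b)) ->
  measurable_fun setT (fun w => pair_mean N phi (fun i b => z i b w)).
Proof.
move=> mphi mz; apply: measurable_funM; first exact: measurable_cst.
have H (i : 'I_N) b : measurable_fun setT (fun w => phi (z i b w)).
  by apply: measurableT_comp => //; exact: mz.
apply: measurable_sum => i; apply: measurable_funM; first exact: measurable_cst.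
by apply: measurable_funD; exact: H.
Qed.

Section design.
Context d dE (Omega : measurableType d) (E : measurableType dE) (R : realType).
Variables (P : probability Omega R) (mu : probability E R).

(** The members of one pair may depend on each other in any way. Members of
    different pairs need not be independent, but their joint law is dominated
    by a multiple of the product law. With c = 1 + K/N this is all that the
    laws of large numbers below use of a sampling method. *)
Definition design (N : nat) (c : R) (z : nat -> bool -> Omega -> E) : Prop :=
  [/\ forall i b, (i < N)%N -> measurable_fun setT (z i b),
      forall i b S, (i < N)%N -> measurable S -> P (z i b @^-1` S) = mu S &
      forall i i' b b' S S', (i < N)%N -> (i' < N)%N -> i != i' ->
        measurable S -> measurable S' ->
        (P (z i b @^-1` S `&` z i' b' @^-1` S') <= c%:E * mu S * mu S')%E].

Variables (N : nat) (c : R) (z : nat -> bool -> Omega -> E).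
Hypotheses (N0 : (0 < N)%N) (c0 : 0 <= c) (zP : design N c z).
Local Open Scope ereal_scope.

Lemma design_integral (psi : E -> R) i b : (i < N)%N ->
  measurable_fun setT psi -> (forall x, (0 <= psi x)%R) ->
  \int[P]_w (psi (z i b w))%:E = \int[mu]_x (psi x)%:E.
Proof.
move=> iN mpsi psi0; have [mz zmu _] := zP.
have mzi := mz i b iN.
rewrite [RHS](@eq_measure_integral _ _ _ _ (pushforward P (z i b))); last first.
  by move=> A mA _; apply/esym; exact: (zmu i b A).
rewrite ge0_integral_pushforward//; first exact/measurable_EFinP.
by move=> x _; rewrite lee_fin.
Qed.

(** The domination of the joint law only bounds expectations of nonnegative
    functions from above; this is why psi is nonnegative here. *)
Lemma design_cross (psi : E -> R) i i' b b' : (i < N)%N -> (i' < N)%N ->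
  i != i' -> measurable_fun setT psi -> (forall x, (0 <= psi x)%R) ->
  \int[P]_w (psi (z i b w) * psi (z i' b' w))%:E <=
  c%:E * \int[mu]_x (psi x)%:E * \int[mu]_x (psi x)%:E.
Proof.
move=> iN i'N ii' mpsi psi0; have [mz zmu zz] := zP.
have mzi := mz i b iN; have mzi' := mz i' b' i'N.
have int0 : 0 <= \int[mu]_x (psi x)%:E.
  by apply: integral_ge0 => x _; rewrite lee_fin.
apply: weighted_integral_le => //.
- exact: measurableT_comp.
- by rewrite mule_ge0.
move=> S' mS'.
under eq_integral do rewrite mulrC.
rewrite -muleA (muleC _ (mu S')) muleA.
apply: weighted_integral_le => //.
- exact: measurableT_comp.
- by rewrite mule_ge0.
move=> S mS.
have mSS' : measurable (z i b @^-1` S `&` z i' b' @^-1` S').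
  by apply: measurableI; rewrite -[X in measurable X]setTI; [exact: mzi|exact: mzi'].
have := zz i i' b b' S S' iN i'N ii' mS mS'.
rewrite -!muleA (muleC (mu S)); apply: le_trans.
rewrite -[X in _ <= P X]setIT -integral_indic//.
apply: ge0_le_integral => //=.
- by apply/measurable_EFinP; apply: measurable_funM; exact: measurableT_comp.
- exact/measurable_EFinP.
- move=> w _; rewrite lee_fin !indicE -natrM mulnb ler_nat.
  by case: (boolP (_ && _)) => // /andP[/set_mem h' /set_mem h]; rewrite mem_set.
Qed.

Lemma pair_meanE (phi : E -> R) (y : nat -> bool -> E) :
  pair_mean N phi y =
  ((N * 2)%:R^-1 * \sum_(p : 'I_N * bool) phi (y p.1 p.2))%R.
Proof.
have -> : (\sum_(p : 'I_N * bool) phi (y p.1 p.2) =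
    \sum_(i < N) \sum_(b : bool) phi (y i b))%R by rewrite pair_bigA.
rewrite /pair_mean natrM invfM -mulrA; congr (_ * _)%R.
rewrite mulr_sumr; apply: eq_bigr => i _.
by rewrite big_bool/= addrC.
Qed.

(** Of the (2N)^2 products of members, those of equal index are bounded by V;
    the others by c m^2. *)
Lemma design_second_moment (psi : E -> R) (m V : R) :
  measurable_fun setT psi -> (forall x, (0 <= psi x)%R) ->
  \int[mu]_x (psi x)%:E = m%:E -> \int[mu]_x (psi x ^+ 2)%:E <= V%:E ->
  \int[P]_w ((pair_mean N psi (fun i b => z i b w)) ^+ 2)%:E <=
  (V / N%:R + c * m ^+ 2)%:E.
Proof.
move=> mpsi psi0 intm intV.
pose k : R := ((N * 2)%:R ^- 2)%R.
have meanE w : ((pair_mean N psi (fun i b => z i b w)) ^+ 2 =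
    \sum_(p : 'I_N * bool) \sum_(q : 'I_N * bool)
      (k * (psi (z p.1 p.2 w) * psi (z q.1 q.2 w))))%R.
  rewrite pair_meanE exprMn exprVn [X in (_ * X)%R]expr2 big_distrlr/= mulr_sumr.
  by apply: eq_bigr => p _; rewrite mulr_sumr.
under eq_integral do rewrite meanE -sumEFin.
under eq_integral do under eq_bigr do rewrite -sumEFin.
have mz (p : 'I_N * bool) : measurable_fun setT (z p.1 p.2).
  by have [mz _ _] := zP; exact: mz.
have k0 : (0 <= k)%R by rewrite invr_ge0 exprn_ge0.
have V0 : (0 <= V)%R.
  rewrite -lee_fin; apply: le_trans intV; apply: integral_ge0 => x _.
  by rewrite lee_fin sqr_ge0.
have mterm (p q : 'I_N * bool) : measurable_fun setT
    (fun w => (k * (psi (z p.1 p.2 w) * psi (z q.1 q.2 w)))%:E).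
  apply/measurable_EFinP; apply: measurable_funM => //.
  by apply: measurable_funM; exact: measurableT_comp.
have term (p q : 'I_N * bool) :
    \int[P]_w (k * (psi (z p.1 p.2 w) * psi (z q.1 q.2 w)))%:E <=
    (k * ((p.1 == q.1)%:R * V + c * m ^+ 2))%:E.
  under eq_integral do rewrite EFinM.
  rewrite ge0_integralZl_EFin//; last 2 first.
  - by move=> w _; rewrite lee_fin mulr_ge0.
  - by apply/measurable_EFinP; apply: measurable_funM; exact: measurableT_comp.
  rewrite EFinM; apply: lee_wpmul2l; first by rewrite lee_fin.
  have [pq|pq] := eqVneq p.1 q.1; last first.
    rewrite mul0r add0r expr2 !EFinM -intm muleA.
    exact: design_cross.
  rewrite mul1r (@le_trans _ _ V%:E)//; last by rewrite lee_fin lerDl mulr_ge0// sqr_ge0.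
  have mpsi2 : measurable_fun setT (fun x => psi x ^+ 2)%R by exact: measurable_funX.
  have sq (r : 'I_N * bool) : \int[P]_w (psi (z r.1 r.2 w) ^+ 2)%:E <= V%:E.
    rewrite (@design_integral (fun x => psi x ^+ 2)%R)// => x; exact: sqr_ge0.
  have msq (r : 'I_N * bool) : measurable_fun setT (fun w => (psi (z r.1 r.2 w) ^+ 2)%:E).
    by apply/measurable_EFinP; exact: (measurableT_comp mpsi2).
  apply: (@le_trans _ _ (\int[P]_w ((2^-1)%:E * ((psi (z p.1 p.2 w) ^+ 2)%:E + (psi (z q.1 q.2 w) ^+ 2)%:E)))).
    apply: ge0_le_integral => //.
    - by move=> w _; rewrite lee_fin mulr_ge0.
    - by apply/measurable_EFinP; apply: measurable_funM; exact: measurableT_comp.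
    - by apply: emeasurable_funM => //; exact: emeasurable_funD.
    - move=> w _; rewrite -EFinD -EFinM lee_fin.
      have := sqr_ge0 (psi (z p.1 p.2 w) - psi (z q.1 q.2 w)); lra.
  rewrite ge0_integralZl_EFin//; last 2 first.
  - by move=> w _; rewrite -EFinD lee_fin addr_ge0 ?sqr_ge0.
  - exact: emeasurable_funD.
  rewrite ge0_integralD//; last 2 first.
  - by move=> w _; rewrite lee_fin sqr_ge0.
  - by move=> w _; rewrite lee_fin sqr_ge0.
  have -> : V%:E = (2^-1)%:E * (V%:E + V%:E) by rewrite -EFinD -EFinM; congr EFin; lra.
  by apply: lee_wpmul2l; rewrite ?lee_fin// leeD.
rewrite ge0_integral_sum//; last 2 first.
- by move=> p; apply: emeasurable_sum.
- by move=> p w _; apply: sume_ge0 => q _; rewrite lee_fin !mulr_ge0.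
apply: (@le_trans _ _ (\sum_(p : 'I_N * bool) \sum_(q : 'I_N * bool)
   (k * ((p.1 == q.1)%:R * V + c * m ^+ 2))%:E)).
  apply: lee_sum => p _; rewrite ge0_integral_sum//; last first.
    by move=> q w _; rewrite lee_fin !mulr_ge0.
  by apply: lee_sum => q _; exact: term.
under eq_bigr do rewrite sumEFin.
rewrite sumEFin lee_fin.
have Nn0 : (N%:R != 0 :> R)%R by rewrite pnatr_eq0 -lt0n.
rewrite [leLHS](_ : _ = \sum_(p : 'I_N * bool)
    (k * (2 * V + (N * 2)%:R * (c * m ^+ 2))))%R; last first.
  apply: eq_bigr => p _; rewrite -mulr_sumr big_split/= sumr_const card_prod card_ord card_bool.
  congr (_ * (_ + _))%R; last by rewrite mulr_natl.
  rewrite -mulr_suml; congr (_ * _)%R.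
  have -> : (\sum_(q : 'I_N * bool) (p.1 == q.1)%:R =
    \sum_(i < N) \sum_(b : bool) (p.1 == i)%:R :> R)%R by rewrite pair_bigA.
  rewrite (bigD1 p.1)//= [X in (_ + X)%R]big1 ?addr0; first by rewrite sumr_const card_bool ?eqxx.
  by move=> i; rewrite eq_sym => /negPf ->; rewrite big1.
rewrite sumr_const card_prod card_ord card_bool -mulr_natl /k natrM.
rewrite le_eqVlt; apply/orP; left; apply/eqP; field.
exact: Nn0.
Qed.

Lemma design_chebyshev (psi : E -> R) (m V delta : R) : (0 < delta)%R ->
  measurable_fun setT psi -> (forall x, (0 <= psi x)%R) ->
  \int[mu]_x (psi x)%:E = m%:E -> \int[mu]_x (psi x ^+ 2)%:E <= V%:E ->
  P [set w | delta <= `|pair_mean N psi (fun i b => z i b w) - m|]%R <=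
  ((V / N%:R + (c - 1) * m ^+ 2) / delta ^+ 2)%:E.
Proof.
move=> delta0 mpsi psi0 intm intV.
have m0 : (0 <= m)%R.
  by rewrite -lee_fin -intm; apply: integral_ge0 => x _; rewrite lee_fin.
pose X w := pair_mean N psi (fun i b => z i b w).
have X0 w : (0 <= X w)%R.
  rewrite /X /pair_mean mulr_ge0// sumr_ge0// => i _.
  by rewrite mulr_ge0// addr_ge0.
have mg i b : (i < N)%N -> measurable_fun setT (fun w => psi (z i b w)).
  by move=> iN; apply: measurableT_comp => //; have [mz _ _] := zP; exact: mz.
have mX : measurable_fun setT X.
  apply: measurable_funM => //; apply: measurable_sum => i.
  by apply: measurable_funM => //; apply: measurable_funD; exact: mg.
have EX : \int[P]_w (X w)%:E = m%:E.
  under eq_integral do rewrite /X pair_meanE EFinM -sumEFin.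
  rewrite ge0_integralZl_EFin//; last 2 first.
  - by move=> w _; apply: sume_ge0 => p _; rewrite lee_fin.
  - by apply: emeasurable_sum => p; apply/measurable_EFinP; exact: mg.
  rewrite ge0_integral_sum//; last 2 first.
  - by move=> p; apply/measurable_EFinP; exact: mg.
  - by move=> p w _; rewrite lee_fin.
  under eq_bigr do rewrite design_integral// intm.
  rewrite sumEFin sumr_const card_prod card_ord card_bool -(mulr_natl m) -EFinM.
  congr EFin; rewrite mulKf// pnatr_eq0 muln_eq0 negb_or -lt0n N0//.
have mY : measurable_fun setT (fun w => ((X w - m) ^+ 2)%:E).
  apply/measurable_EFinP; apply: (measurable_funX 2).
  exact: measurable_funB.
have VX : \int[P]_w ((X w - m) ^+ 2)%:E <= (V / N%:R + (c - 1) * m ^+ 2)%:E.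
  (* The variance is expanded with the cross term on the other side, so that
     all the integrands are nonnegative. *)
  have key : \int[P]_w ((X w - m) ^+ 2)%:E + (2 * m ^+ 2)%:E =
             \int[P]_w (X w ^+ 2)%:E + (m ^+ 2)%:E.
    have <- : (2 * m)%:E * m%:E = (2 * m ^+ 2)%:E by rewrite -EFinM; congr EFin; ring.
    rewrite -EX -ge0_integralZl_EFin//; last 3 first.
    - by move=> w _; rewrite lee_fin.
    - exact/measurable_EFinP.
    - by rewrite mulr_ge0.
    rewrite -ge0_integralD//; last 3 first.
    - by move=> w _; rewrite lee_fin sqr_ge0.
    - by move=> w _; rewrite -EFinM lee_fin mulr_ge0// mulr_ge0.
    - by apply: emeasurable_funM => //; exact/measurable_EFinP.
    have -> : (m ^+ 2)%:E = \int[P]_w (m ^+ 2)%:E.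
      by rewrite integral_cst//= probability_setT mule1.
    rewrite -ge0_integralD//; last 3 first.
    - by move=> w _; rewrite lee_fin sqr_ge0.
    - by apply/measurable_EFinP; exact: (measurable_funX 2).
    - by move=> w _; rewrite lee_fin sqr_ge0.
    apply: eq_integral => w _; rewrite -EFinM -!EFinD; congr EFin; ring.
  have X2 := design_second_moment mpsi psi0 intm intV.
  suff : \int[P]_w ((X w - m) ^+ 2)%:E + (2 * m ^+ 2)%:E <=
      (V / N%:R + (c - 1) * m ^+ 2)%:E + (2 * m ^+ 2)%:E by rewrite leeD2rE.
  rewrite key; apply: (le_trans (leeD2r _ X2)); rewrite -!EFinD lee_fin; lra.
have d20 : (0 < delta ^+ 2)%R by rewrite exprn_gt0.
have := le_integral_abse P measurableT mY d20.
rewrite setTI; under eq_integral do rewrite gee0_abs ?lee_fin ?sqr_ge0//.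
move=> /le_trans/(_ VX); rewrite muleC -lee_pdivlMr//.
rewrite -EFinM; apply: le_trans; rewrite le_eqVlt; apply/orP; left; apply/eqP.
congr (P _); apply/seteqP; split => w /=;
  by rewrite lee_fin normrX ler_pXn2r ?nnegrE ?(ltW delta0).
Qed.

(** A bound for the covariances is available for nonnegative functions only,
    so phi is split into its positive and its negative part, each of which may
    deviate by delta/2: this is the origin of the factor 8. *)
Lemma design_lln (phi : E -> R) (V K delta : R) : (0 < delta)%R -> (0 <= K)%R ->
  c = (1 + K / N%:R)%R -> measurable_fun setT phi ->
  \int[mu]_x (phi x ^+ 2)%:E <= V%:E ->
  P [set w | delta <= `|pair_mean N phi (fun i b => z i b w) -
                        (\int[mu]_x phi x)|]%R <=
  (8 * (1 + K) * V / (N%:R * delta ^+ 2))%:E.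
Proof.
move=> delta0 K0 cK mphi intV.
have V0 : (0 <= V)%R.
  rewrite -lee_fin; apply: le_trans intV; apply: integral_ge0 => x _.
  by rewrite lee_fin sqr_ge0.
have half (psi : E -> R) : measurable_fun setT psi -> (forall x, (0 <= psi x)%R) ->
    (forall x, psi x <= `|phi x|)%R ->
    mu.-integrable setT (EFin \o psi) /\
    P [set w | delta / 2 <= `|pair_mean N psi (fun i b => z i b w) - \int[mu]_x psi x|]%R <=
      (4 * (1 + K) * V / (N%:R * delta ^+ 2))%:E.
  move=> mpsi psi0 psile.
  have mpsi2 : measurable_fun setT (fun x => (psi x ^+ 2)%:E).
    by apply/measurable_EFinP; exact: (measurable_funX 2).
  have mpsiE : measurable_fun setT (fun x => (psi x)%:E) by exact/measurable_EFinP.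
  have int2 : \int[mu]_x (psi x ^+ 2)%:E <= V%:E.
    apply: le_trans intV; apply: ge0_le_integral => //.
    - by move=> x _; rewrite lee_fin sqr_ge0.
    - by apply/measurable_EFinP; exact: (measurable_funX 2).
    - move=> x _; rewrite lee_fin -(real_normK (num_real (phi x))).
      by rewrite ler_pXn2r ?nnegrE.
  have int1 : \int[mu]_x (2 * psi x)%:E <= (V + 1)%:E.
    apply: (@le_trans _ _ (\int[mu]_x ((psi x ^+ 2)%:E + 1%:E))).
      apply: ge0_le_integral => //.
      - by move=> x _; rewrite lee_fin mulr_ge0.
      - by apply/measurable_EFinP; exact: measurable_funM.
      - exact: emeasurable_funD.
      - by move=> x _; rewrite -EFinD lee_fin; have := sqr_ge0 (psi x - 1); lra.
    rewrite ge0_integralD//; last by move=> x _; rewrite lee_fin sqr_ge0.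
    rewrite integral_cst//= probability_setT mule1 EFinD leeD2r//.
  pose m := (\int[mu]_x psi x)%R.
  have intm : \int[mu]_x (psi x)%:E = m%:E.
    rewrite /m /Rintegral fineK// ge0_fin_numE; last first.
      by apply: integral_ge0 => x _; rewrite lee_fin.
    apply: le_lt_trans (ltry (V + 1)); apply: le_trans int1.
    apply: ge0_le_integral => //.
    - by move=> x _; rewrite lee_fin.
    - by apply/measurable_EFinP; exact: measurable_funM.
    - by move=> x _; rewrite lee_fin; have := psi0 x; lra.
  have m0 : (0 <= m)%R.
    by rewrite -lee_fin -intm; apply: integral_ge0 => x _; rewrite lee_fin.
  have mV : (m ^+ 2 <= V)%R.
    have : (2 * m)%:E * m%:E <= (V + m ^+ 2)%:E.
      rewrite -intm -ge0_integralZl_EFin//; last 2 first.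
      - by move=> x _; rewrite lee_fin.
      - by rewrite mulr_ge0.
      apply: (@le_trans _ _ (\int[mu]_x ((psi x ^+ 2)%:E + (m ^+ 2)%:E))).
        apply: ge0_le_integral => //.
        - by move=> x _; rewrite -EFinM lee_fin !mulr_ge0.
        - by apply: emeasurable_funM.
        - exact: emeasurable_funD.
        - by move=> x _; rewrite -EFinD -EFinM lee_fin; have := sqr_ge0 (psi x - m); lra.
      rewrite ge0_integralD//; last 2 first.
      - by move=> x _; rewrite lee_fin sqr_ge0.
      - by move=> x _; rewrite lee_fin sqr_ge0.
      by rewrite integral_cst//= probability_setT mule1 EFinD leeD2r.
    by rewrite -EFinM lee_fin; lra.
  have d20 : (0 < delta / 2)%R by rewrite divr_gt0.
  split.
    apply/integrableP; split=> //=.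
    under eq_integral do rewrite /= ger0_norm//.
    by rewrite intm ltry.
  have := design_chebyshev d20 mpsi psi0 intm int2.
  move=> /le_trans; apply; rewrite lee_fin cK.
  have Nn0 : (0 < N%:R :> R)%R by rewrite ltr0n.
  rewrite (_ : (V / N%:R + (1 + K / N%:R - 1) * m ^+ 2) / (delta / 2) ^+ 2 =
    4 * (V + K * m ^+ 2) / (N%:R * delta ^+ 2))%R; last first.
    by field; rewrite !gt_eqF.
  rewrite ler_pM2r ?invr_gt0 ?mulr_gt0 ?exprn_gt0//.
  rewrite -mulrA ler_pM2l// mulrDl mul1r lerD2l.
  by rewrite ler_wpM2l.
pose pos x := Num.max (phi x) 0%R; pose neg x : R := Num.max (- phi x)%R 0%R.
have mpos : measurable_fun setT pos by exact: measurable_maxr.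
have mneg : measurable_fun setT neg.
  by apply: measurable_maxr => //; exact: measurableT_comp.
have pos0 x : (0 <= pos x)%R by rewrite le_max lexx orbT.
have neg0 x : (0 <= neg x)%R by rewrite le_max lexx orbT.
have [ipos Ppos] := half pos mpos pos0 (fun x => ltac:(rewrite ge_max ler_norm normr_ge0 //)).
have [ineg Pneg] := half neg mneg neg0 (fun x => ltac:(rewrite ge_max normr_ge0 andbT -normrN ler_norm //)).
have phiE x : (phi x = pos x - neg x)%R.
  rewrite /pos /neg; have [p0|p0] := leP 0%R (phi x).
    by rewrite (max_idPr _) ?subr0// oppr_le0.
  by rewrite (max_idPl _) ?sub0r ?opprK// oppr_ge0 ltW.
have intE : (\int[mu]_x phi x = \int[mu]_x pos x - \int[mu]_x neg x)%R.
  by rewrite -RintegralB//; apply: eq_Rintegral => x _; exact: phiE.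
have meanB w : (pair_mean N phi (fun i b => z i b w) =
    pair_mean N pos (fun i b => z i b w) - pair_mean N neg (fun i b => z i b w))%R.
  rewrite !pair_meanE -mulrBr -sumrB; congr (_ * _)%R; apply: eq_bigr => p _.
  exact: phiE.
have mmean (psi : E -> R) e r : measurable_fun setT psi ->
    measurable [set w | (e <= `|pair_mean N psi (fun i b => z i b w) - r|)%R].
  move=> mpsi; apply: measurable_set_le => //.
  apply: measurableT_comp => //; apply: measurable_funB => //.
  by apply: measurable_pair_mean => //; have [] := zP.
apply: (@le_trans _ _ (P ([set w | delta / 2 <= `|pair_mean N pos (fun i b => z i b w) - \int[mu]_x pos x|]%R `|`
   [set w | delta / 2 <= `|pair_mean N neg (fun i b => z i b w) - \int[mu]_x neg x|]%R))).
  apply: le_measure; rewrite ?inE; [exact: mmean|by apply: measurableU; exact: mmean|].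
  move=> w /=; rewrite meanB intE => h.
  have [//|h1] := leP (delta / 2)%R `|pair_mean N pos (fun i b => z i b w) - \int[mu]_x pos x|%R; first by left.
  right; rewrite leNgt; apply/negP => h2.
  move: h; apply/negP; rewrite -ltNge.
  rewrite opprD addrACA -opprD.
  by rewrite (le_lt_trans (ler_normB _ _))// (splitr delta) ltrD.
apply: le_trans (measureU2 _ _ _) _; [exact: mmean|exact: mmean|].
apply: (le_trans (leeD Ppos Pneg)); rewrite -EFinD lee_fin.
lra.
Qed.

End design.

(** * Mixtures of laws and the inverse transform *)

(** The distribution of a map is only defined for maps that are bundled with a
    proof of their measurability. *)
Definition mfun_of d d' (T : sigmaRingType d) (T' : sigmaRingType d')
    (f : T -> T') (mf : measurable_fun setT f) : {mfun T >-> T'} :=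
  HB.pack_for {mfun T >-> T'} f (isMeasurableFun.Build _ _ _ _ f mf).

Section mixture_of_laws.
Context d dT (Omega : measurableType d) (T : measurableType dT) (R : realType).
Variables (P : probability Omega R) (I : finType) (X : I -> Omega -> T).
Hypothesis mX : forall i, measurable_fun setT (X i).
Variables (G : set (set T)) (g : (set T)^nat).
Hypotheses (mG : @measurable _ T = <<s G >>) (GI : setI_closed G).
Hypotheses (Gg : forall k, G (g k)) (gT : \bigcup_k g k = setT).
Local Open Scope ereal_scope.

Let law (k : nat) : {measure set T -> \bar R} :=
  if insub k is Some o then distribution P (mfun_of (mX (enum_val (o : 'I_#|I|))))
  else mzero.

Let law_sum A : msum law #|I| A = \sum_i P (X i @^-1` A).
Proof.
rewrite /msum; transitivity (\sum_(k < #|I|) P (X (enum_val k) @^-1` A)).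
  by apply: eq_bigr => k _; rewrite /law valK.
by rewrite -(big_enum_val (fun i => P (X i @^-1` A))).
Qed.

(** Both sides are measures, so that it suffices to compare them on a
    generating class that is stable under intersections. The sum is over the
    strata of a Latin hypercube; one index gives the uniqueness of a single
    law. *)
Lemma mixture_unique (c : R) (nu : {measure set T -> \bar R}) : (0 <= c)%R ->
  (forall A, G A -> \sum_i P (X i @^-1` A) = c%:E * nu A) ->
  forall A, measurable A -> \sum_i P (X i @^-1` A) = c%:E * nu A.
Proof.
move=> c0 eqG A mA; rewrite -law_sum.
apply: (measure_unique G g mG GI Gg gT (msum law #|I|) (mscale (NngNum c0) nu)) => //.
  by move=> B GB; apply: etrans (law_sum _) _; exact: eqG.
move=> k; rewrite [X in X < _](law_sum (g k)); apply: lte_sum_pinfty => i _.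
rewrite (le_lt_trans (probability_le1 _ _)) ?ltry//.
rewrite -[X in measurable X]setTI; apply: mX => //.
by rewrite mG; apply: sub_sigma_algebra.
Qed.

End mixture_of_laws.

Section uniform_strata.
Context d (Omega : measurableType d) (R : realType).
Variable P : probability Omega R.

Lemma uniform_on_cdf (a b : R) (U : {RV P >-> R}) : uniform_on a b U -> a < b ->
  forall s, P [set w | U w <= s] =
    (Num.max 0 (Num.min 1 ((s - a) / (b - a))))%:E.
Proof.
move=> [Uab [ab Ulaw]] _ s.
have ba0 : 0 < b - a by rewrite subr_gt0.
have [sa|sa] := leP s a.
  rewrite (_ : [set _ | _] = set0); last first.
    apply/seteqP; split => // w /= Us.
    by have /andP[] := Uab w; rewrite ltNge (le_trans Us sa).
  rewrite measure0 (max_idPl _)// ge_min; apply/orP; right.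
  by rewrite pmulr_lle0 ?invr_gt0// subr_le0.
have [bs|bs] := leP b s.
  rewrite (_ : [set _ | _] = setT); last first.
    apply/seteqP; split => // w _ /=.
    by have /andP[_ /ltW] := Uab w => /le_trans; apply.
  rewrite probability_setT (min_idPl _) ?(max_idPr _)//.
  by rewrite ler_pdivlMr// mul1r lerD2r.
transitivity (distribution P U `]-oo, s]).
  by congr (P _); apply/seteqP; split => w /=; rewrite in_itv.
rewrite Ulaw//= /uniform_prob integral_uniform_pdf.
have -> : `]-oo, s] `&` `[a, b] = `[a, s]%classic.
  apply/seteqP; split => x /=; rewrite !in_itv/=.
    by move=> [-> /andP[->]].
  by move=> /andP[-> xs]; rewrite xs (le_trans xs (ltW bs)).
rewrite (eq_integral (fun=> (b - a)^-1%:E)); last first.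
  move=> x; rewrite inE/= in_itv/= => /andP[ax xs].
  by rewrite /uniform_pdf ax (le_trans xs (ltW bs)).
rewrite integral_cst//= lebesgue_measure_itv/= lte_fin sa -EFinD -EFinM mulrC.
rewrite (min_idPr _) ?(max_idPr _)//.
  by rewrite divr_ge0// ltW// subr_gt0.
by rewrite ler_pdivrMr// mul1r lerD2r ltW.
Qed.

(** The mixture of the uniform laws on the n strata is n times the uniform law
    on the unit interval. *)
Lemma sum_strata (n : nat) (s : R) : (0 < n)%N -> 0 <= s <= 1 ->
  \sum_(i < n) Num.max 0 (Num.min 1
    ((s - i%:R / n%:R) / (i.+1%:R / n%:R - i%:R / n%:R))) = n%:R * s.
Proof.
move=> n0 /andP[s0 s1].
have nR : 0 < n%:R :> R by rewrite ltr0n.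
under eq_bigr => i _.
  have -> : (s - i%:R / n%:R) / (i.+1%:R / n%:R - i%:R / n%:R) = n%:R * s - i%:R :> R.
    have e : i.+1%:R - i%:R = 1 :> R by rewrite -natr1 addrAC subrr add0r.
    by rewrite -mulrBl e mul1r invrK mulrBl divfK ?gt_eqF// mulrC.
  over.
(* Telescoping: the first m strata cover the part of the interval below m/n. *)
have H m : \sum_(i < m) Num.max 0 (Num.min 1 (n%:R * s - i%:R)) =
    Num.min (n%:R * s) m%:R :> R.
  elim: m => [|m IH]; first by rewrite big_ord0 (min_idPr _)// mulr_ge0.
  rewrite big_ord_recr/= IH -natr1.
  by rewrite /Num.min/Num.max; do ! case: ifPn => //; rewrite -?leNgt; lra.
by rewrite H (min_idPl _)// ler_piMr// ltW.
Qed.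

End uniform_strata.

Section inverse_transform.
Context d (Omega : measurableType d) (R : realType).
Variable P : probability Omega R.

(** The Galois connection between a distribution function and its inverse; it
    turns the events on the transformed variables into events on the uniform
    ones. *)
Lemma inverse_cdf_le (F G : R -> R) u t : {homo F : x y / x <= y} ->
  inverse_cdf F G -> 0 < u < 1 -> (G u <= t) = (u <= F t).
Proof.
move=> Fnd [FG GF] u01; apply/idP/idP => [Gt|ut].
  by rewrite -(FG u u01); exact: Fnd.
rewrite leNgt; apply/negP => tG.
have Ft : F t = u by apply/eqP; rewrite eq_le ut andbT -[leRHS](FG u u01) Fnd// ltW.
by move: tG; rewrite -{1}Ft GF ?Ft// ltxx.
Qed.

Lemma inverse_cdf_measurable (F G : R -> R) (U : Omega -> R) :
  {homo F : x y / x <= y} -> inverse_cdf F G ->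
  measurable_fun setT U -> (forall w, 0 < U w < 1) ->
  measurable_fun setT (G \o U).
Proof.
move=> Fnd FG mU U01.
apply: (measurability _ (measurable_realfun.RGenOInfty.measurableE R)).
move=> _ [_ [t ->] <-]; rewrite setTI.
have -> : (G \o U) @^-1` `]t, +oo[ = [set w | F t < U w].
  apply/seteqP; split => w /=; rewrite in_itv/= andbT.
    by rewrite !ltNge (inverse_cdf_le _ Fnd FG).
  by rewrite !ltNge (inverse_cdf_le _ Fnd FG).
exact: measurable_set_lt.
Qed.

Variables (dxi : nat) (mu : probability 'rV[R]_dxi R) (j : 'I_dxi).

Lemma component_cdfE t :
  mu (coordinate j @^-1` `]-oo, t]) = (component_cdf mu j t)%:E.
Proof.
rewrite /component_cdf fineK//; apply: fin_num_measure.
exact: measurable_itv.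
Qed.

Lemma component_cdf_homo : {homo component_cdf mu j : s t / s <= t}.
Proof.
move=> s t st; rewrite -lee_fin -!component_cdfE.
exact: (cdf_nondecreasing (coordinate j : {RV mu >-> R})).
Qed.

Lemma component_cdf_itv t : 0 <= component_cdf mu j t <= 1.
Proof.
rewrite -!lee_fin -component_cdfE measure_ge0/=.
exact: (cdf_le1 (coordinate j : {RV mu >-> R}) t).
Qed.

(** The inverse transform of n strata that together fill the unit interval
    uniformly has the law of the component in the mean. The case n = 1 is the
    usual inverse transform. *)
Lemma inverse_transform_law (n : nat) (U : 'I_n -> Omega -> R) (G : R -> R) :
  inverse_cdf (component_cdf mu j) G ->
  (forall i, measurable_fun setT (U i)) -> (forall i w, 0 < U i w < 1) ->
  (forall s, 0 <= s <= 1 ->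
     (\sum_(i < n) P [set w | (U i w <= s)%R] = (n%:R * s)%:E)%E) ->
  forall B, measurable B ->
  (\sum_(i < n) P ((G \o U i) @^-1` B) = n%:R%:E * mu (coordinate j @^-1` B))%E.
Proof.
move=> FG mU U01 Ucdf B mB.
have mGU i : measurable_fun setT (G \o U i).
  by apply: inverse_cdf_measurable FG (mU i) (U01 i); exact: component_cdf_homo.
apply: (@mixture_unique _ _ _ _ _ P _ (fun i => G \o U i) mGU
   (@measurable_realfun.RGenOInfty.G R) (fun k => `]- k%:R, +oo[%classic)
   _ _ _ _ n%:R (distribution mu (coordinate j))) => //.
- exact: measurable_realfun.RGenOInfty.measurableE.
- move=> _ _ [x ->] [y ->]; exists (Num.max x y).
  by apply/seteqP; split => z /=; rewrite !in_itv/= !andbT gt_max;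
    [move=> [-> ->]|move=> /andP[]].
- by move=> k; exists (- k%:R).
- apply/seteqP; split => // x _; exists (Num.trunc `|x|).+1 => //=.
  rewrite in_itv/= andbT ltrNl.
  by rewrite (le_lt_trans _ (Num.Theory.truncnS_gt _))// -normrN ler_norm.
move=> _ [t ->].
rewrite (eq_bigr (fun i => (1 - P [set w | (U i w <= component_cdf mu j t)%R])%E)); last first.
  move=> i _; rewrite -probability_setC; last exact: measurable_set_le.
  congr (P _); apply/seteqP; split => w /=; rewrite in_itv/= andbT ltNge
    (inverse_cdf_le _ component_cdf_homo FG)//.
    by move/negP.
  by move/negP.
have fin i : P [set w | (U i w <= component_cdf mu j t)%R] \is a fin_num.
  by apply: fin_num_measure; exact: measurable_set_le.
have Ut := Ucdf _ (component_cdf_itv t).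
rewrite (eq_bigr (fun i => ((1 - fine (P [set w | (U i w <= component_cdf mu j t)%R]))%R)%:E)); last first.
  by move=> i _; rewrite EFinB fineK.
rewrite sumEFin sumrB.
have -> : \sum_(i < n) fine (P [set w | U i w <= component_cdf mu j t]) =
    n%:R * component_cdf mu j t.
  by apply: EFin_inj; rewrite -Ut -sumEFin; apply: eq_bigr => i _; rewrite fineK.
rewrite [X in (_ * X)%E](_ : _ = (1 - component_cdf mu j t)%:E); last first.
  rewrite EFinB -component_cdfE -probability_setC; last first.
    by rewrite -[X in measurable X]setTI; exact: measurable_coordinate.
  congr (mu _); rewrite preimage_setC; congr (_ @^-1` _).
  by rewrite setCitvl.
by rewrite -EFinM sumr_const card_ord mulrBr mulr1.
Qed.

End inverse_transform.

(** * Independence of random vectors *)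

Section independence_of_rows.
Context d (Omega : measurableType d) (R : realType) (P : probability Omega R).
Context {dxi : nat}.
Local Open Scope ereal_scope.

(** Both sides are finite measures of S, and they agree on boxes. *)
Lemma scale_extend (A : set Omega) (Y : Omega -> 'rV[R]_dxi) (a : R) :
  measurable A -> measurable_fun setT Y -> (0 <= a)%R ->
  (forall S, boxes S -> P (A `&` Y @^-1` S) = a%:E * P (Y @^-1` S)) ->
  forall S, measurable S -> P (A `&` Y @^-1` S) = a%:E * P (Y @^-1` S).
Proof.
move=> mA mY a0 AY S mS.
pose m1 := measure_function_pushforward__canonical__measure_function_Measure
  (mrestr P mA) mY.
have m1E B : m1 B = P (A `&` Y @^-1` B) by rewrite setIC.
pose m2 := mscale (NngNum a0) (distribution P (mfun_of mY)).
rewrite -m1E.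
apply: (measure_unique boxes (fun=> setT) measurable_boxes setI_closed_boxes
   (fun=> boxesT) _ m1 m2) => //.
- by rewrite bigcup_const.
- by move=> B bB; rewrite m1E AY.
- move=> k; rewrite m1E; apply: le_lt_trans (ltry 1); apply: probability_le1.
  by rewrite preimage_setT setIT.
Qed.

(** The event C and the two vectors are independent as soon as they are so on
    boxes. The class of boxes is enlarged for one of the vectors at a time. *)
Lemma independent_rows (C : set Omega) (Y Y' : Omega -> 'rV[R]_dxi) :
  measurable C -> measurable_fun setT Y -> measurable_fun setT Y' ->
  (forall S S', boxes S -> boxes S' ->
     P (C `&` Y @^-1` S `&` Y' @^-1` S') =
     P C * P (Y @^-1` S) * P (Y' @^-1` S')) ->
  forall S S', measurable S -> measurable S' ->
     P (C `&` Y @^-1` S `&` Y' @^-1` S') =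
     P C * P (Y @^-1` S) * P (Y' @^-1` S').
Proof.
move=> mC mY mY' YY'.
have mYS S : measurable S -> measurable (Y @^-1` S).
  by move=> mS; rewrite -[X in measurable X]setTI; exact: mY.
have mYS' S : measurable S -> measurable (Y' @^-1` S).
  by move=> mS; rewrite -[X in measurable X]setTI; exact: mY'.
have finP A : measurable A -> P A = (fine (P A))%:E.
  by move=> mA; rewrite fineK// fin_num_measure.
have step S S' : measurable S -> boxes S' ->
     P (C `&` Y @^-1` S `&` Y' @^-1` S') =
     P C * P (Y @^-1` S) * P (Y' @^-1` S').
  move=> mS bS'; have mS' : measurable S' by have [B mB ->] := bS'; exact: measurable_box.
  have e B : P C * P (Y @^-1` B) * P (Y' @^-1` S') =
     (fine (P C) * fine (P (Y' @^-1` S')))%:E * P (Y @^-1` B).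
    rewrite EFinM -(finP _ mC) -(finP _ (mYS' _ mS')).
    by rewrite -!muleA; congr (_ * _); rewrite muleC.
  rewrite e setIAC.
  apply: (scale_extend (A := C `&` Y' @^-1` S')) => //.
  - by apply: measurableI => //; exact: mYS'.
  - by rewrite mulr_ge0// fine_ge0.
  by move=> B bB; rewrite -e setIAC; exact: YY'.
move=> S S' mS mS'.
rewrite (finP C)// (finP _ (mYS _ mS)) -EFinM.
apply: (scale_extend (A := C `&` Y @^-1` S)) => //.
- by apply: measurableI => //; exact: mYS.
- by rewrite mulr_ge0// fine_ge0.
by move=> B bB; rewrite step// (finP C)// (finP _ (mYS _ mS)) -EFinM.
Qed.

End independence_of_rows.

Section cells.
Context d (Omega : measurableType d) (R : realType) (P : probability Omega R).
Context {dxi : nat} (mu : probability 'rV[R]_dxi R).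
Hypothesis mu_indep : mutually_independent mu setT
  (fun j : 'I_dxi => sigma_of (coordinate j : 'rV[R]_dxi -> R)).
Local Open Scope ereal_scope.

Lemma box_bigsetI (B : 'I_dxi -> set R) :
  box B = \big[setI/setT]_(j < dxi) (coordinate j @^-1` B j).
Proof.
rewrite box_bigcap -bigcap_seq (_ : [set` _] = setT)//.
by apply/seteqP; split=> i //= _; exact: mem_index_enum.
Qed.

Lemma mu_box (B : 'I_dxi -> set R) : (forall j, measurable (B j)) ->
  mu (box B) = \prod_(j < dxi) mu (coordinate j @^-1` B j).
Proof.
move=> mB; rewrite box_bigsetI; apply: mu_indep; first exact: index_enum_uniq.
by move=> j _; split => //; exists (B j) => //; rewrite setTI.
Qed.

Variables (n : nat) (W : 'I_n -> 'I_dxi -> Omega -> R).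

(** In each coordinate the point lies in the stratum that the index of the
    cell prescribes; these are the points that a Latin hypercube sample can
    contain. *)
Definition cell_point (c : {ffun 'I_dxi -> 'I_n}) (w : Omega) : 'rV[R]_dxi :=
  \row_j W (c j) j w.

Hypothesis mW : forall i j, measurable_fun setT (W i j).

Lemma measurable_cell_point c : measurable_fun setT (cell_point c).
Proof.
apply: measurable_fun_row => j.
by under eq_fun do rewrite mxE; exact: mW.
Qed.

(** The sum over all cells of a product over the coordinates is the product of
    the sums over the strata. *)
Lemma cells_law :
  (forall j B, measurable B ->
     \sum_(i < n) P (W i j @^-1` B) = n%:R%:E * mu (coordinate j @^-1` B)) ->
  (forall c B, (forall j, measurable (B j)) ->
     P (cell_point c @^-1` box B) = \prod_(j < dxi) P (W (c j) j @^-1` B j)) ->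
  forall S, measurable S ->
  \sum_(c : {ffun 'I_dxi -> 'I_n}) P (cell_point c @^-1` S) =
    (n ^ dxi)%:R%:E * mu S.
Proof.
move=> Wlaw Windep.
apply: (@mixture_unique _ _ _ _ _ P _ cell_point measurable_cell_point boxes
  (fun=> setT) measurable_boxes setI_closed_boxes (fun=> boxesT) _
  (n ^ dxi)%:R mu) => //.
  by rewrite bigcup_const.
move=> _ [B mB ->]; under eq_bigr do rewrite Windep//.
rewrite [X in _ * X](_ : _ = \prod_(j < dxi) mu (coordinate j @^-1` B j)); last first.
  exact: mu_box.
have mWB i j : measurable (W i j @^-1` B j).
  by rewrite -[X in measurable X]setTI; exact: mW.
have mcB j : measurable (coordinate j @^-1` B j).
  by rewrite -[X in measurable X]setTI; exact: measurable_coordinate.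
pose p i j := fine (P (W i j @^-1` B j)).
pose q j := fine (mu (coordinate j @^-1` B j)).
have pE i j : P (W i j @^-1` B j) = (p i j)%:E by rewrite fineK// fin_num_measure.
have qE j : mu (coordinate j @^-1` B j) = (q j)%:E by rewrite fineK// fin_num_measure.
under eq_bigr do under eq_bigr do rewrite pE.
under eq_bigr do rewrite prodEFin.
under [X in _ * X]eq_bigr do rewrite qE.
rewrite prodEFin sumEFin -EFinM; congr EFin.
rewrite -(bigA_distr_bigA (fun j i => p i j)).
rewrite (eq_bigr (fun j => n%:R * q j)%R); last first.
  move=> j _; apply: EFin_inj; rewrite EFinM -qE -Wlaw// -sumEFin.
  by apply: eq_bigr => i _; rewrite pE.
by rewrite big_split/= prodr_const card_ord natrX.
Qed.

End cells.

(** * Finite families of independent events *)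

Lemma mutually_independent_fin d (Omega : measurableType d) (R : realType)
    (P : probability Omega R) (I : choiceType) (D : set I)
    (G : I -> set (set Omega)) (J : finType) (t : J -> I) (A : J -> set Omega) :
  mutually_independent P D G -> injective t ->
  (forall j, D (t j) /\ G (t j) (A j)) ->
  (P (\big[setI/setT]_j A j) = \prod_j P (A j))%E.
Proof.
move=> ind tI DA.
(* The events are transported along t to the index set of the family. *)
pose A' i := if [pick j | t j == i] is Some j then A j else setT.
have A't j : A' (t j) = A j.
  by rewrite /A'; case: pickP => [j' /eqP/tI->//|/(_ j)]; rewrite eqxx.
have := ind (map t (index_enum J)) A'.
rewrite !big_map map_inj_uniq// index_enum_uniq => /(_ isT) H.
under eq_bigr do rewrite -A't; under [RHS]eq_bigr do rewrite -A't.
by apply: H => i /mapP[j _ ->]; rewrite A't; exact: DA.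
Qed.

Lemma mutually_independent_comp d (Omega : measurableType d) (R : realType)
    (P : probability Omega R) (I : choiceType) (D : set I)
    (G : I -> set (set Omega)) (J : finType) (t : J -> I) :
  mutually_independent P D G -> injective t -> (forall j, D (t j)) ->
  mutually_independent P setT (fun j => G (t j)).
Proof.
move=> ind tI Dt s A us sA.
pose A' i := if [pick j | t j == i] is Some j then A j else setT.
have A't j : A' (t j) = A j.
  by rewrite /A'; case: pickP => [j' /eqP/tI->//|/(_ j)]; rewrite eqxx.
have := ind (map t s) A'.
rewrite !big_map map_inj_uniq// => /(_ us) H.
under eq_bigr do rewrite -A't; under [RHS]eq_bigr do rewrite -A't.
by apply: H => i /mapP[j js ->]; rewrite A't; split => //; have [] := sA j js.
Qed.

(** * Random permutations *)

Section permutation_counts.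
Variable n : nat.
Local Open Scope nat_scope.

(** This makes the counts below equal for all pairs of distinct values. *)
Lemma perm_two_transitive (a b a' b' : 'I_n) : a != b -> a' != b' ->
  exists s : 'S_n, s a = a' /\ s b = b'.
Proof.
move=> ab a'b'; exists (tperm a a' * tperm (tperm a a' b) b')%g.
rewrite !permM tpermL; split; last by rewrite tpermL.
have c_neq : tperm a a' b != a'.
  by rewrite -[X in _ != X](tpermL a a') (inj_eq perm_inj) eq_sym.
by apply: tpermD => //; rewrite eq_sym.
Qed.

(** The n classes of permutations s, according to the value s i, have the same
    number of elements and partition the symmetric group. *)
Lemma card_perm1 (i a : 'I_n) : n * #|[set s : 'S_n | s i == a]%SET| <= n`!.
Proof.
pose S b := [set s : 'S_n | s i == b]%SET.
have le_card b : #|S a| <= #|S b|.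
  rewrite -(card_imset _ (mulIg (tperm a b))); apply: subset_leq_card.
  apply/fintype.subsetP => s /imsetP[s0 s0S ->].
  by move: s0S; rewrite /S !inE permM => /eqP s0i; rewrite s0i tpermL.
rewrite -card_Sn -[X in _ <= X]sum1_card (partition_big (fun s : 'S_n => s i) xpredT)//=.
apply: (@leq_trans (\sum_(b < n) #|S a|)); first by rewrite sum_nat_const card_ord.
apply: leq_sum => b _.
by rewrite sum1_card (leq_trans (le_card b))// subset_leq_card//;
  apply/fintype.subsetP => s; rewrite /S !inE.
Qed.

(** As for one value, but the n(n-1) pairs of distinct values index the
    classes. *)
Lemma card_perm2 (i i' a b : 'I_n) : i != i' -> a != b ->
  n * n.-1 * #|[set s : 'S_n | (s i == a) && (s i' == b)]%SET| <= n`!.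
Proof.
move=> ii' ab.
pose S (p : 'I_n * 'I_n) := [set s : 'S_n | (s i == p.1) && (s i' == p.2)]%SET.
have le_card (p : 'I_n * 'I_n) : p.1 != p.2 -> #|S (a, b)| <= #|S p|.
  case: p => a' b' /= a'b'; have [t [ta tb]] := perm_two_transitive ab a'b'.
  rewrite -(card_imset _ (mulIg t)); apply: subset_leq_card.
  apply/fintype.subsetP => s /imsetP[s0 s0S ->].
  move: s0S; rewrite /S !inE !permM /= => /andP[/eqP s0i /eqP s0i'].
  by rewrite s0i s0i' ta tb !eqxx.
have -> : n`! = \sum_(p : 'I_n * 'I_n) #|S p|.
  rewrite -card_Sn -sum1_card (partition_big (fun s : 'S_n => (s i, s i')) xpredT)//=.
  apply: eq_bigr => p _; rewrite sum1_card; apply: eq_card => s.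
  by case: p => a1 b1; rewrite /S !inE /= ?unfold_in /= ?xpair_eqE.
rewrite (bigID (fun p : 'I_n * 'I_n => p.1 != p.2))/=.
apply: leq_trans (leq_addr _ _).
apply: (@leq_trans (\sum_(p : 'I_n * 'I_n | p.1 != p.2) #|S (a, b)|)); last first.
  by apply: leq_sum => p; exact: le_card.
rewrite sum_nat_const leq_mul2r; apply/orP; right.
rewrite -sum1_card -(pair_big_dep xpredT (fun i j => i != j) (fun _ _ => 1))/=.
apply: (@leq_trans (\sum_(k < n) n.-1)); first by rewrite sum_nat_const card_ord.
apply: leq_sum => k _.
rewrite sum1_card -[n in n.-1]card_ord -(cardC1 k) subset_leq_card//.
by apply/fintype.subsetP => l; rewrite !inE eq_sym.
Qed.

End permutation_counts.

(** * Latin hypercube samples *)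

Lemma le_measure_bigsetU d (Omega : measurableType d) (R : realType)
    (P : {measure set Omega -> \bar R}) (I : finType) (A : set Omega)
    (B : I -> set Omega) :
  measurable A -> (forall i, measurable (B i)) -> A `<=` \bigcup_i B i ->
  (P A <= \sum_i P (B i))%E.
Proof.
move=> mA mB AB.
have AB' : A `<=` \big[setU/set0]_(i : I) B i.
  by move=> w /AB[i _ Bi]; rewrite -bigcup_seq; exists i => //=; exact: mem_index_enum.
have mBs (s : seq I) : measurable (\big[setU/set0]_(i <- s) B i).
  exact: bigsetU_measurable.
apply: (@le_trans _ _ (P (\big[setU/set0]_(i : I) B i))).
  by apply: le_measure; rewrite ?inE.
elim: (index_enum I) => [|i s IH]; first by rewrite !big_nil measure0.
rewrite !big_cons (le_trans (measureU2 _ _ _))//.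
by rewrite leeD2l.
Qed.

Lemma uniform_fin_le d (Omega : measurableType d) (R : realType)
    (P : probability Omega R) (E : finType) (Y : Omega -> E) (D : {set E}) :
  uniform_fin P Y ->
  measurable (Y @^-1` [set e | e \in D]) /\
  (P (Y @^-1` [set e | e \in D]) <= (#|D|%:R / #|E|%:R)%:E)%E.
Proof.
move=> Yu.
pose B e := if e \in D then Y @^-1` [set e] else set0.
have mB e : measurable (B e).
  by rewrite /B; case: ifP => // _; have [] := Yu e.
have YE : Y @^-1` [set e | e \in D] = \bigcup_e B e.
  apply/seteqP; split => w /=.
    by move=> wD; exists (Y w) => //; rewrite /B wD.
  by move=> [e _]; rewrite /B; case: ifP => // eD ->.
have mY : measurable (Y @^-1` [set e | e \in D]).
  by rewrite YE; apply: fin_bigcup_measurable.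
split=> //; apply: (le_trans (le_measure_bigsetU P mY mB _)); first by rewrite YE.
rewrite (eq_bigr (fun e => ((e \in D)%:R / #|E|%:R)%:E)); last first.
  move=> e _; rewrite /B; case: ifP => _; last by rewrite measure0 mul0r.
  by have [_ H] := Yu e; apply: etrans H _; rewrite mul1r.
rewrite sumEFin -mulr_suml -natr_sum; suff -> : (\sum_(e : E) (e \in D) = #|D|)%N by [].
by rewrite -sum1_card [RHS]big_mkcond; apply: eq_bigr => e _; case: ifP.
Qed.

Section latin_hypercube.
Context d (Omega : measurableType d) (R : realType) (P : probability Omega R).
Context {dxi : nat} (mu : probability 'rV[R]_dxi R).
Hypothesis mu_indep : mutually_independent mu setT
  (fun j : 'I_dxi => sigma_of (coordinate j : 'rV[R]_dxi -> R)).
Variable Finv : 'I_dxi -> R -> R.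
Hypothesis Finv_inv : forall j, inverse_cdf (component_cdf mu j) (Finv j).

(** An inverse distribution function is only controlled inside the unit
    interval; the uniform variables never leave it, so that replacing the
    other arguments by 1/2 changes nothing and makes Finv measurable on the
    whole line. *)
Definition clamp01 (x : R) : R := if (0 < x) && (x < 1) then x else 2^-1.

Lemma clamp01_itv x : 0 < clamp01 x < 1.
Proof. by rewrite /clamp01; case: ifPn => // _; lra. Qed.

Lemma clamp01_id x : 0 < x < 1 -> clamp01 x = x.
Proof. by rewrite /clamp01 => ->. Qed.

Lemma measurable_clamp01 : measurable_fun setT clamp01.
Proof.
rewrite /clamp01; apply: measurable_fun_if => //=.
by apply: measurable_and => //; exact: measurable_fun_ltr.
Qed.

Lemma measurable_Finv_clamp01 j : measurable_fun setT (Finv j \o clamp01).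
Proof.
apply: inverse_cdf_measurable (Finv_inv j) measurable_clamp01 clamp01_itv.
exact: component_cdf_homo.
Qed.

Lemma sigma_of_Finv j (h : R -> R) (U : Omega -> R) (B : set R) :
  measurable_fun setT h -> (forall w, 0 < h (U w) < 1) -> measurable B ->
  sigma_of U ((fun w => Finv j (h (U w))) @^-1` B).
Proof.
move=> mh hU mB; exists ((Finv j \o clamp01 \o h) @^-1` B).
  rewrite -[X in measurable X]setTI.
  by apply: (measurableT_comp (measurable_Finv_clamp01 j) mh).
by rewrite setTI; apply/seteqP; split => w /=; rewrite clamp01_id.
Qed.

Variables (n : nat) (U : 'I_n -> 'I_dxi -> {RV P >-> R}).
Variable sigma : 'I_dxi -> Omega -> 'S_n.
Hypothesis U_unif : forall (i : 'I_n) j, uniform_on (i%:R / n%:R) (i.+1%:R / n%:R) (U i j).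
Hypothesis sigma_unif : forall j, uniform_fin P (sigma j).
Hypothesis U_sigma_indep : mutually_independent P setT
  (fun t : 'I_n * 'I_dxi + 'I_dxi => match t with
     | inl (i, j) => sigma_of (U i j : Omega -> R)
     | inr j => sigma_of_fin (sigma j) end).
Hypothesis n2 : (2 <= n)%N.

Let n0 : (0 < n)%N. Proof. exact: leq_trans n2. Qed.

Let W i j w := Finv j (U i j w).

Definition lhs_point (i : 'I_n) (w : Omega) : 'rV[R]_dxi :=
  \row_j Finv j (U (sigma j w i) j w).

Let U01 i j w : 0 < U i j w < 1.
Proof.
have [/(_ w)/andP[Ul Ur] _] := U_unif i j.
have nR : 0 < n%:R :> R by rewrite ltr0n.
rewrite (le_lt_trans _ Ul)/= ?divr_ge0//; apply: (lt_le_trans Ur).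
by rewrite ler_pdivrMr// mul1r ler_nat.
Qed.

Let sigma_W i j B : measurable B -> sigma_of (U i j : Omega -> R) (W i j @^-1` B).
Proof.
move=> mB; apply: (@sigma_of_Finv _ idfun) mB; first exact: measurable_id.
by move=> w; exact: U01.
Qed.

Let mW i j : measurable_fun setT (W i j).
Proof.
apply: inverse_cdf_measurable (Finv_inv j) _ (U01 i j) => //.
exact: component_cdf_homo.
Qed.

Let W_law j B : measurable B ->
  (\sum_(i < n) P (W i j @^-1` B) = n%:R%:E * mu (coordinate j @^-1` B))%E.
Proof.
move=> mB; apply: (inverse_transform_law (U := fun i => U i j)) => //.
move=> s s01; under eq_bigr => i _.
  have [_ [ab _]] := U_unif i j.
  rewrite (uniform_on_cdf (U_unif i j))//; over.
by rewrite sumEFin sum_strata.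
Qed.

(* The i-th point is the point of the random cell (sigma_j i)_j. The
   variables that define the point of a fixed cell are independent of the
   permutations. *)
Let cell := cell_point W.

Let cell_box c B : cell c @^-1` box B =
  \big[setI/setT]_(j < dxi) (W (c j) j @^-1` B j).
Proof.
rewrite -bigcap_seq; apply/seteqP; split => w /=.
  by move=> H j _; have := H j; rewrite /cell/cell_point mxE.
by move=> H j; rewrite mxE; apply: H => /=; exact: mem_index_enum.
Qed.

Let cells_sum S : measurable S ->
  (\sum_(c : {ffun 'I_dxi -> 'I_n}) P (cell c @^-1` S) = (n ^ dxi)%:R%:E * mu S)%E.
Proof.
apply: cells_law => // c B mB; rewrite cell_box.
apply: (mutually_independent_fin (t := fun j => inl (c j, j)) U_sigma_indep).
  by move=> j j' [_ ->].
by move=> j; split => //=; exact: sigma_W.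
Qed.

Let perm_event (D : 'I_dxi -> {set 'S_n}) : set Omega :=
  \big[setI/setT]_(j < dxi) (sigma j @^-1` [set s | s \in D j]).

Let perm_eventP D w : perm_event D w <-> forall j, sigma j w \in D j.
Proof.
rewrite /perm_event -bigcap_seq; split => /= H.
  by move=> j; apply: H => /=; exact: mem_index_enum.
by move=> j _; exact: H.
Qed.

Let measurable_perm_event D : measurable (perm_event D).
Proof.
by apply: bigsetI_measurable => j _; have [] := uniform_fin_le (D j) (sigma_unif j).
Qed.

Let perm_event_le (D : 'I_dxi -> {set 'S_n}) (k : R) : (forall j, (#|D j|%:R / n`!%:R <= k :> R)) ->
  (P (perm_event D) <= (k ^+ dxi)%:E)%E.
Proof.
move=> Dk.
rewrite (mutually_independent_fin (t := inr) U_sigma_indep); last 2 first.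
- by move=> j j' [->].
- by move=> j; split => //=; exists [set s | s \in D j] => //; rewrite setTI.
have fE j : P (sigma j @^-1` [set s | s \in D j]) =
    (fine (P (sigma j @^-1` [set s | s \in D j])))%:E.
  by rewrite fineK// fin_num_measure//; have [] := uniform_fin_le (D j) (sigma_unif j).
under eq_bigr do rewrite fE.
have -> : k ^+ dxi = \prod_(j < dxi) k by rewrite prodr_const card_ord.
rewrite prodEFin lee_fin; apply: ler_prod => j _; rewrite fine_ge0//= -lee_fin -fE.
have [_ /le_trans] := uniform_fin_le (D j) (sigma_unif j); apply.
by rewrite lee_fin card_Sn.
Qed.

Let perm_prod D : (P (perm_event D) =
  \prod_(j < dxi) P (sigma j @^-1` [set s | s \in D j]))%E.
Proof.
apply: (mutually_independent_fin (t := inr) U_sigma_indep).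
  by move=> j j' [->].
by move=> j; split => //=; exists [set s | s \in D j] => //; rewrite setTI.
Qed.

Let cell_prod c B : (forall j, measurable (B j)) ->
  (P (cell c @^-1` box B) = \prod_(j < dxi) P (W (c j) j @^-1` B j))%E.
Proof.
move=> mB; rewrite cell_box.
apply: (mutually_independent_fin (t := fun j => inl (c j, j)) U_sigma_indep).
  by move=> j j' [_ ->].
by move=> j; split => //=; exact: sigma_W.
Qed.

Let measurable_cell c : measurable_fun setT (cell c).
Proof. exact: measurable_cell_point. Qed.

Let cell_perm_indep D c S : measurable S ->
  (P (perm_event D `&` cell c @^-1` S) = P (perm_event D) * P (cell c @^-1` S))%E.
Proof.
move=> mS; rewrite -(fineK (fin_num_measure P _ (measurable_perm_event D))).
apply: scale_extend => //; first exact: fine_ge0.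
move=> _ [B mB ->]; rewrite fineK ?fin_num_measure//.
pose t (x : 'I_dxi + 'I_dxi) : 'I_n * 'I_dxi + 'I_dxi :=
  match x with inl j => inr j | inr j => inl (c j, j) end.
pose A (x : 'I_dxi + 'I_dxi) : set Omega := match x with
  inl j => sigma j @^-1` [set s | s \in D j] | inr j => W (c j) j @^-1` B j end.
have := mutually_independent_fin (t := t) (A := A) U_sigma_indep.
rewrite !big_sumType/= -cell_box -perm_prod -(cell_prod _ mB); apply.
  by move=> [j|j] [j'|j'] //= [] => [->|_ ->].
case=> j; split => //=; first by exists [set s | s \in D j] => //; rewrite setTI.
exact: sigma_W.
Qed.

Let cell_pair_indep (D : 'I_dxi -> {set 'S_n}) (c c' : {ffun 'I_dxi -> 'I_n}) S S' : (forall j, c j != c' j) ->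
  measurable S -> measurable S' ->
  (P (perm_event D `&` cell c @^-1` S `&` cell c' @^-1` S') =
   P (perm_event D) * P (cell c @^-1` S) * P (cell c' @^-1` S'))%E.
Proof.
move=> cc'; apply: independent_rows => // _ _ [B mB ->] [B' mB' ->].
pose t (x : 'I_dxi + 'I_dxi + 'I_dxi) : 'I_n * 'I_dxi + 'I_dxi :=
  match x with inl (inl j) => inr j | inl (inr j) => inl (c j, j)
  | inr j => inl (c' j, j) end.
pose A (x : 'I_dxi + 'I_dxi + 'I_dxi) : set Omega := match x with
  inl (inl j) => sigma j @^-1` [set s | s \in D j]
  | inl (inr j) => W (c j) j @^-1` B j | inr j => W (c' j) j @^-1` B' j end.
have := mutually_independent_fin (t := t) (A := A) U_sigma_indep.
rewrite !big_sumType/= -!cell_box -perm_prod -(cell_prod _ mB) -(cell_prod _ mB').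
apply.
  move=> [[j|j]|j] [[j'|j']|j'] //= [].
  - by move=> ->.
  - by move=> _ ->.
  - by move=> H jj'; move: (cc' j'); rewrite -H jj' eqxx.
  - by move=> H jj'; move: (cc' j); rewrite H jj' eqxx.
  - by move=> _ ->.
case=> [[]|] j; split => //=; first by exists [set s | s \in D j] => //; rewrite setTI.
- exact: sigma_W.
- exact: sigma_W.
Qed.

Let lhs_pointE i w :
  lhs_point i w = cell [ffun j => sigma j w i] w.
Proof. by apply/rowP => j; rewrite !mxE ffunE. Qed.

Let D1 (i : 'I_n) (c : {ffun 'I_dxi -> 'I_n}) j : {set 'S_n} :=
  [set s : 'S_n | s i == c j]%SET.

Let lhs_pointP i w c : perm_event (D1 i c) w -> lhs_point i w = cell c w.
Proof.
move=> /perm_eventP H; rewrite lhs_pointE; congr (cell _ w).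
by apply/ffunP => j; rewrite ffunE; have := H j; rewrite inE => /eqP.
Qed.

Let perm_event_cell i w : perm_event (D1 i [ffun j => sigma j w i]) w.
Proof. by apply/perm_eventP => j; rewrite inE ffunE. Qed.

Let lhs_preimage i S : lhs_point i @^-1` S =
  \bigcup_c (perm_event (D1 i c) `&` cell c @^-1` S).
Proof.
apply/seteqP; split => w /=.
  move=> Sw; exists [ffun j => sigma j w i] => //; split => //=.
  by rewrite -lhs_pointE.
by move=> [c _ [cw /=]]; rewrite (lhs_pointP cw).
Qed.

Let measurable_cellS c S : measurable S -> measurable (cell c @^-1` S).
Proof. by move=> mS; rewrite -[X in measurable X]setTI; exact: measurable_cell. Qed.

Lemma measurable_lhs_point i : measurable_fun setT (lhs_point i).
Proof.
move=> _ S mS; rewrite setTI lhs_preimage; apply: fin_bigcup_measurable => // c _.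
by apply: measurableI => //; exact: measurable_cellS.
Qed.

Let measurable_lhsS i S : measurable S -> measurable (lhs_point i @^-1` S).
Proof.
by move=> mS; rewrite -[X in measurable X]setTI; exact: measurable_lhs_point.
Qed.

Let nR : 0 < n%:R :> R. Proof. by rewrite ltr0n. Qed.

(* Each of the n^d cells is occupied by the i-th point with probability at
   most n^-d. *)
Let lhs_point_le i S : measurable S -> (P (lhs_point i @^-1` S) <= mu S)%E.
Proof.
move=> mS.
apply: (@le_trans _ _ (\sum_(c : {ffun 'I_dxi -> 'I_n})
    P (perm_event (D1 i c) `&` cell c @^-1` S))%E).
  apply: le_measure_bigsetU; [exact: measurable_lhsS| |by rewrite lhs_preimage].
  by move=> c; apply: measurableI => //; exact: measurable_cellS.
apply: (@le_trans _ _ (\sum_(c : {ffun 'I_dxi -> 'I_n})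
    ((n%:R^-1 ^+ dxi)%:E * P (cell c @^-1` S)))%E).
  apply: lee_sum => c _; rewrite cell_perm_indep//; apply: lee_wpmul2r => //.
  apply: perm_event_le => j; rewrite ler_pdivrMr ?ltr0n ?fact_gt0//.
  rewrite ler_pdivlMl// -natrM ler_nat; exact: card_perm1.
rewrite -ge0_sume_distrr// cells_sum// muleA -EFinM natrX -exprMn mulVf ?gt_eqF//.
by rewrite expr1n mul1e.
Qed.

(** The law of the point and mu are probability measures, so the bound for S
    and the bound for its complement give equality. *)
Lemma lhs_point_law i S : measurable S -> P (lhs_point i @^-1` S) = mu S.
Proof.
move=> mS; apply/eqP; rewrite eq_le lhs_point_le//=.
have := lhs_point_le i (measurableC mS).
rewrite preimage_setC !probability_setC//; last exact: measurable_lhsS.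
have [pf mf] : P (lhs_point i @^-1` S) \is a fin_num /\ mu S \is a fin_num.
  by split; apply: fin_num_measure => //; exact: measurable_lhsS.
by rewrite -(fineK pf) -(fineK mf) -!EFinB !lee_fin lerD2l lerN2.
Qed.

(** Two points lie in cells that differ in every coordinate. Such a pair of
    cells is occupied with probability at most (n(n-1))^-d, and the points of
    the two cells are independent; the bound follows by summing over all pairs
    of cells, including those that cannot occur. *)
Lemma lhs_point_pair i i' S S' : i != i' -> measurable S -> measurable S' ->
  (P (lhs_point i @^-1` S `&` lhs_point i' @^-1` S') <=
   ((n%:R / n.-1%:R) ^+ dxi)%:E * mu S * mu S')%E.
Proof.
move=> ii' mS mS'.
have n10 : 0 < n.-1%:R :> R by rewrite ltr0n -ltnS prednK.
pose C := {ffun 'I_dxi -> 'I_n}.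
pose D2 (p : C * C) j : {set 'S_n} :=
  [set s : 'S_n | (s i == p.1 j) && (s i' == p.2 j)]%SET.
pose B (p : C * C) := perm_event (D2 p) `&` cell p.1 @^-1` S `&` cell p.2 @^-1` S'.
apply: (@le_trans _ _ (\sum_(p : C * C) P (B p))%E).
  apply: le_measure_bigsetU.
  - by apply: measurableI; exact: measurable_lhsS.
  - move=> p; apply: measurableI; last exact: measurable_cellS.
    by apply: measurableI => //; exact: measurable_cellS.
  move=> w /= [Sw S'w]; exists ([ffun j => sigma j w i], [ffun j => sigma j w i']) => //.
  rewrite /B/= -!lhs_pointE; split => //; split => //.
  by apply/perm_eventP => j; rewrite inE/= !ffunE !eqxx.
pose k := (n%:R * n.-1%:R)^-1 : R.
have k0 : 0 <= k ^+ dxi by rewrite exprn_ge0// invr_ge0 mulr_ge0// ltW.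
apply: (@le_trans _ _ (\sum_(p : C * C)
    ((k ^+ dxi)%:E * (P (cell p.1 @^-1` S) * P (cell p.2 @^-1` S'))))%E).
  apply: lee_sum => p _.
  have [cc'|] := pselect (forall j, p.1 j != p.2 j).
    rewrite /B cell_pair_indep// -muleA; apply: lee_wpmul2r; first exact: mule_ge0.
    apply: perm_event_le => j; rewrite ler_pdivrMr ?ltr0n ?fact_gt0//.
    rewrite ler_pdivlMl ?mulr_gt0// -!natrM ler_nat; exact: card_perm2.
  move=> /existsNP[j /negP]; rewrite negbK => /eqP pj.
  rewrite (_ : B p = set0) ?measure0; first by rewrite !mule_ge0.
  apply/seteqP; split => // w [[/perm_eventP/(_ j)]]; rewrite inE => /andP[/eqP a /eqP b] _ _.
  by move: ii'; rewrite -(inj_eq (@perm_inj _ (sigma j w))) a b pj eqxx.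
rewrite -ge0_sume_distrr; last by move=> p _; exact: mule_ge0.
have -> : (\sum_(p : C * C) (P (cell p.1 @^-1` S) * P (cell p.2 @^-1` S')) =
    \sum_(c : C) \sum_(c' : C) (P (cell c @^-1` S) * P (cell c' @^-1` S')))%E.
  by rewrite pair_bigA.
under eq_bigr do rewrite -ge0_sume_distrr// cells_sum//.
rewrite -ge0_sume_distrl// cells_sum//.
rewrite muleACA !muleA -!EFinM.
rewrite (_ : (k ^+ dxi * _ * _)%R = (n%:R / n.-1%:R) ^+ dxi) ?lexx//.
have -> : n%:R / n.-1%:R = k * (n%:R * n%:R) :> R.
  by rewrite /k; field; rewrite !gt_eqF.
by rewrite natrX !exprMn; ring.
Qed.

End latin_hypercube.

(** * Antithetic pairs *)

Section antithetic.
Context d (Omega : measurableType d) (R : realType) (P : probability Omega R).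

Lemma uniform01_reflected_cdf (U : {RV P >-> R}) s : uniform_on 0 1 U ->
  0 <= s <= 1 -> P [set w | 1 - U w <= s] = s%:E.
Proof.
move=> [_ [ab Ulaw]] /andP[s0 s1].
transitivity (distribution P U `[1 - s, +oo[).
  by congr (P _); apply/seteqP; split => w /=; rewrite in_itv/= andbT lerBlDl lerBlDr addrC.
rewrite Ulaw//= /uniform_prob integral_uniform_pdf.
have -> : `[1 - s, +oo[ `&` `[0, 1] = `[1 - s, 1]%classic.
  apply/seteqP; split => x /=; rewrite !in_itv/= andbT.
    by move=> [-> /andP[_ ->]].
  by move=> /andP[sx ->]; rewrite sx (le_trans _ sx)// subr_ge0.
rewrite (eq_integral (fun=> 1%:E)); last first.
  move=> x; rewrite inE/= in_itv/= => /andP[sx x1].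
  by rewrite /uniform_pdf x1 (le_trans _ sx) ?subr_ge0// subr0 invr1.
rewrite integral_cst//= lebesgue_measure_itv/= lte_fin mul1e.
have [->|sn0] := eqVneq s 0; first by rewrite subr0 ltxx.
by rewrite ltrBlDr ltrDl lt_neqAle eq_sym sn0 s0/= -EFinB opprB addrC subrK.
Qed.

Context {dxi : nat} (mu : probability 'rV[R]_dxi R).
Hypothesis mu_indep : mutually_independent mu setT
  (fun j : 'I_dxi => sigma_of (coordinate j : 'rV[R]_dxi -> R)).
Variable Finv : 'I_dxi -> R -> R.
Hypothesis Finv_inv : forall j, inverse_cdf (component_cdf mu j) (Finv j).
Variables (n : nat) (U : 'I_n -> 'I_dxi -> {RV P >-> R}).
Hypothesis U_unif : forall i j, uniform_on 0 1 (U i j).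
Hypothesis U_indep : mutually_independent P setT
  (fun t : 'I_n * 'I_dxi => sigma_of (U t.1 t.2 : Omega -> R)).

Definition reflect01 (b : bool) (x : R) : R := if b then 1 - x else x.

Let W b i j w := Finv j (reflect01 b (U i j w)).

Definition av_point (b : bool) (i : 'I_n) (w : Omega) : 'rV[R]_dxi :=
  \row_j Finv j (reflect01 b (U i j w)).

Let mreflect b : measurable_fun setT (reflect01 b).
Proof.
case: b; last exact: measurable_id.
change (measurable_fun setT ((cst 1 : R -> R) \- idfun)).
by apply: measurable_funB; [exact: measurable_cst|exact: measurable_id].
Qed.

Let U01 b i j w : 0 < reflect01 b (U i j w) < 1.
Proof.
have [/(_ w)/andP[U0 U1] _] := U_unif i j.
by case: b => /=; rewrite ?U0 ?U1// subr_gt0 U1/= ltrBlDr ltrDl.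
Qed.

Let sigma_W b i j B : measurable B -> sigma_of (U i j : Omega -> R) (W b i j @^-1` B).
Proof.
move=> mB; apply: (sigma_of_Finv Finv_inv) mB; first exact: mreflect.
by move=> w; exact: U01.
Qed.

Let mW b i j : measurable_fun setT (W b i j).
Proof.
apply: (inverse_cdf_measurable (U := fun w => reflect01 b (U i j w))) (Finv_inv j) _ (U01 b i j) => //.
  exact: component_cdf_homo.
by apply: (measurableT_comp (mreflect b)).
Qed.

Lemma measurable_av_point b i : measurable_fun setT (av_point b i).
Proof.
by apply: measurable_fun_row => j; under eq_fun do rewrite mxE; exact: mW.
Qed.

Let W_law b i j B : measurable B -> P (W b i j @^-1` B) = mu (coordinate j @^-1` B).
Proof.
move=> mB.
suff : (\sum_(k < 1) P (W b i j @^-1` B) =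
    1%:R%:E * mu (coordinate j @^-1` B))%E by rewrite big_ord1 mul1e.
apply: (@inverse_transform_law _ _ _ P _ mu j 1
  (fun _ w => reflect01 b (U i j w)) _ (Finv_inv j)) => //.
  by move=> _; apply: (measurableT_comp (mreflect b)).
move=> s s01; rewrite big_ord1 mul1r; case: b; first exact: uniform01_reflected_cdf.
have [s0 s1] := andP s01.
rewrite (uniform_on_cdf (U_unif i j))// !subr0 divr1.
by rewrite (min_idPr _)// (max_idPr _).
Qed.

Let av_box b i B : av_point b i @^-1` box B =
  \big[setI/setT]_(j < dxi) (W b i j @^-1` B j).
Proof.
rewrite -bigcap_seq; apply/seteqP; split => w /=.
  by move=> H j _; have := H j; rewrite mxE.
by move=> H j; rewrite mxE; apply: H => /=; exact: mem_index_enum.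
Qed.

Let av_prod b i B : (forall j, measurable (B j)) ->
  (P (av_point b i @^-1` box B) = \prod_(j < dxi) P (W b i j @^-1` B j))%E.
Proof.
move=> mB; rewrite av_box.
apply: (mutually_independent_fin (t := fun j => (i, j)) U_indep).
  by move=> j j' [->].
by move=> j; split => //=; exact: sigma_W.
Qed.

Lemma av_point_law b i S : measurable S -> P (av_point b i @^-1` S) = mu S.
Proof.
move=> mS.
have cov : \bigcup_(k in [set: nat]) [set: 'rV[R]_dxi] = setT by rewrite bigcup_const.
have := @mixture_unique _ _ _ _ _ P 'I_1 (fun=> av_point b i)
  (fun=> measurable_av_point b i) boxes (fun=> setT) measurable_boxes
  setI_closed_boxes (fun=> boxesT) cov 1 mu ler01.
move=> H; have := H _ S mS; rewrite big_ord1 mul1e; apply.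
move=> _ [B mB ->]; rewrite big_ord1 mul1e av_prod//.
apply: etrans (esym (mu_box mu_indep mB)).
by apply: eq_bigr => j _; exact: W_law.
Qed.

(** The two points use disjoint families of uniform variables, whichever
    member of its pair each of them is. *)
Lemma av_point_pair b b' i i' S S' : i != i' -> measurable S -> measurable S' ->
  (P (av_point b i @^-1` S `&` av_point b' i' @^-1` S') = mu S * mu S')%E.
Proof.
move=> ii' mS mS'; rewrite -(av_point_law b i mS) -(av_point_law b' i' mS').
have := @independent_rows _ Omega R P _ setT (av_point b i) (av_point b' i') measurableT
  (measurable_av_point b i) (measurable_av_point b' i').
move=> H; have := H _ S S' mS mS'; rewrite setTI probability_setT mul1e; apply.
move=> _ _ [B mB ->] [B' mB' ->].
rewrite setTI mul1e.
pose t (x : 'I_dxi + 'I_dxi) : 'I_n * 'I_dxi :=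
  match x with inl j => (i, j) | inr j => (i', j) end.
pose A (x : 'I_dxi + 'I_dxi) : set Omega := match x with
  inl j => W b i j @^-1` B j | inr j => W b' i' j @^-1` B' j end.
have := mutually_independent_fin (t := t) (A := A) U_indep.
rewrite !big_sumType/= -!av_box -(av_prod b i mB) -(av_prod b' i' mB'); apply.
  move=> [j|j] [j'|j'] //= [].
  - by move=> ->.
  - by move=> H0; move: ii'; rewrite H0 eqxx.
  - by move=> H0; move: ii'; rewrite H0 eqxx.
  - by move=> ->.
by case=> j; split => //=; exact: sigma_W.
Qed.

End antithetic.

(** By convexity (1 + x)^d is at most 1 + (2^d - 1) x for x in the unit
    interval; here x = 1/(n-1), which is at most 2/n. *)
Lemma lhs_factor_le (R : realType) (n dxi : nat) : (2 <= n)%N ->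
  (n%:R / n.-1%:R) ^+ dxi <= 1 + 2 ^+ dxi.+1 / n%:R :> R.
Proof.
case: n => [//|n]; rewrite ltnS => n0 /=.
have nR : 1 <= n%:R :> R by rewrite ler1n.
have nR0 : 0 < n%:R :> R by exact: lt_le_trans nR.
have H (x : R) : 0 <= x <= 1 -> (1 + x) ^+ dxi <= 1 + (2 ^+ dxi - 1) * x.
  move=> /andP[x0 x1]; elim: dxi => [|k IH]; first by rewrite !expr0 subrr mul0r addr0.
  rewrite exprS; apply: (le_trans (ler_wpM2l _ IH)); first by rewrite addr_ge0.
  have k1 : 1 <= 2 ^+ k :> R by rewrite exprn_ege1// ler1n.
  have h : 0 <= (2 ^+ k - 1) * x * (1 - x) by rewrite !mulr_ge0 ?subr_ge0.
  rewrite exprS -subr_ge0; apply: (le_trans h); rewrite le_eqVlt.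
  by apply/orP; left; apply/eqP; ring.
have -> : n.+1%:R / n%:R = 1 + n%:R^-1 :> R.
  by rewrite -natr1 mulrDl mulfV ?gt_eqF// mul1r.
apply: le_trans (H _ _) _.
  by rewrite invr_ge0 ltW//= invf_le1.
rewrite lerD2l exprS -natr1.
apply: (@le_trans _ _ (2 ^+ dxi * n%:R^-1)).
  by rewrite ler_wpM2r ?invr_ge0 ?(ltW nR0)// lerBlDr lerDl.
rewrite [2 * _]mulrC -mulrA ler_wpM2l ?exprn_ge0// ler_pdivlMr ?ltr_wpDr//.
by rewrite mulrC ler_pdivrMr//; lra.
Qed.

(** A Latin hypercube point serves as both members of its pair. *)
Definition member (s : sampling) (b : bool) : bool :=
  if s is Antithetic then b else false.

(** The property concerns the sample of one iteration and one replication, so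
    that antithetic pairs reused from previous iterations are covered. *)
Lemma sampling_design d (Omega : measurableType d) (R : realType)
    (P : probability Omega R) (dxi : nat) (mu : probability 'rV[R]_dxi R)
    (Finv : 'I_dxi -> R -> R) (nr : nat) (m : nat -> nat)
    (xi : nat -> nat -> nat -> bool -> Omega -> 'rV[R]_dxi) (s : sampling) :
  mutually_independent mu setT
    (fun j : 'I_dxi => sigma_of (coordinate j : 'rV[R]_dxi -> R)) ->
  (forall j, inverse_cdf (component_cdf mu j) (Finv j)) ->
  sampling_scheme P Finv nr m xi s ->
  forall k r, (1 <= k)%N -> (r < nr)%N -> (2 <= m k)%N ->
  design P mu (m k) (1 + 2 ^+ dxi.+1 / (m k)%:R)
    (fun i b => xi k r i (member s b)).
Proof.
move=> mu_indep Finv_inv sch k r k1 rn mk2.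
have c0 : 0 <= 2 ^+ dxi.+1 / (m k)%:R :> R by rewrite divr_ge0// exprn_ge0.
case: s sch => /=.
  move=> [batch [u [_ u_unif u_indep xiE]]].
  pose U (i : 'I_(m k)) j := u (batch k) r i j.
  have U_unif i j : uniform_on 0 1 (U i j) by apply: u_unif; exists k; split => //; exact: ltn_ord.
  have U_indep : mutually_independent P setT
      (fun t : 'I_(m k) * 'I_dxi => sigma_of (U t.1 t.2 : Omega -> R)).
    pose t (x : 'I_(m k) * 'I_dxi) : nat * nat * nat * 'I_dxi :=
      (batch k, r, val x.1, x.2).
    apply: (mutually_independent_comp (t := t)) u_indep _ _.
      by move=> [i j] [i' j'] [/val_inj -> ->].
    by move=> x; exists k; split => //=; exact: ltn_ord.
  have ptE i b (im : (i < m k)%N) : xi k r i b = av_point Finv U b (Ordinal im).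
    apply/funext => w; have [f t] := xiE k r i w k1 rn im.
    by case: b => /=; [rewrite t|rewrite f].
  split.
  - by move=> i b im; rewrite ptE; exact: measurable_av_point.
  - by move=> i b S im mS; rewrite ptE; exact: av_point_law.
  - move=> i i' b b' S S' im im' ii' mS mS'; rewrite !ptE.
    rewrite (av_point_pair mu_indep Finv_inv U_unif U_indep)//.
    rewrite -muleA -[leLHS]mul1e; apply: lee_wpmul2r; first exact: mule_ge0.
    by rewrite lee_fin lerDl.
move=> [u [perm [u_unif perm_unif up_indep xiE]]].
pose U (i : 'I_(m k)) j := u k r i j.
pose sigma j := perm k r j.
have U_unif (i : 'I_(m k)) j : uniform_on (i%:R / (m k)%:R) (i.+1%:R / (m k)%:R) (U i j).
  by apply: u_unif.
have sigma_unif j : uniform_fin P (sigma j) by apply: perm_unif.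
have US_indep : mutually_independent P setT
    (fun t : 'I_(m k) * 'I_dxi + 'I_dxi => match t with
     | inl (i, j) => sigma_of (U i j : Omega -> R)
     | inr j => sigma_of_fin (sigma j) end).
  pose t (x : 'I_(m k) * 'I_dxi + 'I_dxi) : nat * nat * nat * 'I_dxi + nat * nat * 'I_dxi :=
    match x with inl (i, j) => inl (k, r, val i, j) | inr j => inr (k, r, j) end.
  have := mutually_independent_comp (t := t) up_indep.
  move=> H s A us sA; apply: H => //.
  - by move=> [[i j]|j] [[i' j']|j'] //= [] => [/val_inj -> ->|->].
  - by move=> [[i j]|j] /=; split => //; exact: ltn_ord.
  - by move=> i iS; split => //; have [_] := sA i iS; case: i iS => [[i j]|j].
have ptE i (im : (i < m k)%N) : xi k r i false = lhs_point Finv U sigma (Ordinal im).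
  by apply/funext => w; rewrite (xiE k r (Ordinal im) w k1 rn).
split.
- by move=> i b im; rewrite ptE; exact: (measurable_lhs_point Finv_inv U_unif sigma_unif mk2).
- by move=> i b S im mS; rewrite ptE; exact: (lhs_point_law mu_indep Finv_inv U_unif sigma_unif US_indep mk2).
- move=> i i' b b' S S' im im' ii' mS mS'; rewrite !ptE.
  apply: le_trans (lhs_point_pair mu_indep Finv_inv U_unif sigma_unif US_indep mk2 _ mS mS') _ => //.
  rewrite -!muleA; apply: lee_wpmul2r; first exact: mule_ge0.
  by rewrite lee_fin lhs_factor_le.
Qed.

(** * The support of the distribution *)

Section support.
Context {R : realType} {dxi : nat} (mu : probability 'rV[R]_dxi R).

Lemma measurable_rational_box (c : 'rV[rat]_dxi * nat) :
  measurable (rational_box c : set 'rV[R]_dxi).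
Proof. by apply: measurable_box => j; exact: measurable_ball. Qed.

Lemma open_rational_box (c : 'rV[rat]_dxi * nat) :
  open (rational_box c : set 'rV[R]_dxi).
Proof.
rewrite /rational_box box_bigcap -bigsetI_fset_set//.
apply: (big_ind (@open _)) => [|A B|j _]; [exact: openT|exact: openI|].
have /continuousP := @coord_continuous R 1 dxi ord0 j.
  by apply; exact: ball_open.
exact: finite_finset.
Qed.

Lemma dsupportC : ~` dsupport mu =
  \bigcup_(c in [set c | mu (rational_box c) = 0%E]) rational_box c.
Proof.
apply/seteqP; split => [v|v [c c0 cv]].
  move=> /existsNP[U /not_implyP[oU /not_implyP[Uv /negP]]].
  rewrite -leNgt => U0.
  have [c cv cU] := rational_box_nbhs oU Uv; exists c => //=.
  apply/eqP; rewrite eq_le measure_ge0 andbT (le_trans _ U0)// le_measure// inE.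
    exact: measurable_rational_box.
  by apply: sub_sigma_algebra.
by move=> /(_ _ (@open_rational_box c) cv); rewrite c0 ltxx.
Qed.

Lemma open_dsupportC : open (~` dsupport mu).
Proof. by rewrite dsupportC; apply: bigcup_open => c _; exact: open_rational_box. Qed.

Lemma measurable_dsupport : measurable (dsupport mu).
Proof.
rewrite -[X in measurable X]setCK; apply: measurableC.
by apply: sub_sigma_algebra; exact: open_dsupportC.
Qed.

(** The complement of the support is covered by the countably many rational
    boxes of measure 0. *)
Lemma mu_dsupportC : mu (~` dsupport mu) = 0%E.
Proof.
pose F k : set 'rV[R]_dxi := if unpickle k is Some c then
  (if mu (rational_box (c : 'rV[rat]_dxi * nat)) == 0%E then rational_box c else set0) else set0.
have FE : ~` dsupport mu = \bigcup_k F k.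
  rewrite dsupportC; apply/seteqP; split => v.
    by move=> [c c0 cv]; exists (pickle c) => //; rewrite /F pickleK c0 eqxx.
  move=> [k _]; rewrite /F; case: unpickle => // c; case: ifP => // /eqP c0 cv.
  by exists c.
have mF k : measurable (F k).
  rewrite /F; case: unpickle => // c; case: ifP => // _; exact: measurable_rational_box.
have : mu.-negligible (\bigcup_k F k).
  apply: negligible_bigcup => k; exists (F k); split => //.
  by rewrite /F; case: unpickle => [c|]; [case: ifP => [/eqP//|_]|]; rewrite measure0.
rewrite -FE => /measure_negligible; apply.
by apply: measurableC; exact: measurable_dsupport.
Qed.

Hypothesis mu_indep : mutually_independent mu setT
  (fun j : 'I_dxi => sigma_of (coordinate j : 'rV[R]_dxi -> R)).
Variable Finv : 'I_dxi -> R -> R.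
Hypothesis Finv_inv : forall j, inverse_cdf (component_cdf mu j) (Finv j).

(** The distribution function of a component is not constant just to the left
    of a value of its inverse, so every box around such a row has positive
    measure. *)
Lemma row_Finv_dsupport (v : 'I_dxi -> R) : (forall j, 0 < v j < 1) ->
  dsupport mu (\row_j Finv j (v j)).
Proof.
move=> v01 U oU Uz; have [c cz cU] := rational_box_nbhs oU Uz.
have mU : measurable U by apply: sub_sigma_algebra.
suff box_gt0 : (0 < mu (rational_box c))%E.
  apply: (lt_le_trans box_gt0); apply: le_measure; rewrite ?inE//.
  exact: measurable_rational_box.
rewrite /rational_box (mu_box mu_indep); last by move=> j; exact: measurable_ball.
have pos j : (0 < mu (coordinate j @^-1` ball (ratr (c.1 ord0 j) : R) c.2.+1%:R^-1))%E.
  have := cz j; rewrite mxE; set q := ratr _; set r := c.2.+1%:R^-1; set t := Finv j (v j).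
  rewrite -ball_normE /= ltr_distlC => /andP[qt tq].
  have Flt : component_cdf mu j (q - r) < component_cdf mu j t.
    have [FG _] := Finv_inv j; rewrite /t (FG _ (v01 j)) ltNge.
    by rewrite -(inverse_cdf_le _ (@component_cdf_homo _ _ mu j) (Finv_inv j))// -ltNge.
  have mray (x : R) : measurable (coordinate j @^-1` `]-oo, x]).
    by rewrite -[X in measurable X]setTI; exact: measurable_coordinate.
  apply: (@lt_le_trans _ _ (mu (coordinate j @^-1` `]-oo, t] `\` coordinate j @^-1` `]-oo, q - r]))).
    rewrite measureD; [|exact: mray|exact: mray|]; last first.
      by rewrite (le_lt_trans (probability_le1 mu (mray t)))// ltry.
    rewrite setIidr; last first.
      by move=> x /=; rewrite !in_itv/= => /le_trans; apply; exact: ltW.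
    suff : (0 < (component_cdf mu j t)%:E - (component_cdf mu j (q - r))%:E)%E.
      by rewrite -!component_cdfE.
    by rewrite -EFinB lte_fin subr_gt0.
  apply: le_measure; rewrite ?inE.
  - exact: measurableD.
  - by rewrite -[X in measurable X]setTI; apply: measurable_coordinate => //; exact: measurable_ball.
  move=> x /=; rewrite !in_itv/= => -[xt /negP]; rewrite -ltNge => qx.
  change (ball q r (coordinate j x)); rewrite -ball_normE /= ltr_distlC.
  by rewrite qx/= (le_lt_trans xt).
have fE j : mu (coordinate j @^-1` ball (ratr (c.1 ord0 j) : R) c.2.+1%:R^-1) =
   (fine (mu (coordinate j @^-1` ball (ratr (c.1 ord0 j) : R) c.2.+1%:R^-1)))%:E.
  rewrite fineK// fin_num_measure// -[X in measurable X]setTI.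
  by apply: measurable_coordinate => //; exact: measurable_ball.
under eq_bigr do rewrite fE.
rewrite prodEFin lte_fin prodr_gt0// => j _.
by rewrite -lte_fin -fE.
Qed.

End support.

(** The integrand is only meaningful on the support. As the sampled points are
    in it for every outcome, the estimators are random variables. *)
Lemma sampling_in_dsupport d (Omega : measurableType d) (R : realType)
    (P : probability Omega R) (dxi : nat) (mu : probability 'rV[R]_dxi R)
    (Finv : 'I_dxi -> R -> R) (nr : nat) (m : nat -> nat)
    (xi : nat -> nat -> nat -> bool -> Omega -> 'rV[R]_dxi) (s : sampling) :
  mutually_independent mu setT
    (fun j : 'I_dxi => sigma_of (coordinate j : 'rV[R]_dxi -> R)) ->
  (forall j, inverse_cdf (component_cdf mu j) (Finv j)) ->
  sampling_scheme P Finv nr m xi s ->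
  forall k r i b w, (1 <= k)%N -> (r < nr)%N -> (i < m k)%N ->
  dsupport mu (xi k r i (member s b) w).
Proof.
move=> mu_indep Finv_inv sch k r i b w k1 rn im.
case: s sch => /=.
  move=> [batch [u [_ u_unif _ xiE]]].
  have [xf xt] := xiE k r i w k1 rn im.
  have u01 j : 0 < u (batch k) r i j w < 1.
    by have [|//] := u_unif (batch k) r i j; exists k.
  case: b; rewrite ?xf ?xt; apply: row_Finv_dsupport => // j.
  by have /andP[u0 u1] := u01 j; rewrite subr_gt0 u1/= ltrBlDr ltrDl.
move=> [u [perm [u_unif _ _ xiE]]].
rewrite (xiE k r (Ordinal im) w k1 rn); apply: row_Finv_dsupport => // j.
set l := perm k r j w _.
have [|/(_ w)/andP[Ul Ur] _] := u_unif k r l j; first by split => //; exact: ltn_ord.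
have mR : 0 < (m k)%:R :> R by rewrite ltr0n (leq_trans _ im).
rewrite (le_lt_trans _ Ul)/= ?divr_ge0//; apply: (lt_le_trans Ur).
by rewrite ler_pdivrMr// mul1r ler_nat.
Qed.

(** * Continuity on a compact set *)

Section within_continuity.
Context {R : realType} {dx : nat} (X : set 'rV[R]_dx).

Lemma within_continuous_ball (f : 'rV[R]_dx -> R) x e :
  {within X, continuous f} -> X x -> 0 < e ->
  exists2 delta, 0 < delta & forall y, X y -> ball x delta y -> `|f x - f y| < e.
Proof.
move=> /subspace_continuousP fc Xx e0.
have /cvgrPdist_lt/(_ e e0) := fc x Xx.
rewrite /within/= => /nbhs_ballP[delta /= d0 H]; exists delta => // y Xy xy.
exact: H.
Qed.

Hypothesis Xc : compact X.

(** Uniform continuity in a form that holds for all large indices, because the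
    sets on which a modulus is valid are increasing in the index. *)
Lemma compact_modulus (f : 'rV[R]_dx -> R) e :
  {within X, continuous f} -> 0 < e ->
  \forall k \near \oo, forall x, X x -> forall y, X y ->
    ball x k.+1%:R^-1 y -> `|f x - f y| <= e.
Proof.
move=> fc e0.
have e20 : 0 < e / 2 by rewrite divr_gt0.
pose Q (k : nat) (x : 'rV[R]_dx) :=
  X x -> forall y, X y -> ball x k.+1%:R^-1 y -> `|f x - f y| <= e.
have := (compact_near_coveringP X).1 Xc nat \oo Q _ => H; move: H => /(_ _).
suff HQ : forall x, X x -> \forall x' \near x & k \near \oo, Q k x'.
  by move=> /(_ HQ); apply: filterS => k H x Xx; exact: (H x Xx Xx).
move=> x Xx; have [delta d0 H] := within_continuous_ball fc Xx e20.
have d20 : 0 < delta / 2 by rewrite divr_gt0.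
near=> x' k => Xx' y Xy x'y.
have xx' : ball x (delta / 2) x' by near: x'; exact: nbhsx_ballx.
have kd : k.+1%:R^-1 <= delta / 2.
  by apply: ltW; near: k; exact: near_infty_natSinv_lt (PosNum d20).
have xy : ball x delta y.
  by rewrite (splitr delta); apply: ball_triangle xx' _; exact: le_ball x'y.
rewrite (le_trans (ler_distD (f x) _ _))// (splitr e) lerD// ltW//.
  rewrite distrC; apply: H => //; apply: le_ball xx'.
  by rewrite ler_pdivrMr// ler_pMr// ler1n.
exact: H.
Unshelve. all: by end_near. Qed.

Lemma compact_net (delta : R) : 0 < delta ->
  exists l : seq 'rV[R]_dx, (forall p, p \in l -> X p) /\
    (forall x, X x -> exists2 p, p \in l & (ball p delta)° x).
Proof.
move=> d0; move: Xc; rewrite compact_cover => /(_ _ X (fun p => (ball p delta)°)).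
case.
- by move=> p _; exact: open_interior.
- by move=> x Xx; exists x => //; apply: nbhsx_ballx.
move=> D DX XD; exists (finmap.enum_fset D); split.
  by move=> p pD; have := DX p pD; rewrite inE.
by move=> x /XD[p /= pD xp]; exists p.
Qed.

(** A countable dense family of points of X: one point in each rational box
    that meets X. *)
Definition dense_point (c : 'rV[rat]_dx * nat) : 'rV[R]_dx :=
  xget (xget 0 X) (X `&` rational_box c).

Lemma dense_point_in c : X !=set0 -> X (dense_point c).
Proof.
move=> [x Xx]; rewrite /dense_point; case: xgetP => [y _ []//|_].
by apply: (@xgetPex _ 0 X); exists x.
Qed.

Lemma dense_point_near x (delta : R) : X x -> 0 < delta ->
  exists c, ball x delta (dense_point c).
Proof.
move=> Xx d0.
have [c cx cd] := rational_box_nbhs (open_interior (ball x delta))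
  (nbhsx_ballx x delta d0).
exists c; apply: interior_subset; apply: cd.
by rewrite /dense_point; case: xgetP => [y _ []//|/(_ x)[]].
Qed.

End within_continuity.

(** * Uniform laws of large numbers *)

Section pair_mean_theory.
Context {E : Type} {R : realType}.
Implicit Types (phi psi : E -> R) (y : nat -> bool -> E).

Lemma pair_mean_le N phi psi y : (forall e, phi e <= psi e) ->
  pair_mean N phi y <= pair_mean N psi y.
Proof.
move=> H; rewrite /pair_mean ler_wpM2l ?invr_ge0//.
by apply: ler_sum => i _; rewrite ler_wpM2l ?invr_ge0// lerD.
Qed.

Lemma pair_mean_affine N a b phi y : (0 < N)%N ->
  pair_mean N (fun e => a + b * phi e) y = a + b * pair_mean N phi y.
Proof.
move=> N0; rewrite /pair_mean.
under eq_bigr => i _.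
  have -> : 2^-1 * (a + b * phi (y i false) + (a + b * phi (y i true))) =
    a + b * (2^-1 * (phi (y i false) + phi (y i true))) by field.
  over.
rewrite big_split/= -mulr_sumr sumr_const card_ord -(mulr_natl a) mulrDr mulKf ?pnatr_eq0 -?lt0n//.
by rewrite mulrCA.
Qed.

Lemma pair_meanB N phi psi y :
  pair_mean N (fun e => phi e - psi e) y = pair_mean N phi y - pair_mean N psi y.
Proof.
rewrite /pair_mean -mulrBr -sumrB; congr (_ * _); apply: eq_bigr => i _.
by rewrite -mulrBr; congr (_ * _); ring.
Qed.

Lemma pair_mean_dist N phi psi chi y a b : (0 < N)%N ->
  (forall e, `|phi e - psi e| <= a + b * chi e) ->
  `|pair_mean N phi y - pair_mean N psi y| <= a + b * pair_mean N chi y.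
Proof.
move=> N0 H; rewrite -pair_mean_affine// ler_norml lerNl opprB -!pair_meanB.
by apply/andP; split; apply: pair_mean_le => e; apply: le_trans (H e);
  [rewrite distrC|]; exact: ler_norm.
Qed.

End pair_mean_theory.

Section random_functions.
Context {R : realType} {dx : nat} (X : set 'rV[R]_dx).
Context {dE : measure_display} {E : measurableType dE} (mu : probability E R).
Variable g : 'rV[R]_dx -> E -> R.
Hypotheses (Xc : compact X) (X0 : X !=set0).
Hypothesis mg : forall x, X x -> measurable_fun setT (g x).
Hypothesis gc : forall e, {within X, continuous (fun x => g x e)}.

Let q (c : 'rV[rat]_dx * nat) := dense_point X c.
Let Xq c : X (q c). Proof. exact: dense_point_in. Qed.

(** The oscillation is taken over countably many points of X, which makes the
    set measurable; by continuity it is the oscillation over X. *)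
Definition osc_set (eta : R) (k : nat) : set E :=
  [set e | forall c c', ball (q c) k.+1%:R^-1 (q c') ->
     `|g (q c) e - g (q c') e| <= eta].

Lemma measurable_osc_set eta k : measurable (osc_set eta k).
Proof.
pose B (p : ('rV[rat]_dx * nat) * ('rV[rat]_dx * nat)) : set E :=
  if `[< ball (q p.1) (k.+1%:R^-1 : R) (q p.2) >]
  then [set e | eta < `|g (q p.1) e - g (q p.2) e|] else set0.
rewrite (_ : osc_set eta k = ~` \bigcup_p B p); last first.
  apply/seteqP; split => e.
    move=> He [[c c'] _]; rewrite /B; case: asboolP => //= cc'.
    by rewrite ltNge (He c c' cc').
  move=> He c c' cc'; rewrite leNgt; apply/negP => H; apply: He.
  by exists (c, c') => //; rewrite /B asboolT.
apply: measurableC; apply: countable_bigcupT_measurable; first exact: countableP.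
move=> p; rewrite /B; case: asboolP => // _; apply: measurable_set_lt => //.
by apply: measurableT_comp => //; apply: measurable_funB; exact: mg.
Qed.

Lemma osc_set_mono (eta : R) : {homo osc_set eta : k l / (k <= l)%N >-> (k <= l)%O}.
Proof.
move=> k l kl; apply/subsetPset => e He c c' cc'; apply: He; apply: le_ball cc'.
by rewrite lef_pV2 ?posrE// ler_nat.
Qed.

Lemma osc_set_cover eta : 0 < eta -> \bigcup_k osc_set eta k = setT.
Proof.
move=> eta0; apply/seteqP; split => // e _.
have [k _ Hk] := compact_modulus Xc (@gc e) eta0.
by exists k => // c c'; apply: (Hk k) => //=.
Qed.

(** The radius is halved to leave room for the approximation of x and y by
    points of the dense family. *)
Lemma osc_set_modulus eta k e x y : osc_set eta k e -> X x -> X y ->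
  ball x (k.+1%:R^-1 / 2) y -> `|g x e - g y e| <= eta.
Proof.
move=> He Xx Xy xy; apply/ler_addgt0Pr => t t0.
have t20 : 0 < t / 2 by rewrite divr_gt0.
have [d1 d10 H1] := within_continuous_ball (@gc e) Xx t20.
have [d2 d20 H2] := within_continuous_ball (@gc e) Xy t20.
pose r : R := k.+1%:R^-1 / 2 / 2.
have r0 : 0 < r by rewrite !divr_gt0.
have m1 : 0 < Num.min d1 r by rewrite lt_min d10.
have m2 : 0 < Num.min d2 r by rewrite lt_min d20.
have [c xc] := dense_point_near Xx m1.
have [c' yc'] := dense_point_near Xy m2.
have {}H1 : `|g x e - g (q c) e| < t / 2.
  by apply: H1 => //; apply: le_ball xc; rewrite ge_min lexx.
have {}H2 : `|g y e - g (q c') e| < t / 2.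
  by apply: H2 => //; apply: le_ball yc'; rewrite ge_min lexx.
have H3 : `|g (q c) e - g (q c') e| <= eta.
  apply: He; rewrite (_ : k.+1%:R^-1 = (r + k.+1%:R^-1 / 2) + r); last by rewrite /r; field.
  apply: (@ball_triangle _ _ y); last by apply: le_ball yc'; rewrite ge_min lexx orbT.
  apply: ball_triangle xy; apply: ball_sym.
  by apply: le_ball xc; rewrite ge_min lexx orbT.
rewrite (_ : g x e - g y e = (g x e - g (q c) e) + (g (q c) e - g (q c') e)
  - (g y e - g (q c') e)); last by ring.
apply: (le_trans (ler_normB _ _)); apply: (le_trans (lerD (ler_normD _ _) (lexx _))).
lra.
Qed.

(** Every sample path is uniformly continuous on the compact set X, and so the
    sets on which a given modulus is valid increase to the whole space. *)
Lemma stochastic_modulus (eta eta2 : R) : 0 < eta -> 0 < eta2 ->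
  exists A delta, [/\ measurable A, 0 < delta, (mu (~` A) <= eta2%:E)%E &
    forall x y e, X x -> X y -> ball x delta y -> A e -> `|g x e - g y e| <= eta].
Proof.
move=> eta0 eta20.
have mO k := measurable_osc_set eta k.
have := nondecreasing_cvg_mu (mu := mu) mO _ (@osc_set_mono eta).
rewrite osc_set_cover// => /(_ measurableT) cv.
have lt1 : ((1 - eta2)%:E < mu setT)%E by rewrite probability_setT lte_fin; lra.
have : \forall k \near \oo, ((1 - eta2)%:E < mu (osc_set eta k))%E.
  exact: (cv _ (open_ereal_gt' lt1)).
move=> [k _ /(_ k (leqnn k)) Hk].
exists (osc_set eta k), (k.+1%:R^-1 / 2); split => //.
- rewrite probability_setC; last exact: mO.
  rewrite leeBlDr; last by rewrite fin_num_measure; last exact: mO.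
  rewrite -leeBlDl// -EFinB; exact: ltW.
- by move=> x y e Xx Xy xy He; exact: osc_set_modulus He Xx Xy xy.
Qed.

End random_functions.

Section bounded_integrals.
Context d (T : measurableType d) (R : realType) (mu : probability T R).

Lemma bounded_integrable (f : T -> R) C : measurable_fun setT f ->
  (forall t, `|f t| <= C) -> mu.-integrable setT (EFin \o f).
Proof.
move=> mf fC; apply: measurable_bounded_integrable => //.
  by rewrite (le_lt_trans (probability_le1 _ _))// ltry.
exists C; split; first exact: num_real.
by move=> y Cy t _ /=; apply: le_trans (fC t) _; exact: ltW.
Qed.

Lemma Rintegral_le (f g : T -> R) : mu.-integrable setT (EFin \o f) ->
  mu.-integrable setT (EFin \o g) -> (forall t, f t <= g t) ->
  \int[mu]_t f t <= \int[mu]_t g t.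
Proof. by move=> fi gi fg; apply: le_Rintegral => // t _; exact: fg. Qed.

Lemma Rintegral_prob_cst (r : R) : \int[mu]_(t in setT) r = r.
Proof.
by rewrite Rintegral_cst//= [X in fine X](_ : _ = 1%E) ?mulr1//; exact: probability_setT.
Qed.

Lemma square_integrable (f : T -> R) M : measurable_fun setT f ->
  (\int[mu]_t (f t ^+ 2)%:E <= M%:E)%E ->
  mu.-integrable setT (EFin \o f) /\
  mu.-integrable setT (EFin \o (fun t => f t ^+ 2)).
Proof.
move=> mf fM.
have mf2 : measurable_fun setT (fun t => f t ^+ 2) by exact: (measurable_funX 2).
have f2i : mu.-integrable setT (EFin \o (fun t => f t ^+ 2)).
  apply/integrableP; split; first exact/measurable_EFinP.
  under eq_integral do rewrite /= ger0_norm ?sqr_ge0//.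
  by apply: le_lt_trans fM _; rewrite ltry.
split=> //.
have c1 : mu.-integrable setT (EFin \o cst (1 : R)).
  by apply: (@bounded_integrable _ 1) => // t; rewrite normr1.
apply: le_integrable (integrableD measurableT f2i c1) => //.
  exact/measurable_EFinP.
move=> t _; rewrite /= lee_fin [leRHS]ger0_norm; last by rewrite addr_ge0// sqr_ge0.
have := sqr_ge0 (`|f t| - 1); have := normr_ge0 (f t).
rewrite -(real_normK (num_real (f t))) /cst; nra.
Qed.

End bounded_integrals.

Section random_functions_lln.
Context {R : realType} {dx : nat} (X : set 'rV[R]_dx).
Context {dE : measure_display} {E : measurableType dE} (mu : probability E R).
Variable g : 'rV[R]_dx -> E -> R.
Hypotheses (Xc : compact X) (X0 : X !=set0).
Hypothesis mg : forall x, X x -> measurable_fun setT (g x).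
Hypothesis gc : forall e, {within X, continuous (fun x => g x e)}.

(** For x and y in a finite net there are finitely many bounded functions to
    control. A general pair is compared with a pair of the net: outside an
    event of small probability the functions are close, and on that event,
    whose empirical frequency is controlled by one more law of large numbers,
    they are bounded by C. *)
Lemma uniform_lln (phi : R -> R) (C L K eta : R) :
  measurable_fun setT phi -> (forall t, `|phi t| <= C) ->
  (forall s t, `|phi s - phi t| <= L * `|s - t|) ->
  0 < eta -> 0 <= K ->
  exists2 K', 0 <= K' &
    forall d (Omega : measurableType d) (P : probability Omega R) (N : nat)
      (z : nat -> bool -> Omega -> E),
    (0 < N)%N -> design P mu N (1 + K / N%:R) z ->
    exists B, [/\ measurable B, (P B <= (K' / N%:R)%:E)%E &
      forall w, ~ B w -> forall x y, X x -> X y ->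
      `|pair_mean N (fun e => phi (g x e - g y e)) (fun i b => z i b w) -
        \int[mu]_e phi (g x e - g y e)| <= eta].
Proof.
move=> mphi phiC phiL eta0 K0.
have C0 : 0 <= C by apply: le_trans (phiC 0).
have L0 : 0 <= L.
  have := phiL 1 0; rewrite subr0 normr1 mulr1; exact: le_trans.
(* The error is at most 4 L eta1 from the modulus of continuity, 6 C eta2
   from the points outside A (frequency at most 2 eta2, measure at most eta2)
   and eta2 at the points of the net. *)
pose eta1 := eta / (8 * (L + 1)).
pose eta2 := eta / (2 * (6 * C + 1)).
have eta10 : 0 < eta1 by rewrite divr_gt0// mulr_gt0// ltr_wpDl.
have eta20 : 0 < eta2 by rewrite divr_gt0// mulr_gt0// ltr_wpDl// mulr_ge0.
have [A [delta [mA delta0 muA modA]]] := stochastic_modulus mu Xc X0 mg gc eta10 eta20.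
have [l [lX lnet]] := compact_net Xc delta0.
pose n := size l.
pose pt (i : 'I_n) := nth 0 l i.
have ptX i : X (pt i) by apply: lX; rewrite mem_nth.
pose psi (p : 'I_n * 'I_n) e := phi (g (pt p.1) e - g (pt p.2) e).
pose chi : E -> R := \1_(~` A).
have mchi : measurable_fun setT chi by apply: measurable_indic; exact: measurableC.
have chi01 e : 0 <= chi e <= 1 by rewrite /chi indicE; case: (_ \in _) => /=; rewrite ?lexx ?ler01.
have mpsi0 x y : X x -> X y -> measurable_fun setT (fun e => phi (g x e - g y e)).
  move=> Xx Xy; apply: measurableT_comp => //.
  by apply: measurable_funB; exact: mg.
have mpsi p : measurable_fun setT (psi p) by exact: mpsi0.
have sq (f : E -> R) (c : R) : (forall e, `|f e| <= c) -> measurable_fun setT f ->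
    (\int[mu]_e (f e ^+ 2)%:E <= (c ^+ 2)%:E)%E.
  move=> fc mf; have c0 : 0 <= c by apply: le_trans (fc point).
  apply: (@le_trans _ _ (\int[mu]_e (c ^+ 2)%:E)%E).
    apply: ge0_le_integral => //.
    - by move=> e _; rewrite lee_fin sqr_ge0.
    - by apply/measurable_EFinP; exact: (measurable_funX 2).
    - by move=> e _; rewrite lee_fin -(real_normK (num_real (f e))) ler_pXn2r// nnegrE.
  by rewrite integral_cst//= probability_setT mule1.
pose K' := 8 * (1 + K) * (n%:R ^+ 2 * C ^+ 2 + 1) / eta2 ^+ 2.
exists K'.
  by rewrite /K' !mulr_ge0 ?addr_ge0// ?mulr_ge0 ?invr_ge0 ?exprn_ge0// ltW.
move=> d Omega P N z N0 zP.
have c0 : 0 <= 1 + K / N%:R by rewrite addr_ge0// divr_ge0.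
pose bad (f : E -> R) := [set w | eta2 <= `|pair_mean N f (fun i b => z i b w) - \int[mu]_e f e|].
have mbad (f : E -> R) : measurable_fun setT f -> measurable (bad f).
  move=> mf; apply: measurable_set_le => //; apply: measurableT_comp => //.
  apply: measurable_funB => //.
  by apply: measurable_pair_mean => //; have [] := zP.
have Pbad (f : E -> R) (c : R) : measurable_fun setT f -> (forall e, `|f e| <= c) ->
    (P (bad f) <= (8 * (1 + K) * c ^+ 2 / (N%:R * eta2 ^+ 2))%:E)%E.
  move=> mf fc; apply: (design_lln N0 c0 zP eta20 K0) => //; exact: sq.
pose B1 := \bigcup_(p : 'I_n * 'I_n) bad (psi p).
have mB1 : measurable B1 by apply: fin_bigcup_measurable => // p _; exact: mbad.
exists (B1 `|` bad chi); split.
- by apply: measurableU => //; exact: mbad.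
- apply: le_trans (measureU2 _ _ _) _ => //; first exact: mbad.
  have PB1 : (P B1 <= \sum_(p : 'I_n * 'I_n) P (bad (psi p)))%E.
    by apply: le_measure_bigsetU => // p; exact: mbad.
  have Pchi := Pbad chi 1 mchi.
  apply: (le_trans (leeD PB1 (Pbad chi 1 mchi _))).
    by move=> e; have /andP[h0 h1] := chi01 e; rewrite ger0_norm.
  apply: (@le_trans _ _ ((\sum_(p : 'I_n * 'I_n)
      (8 * (1 + K) * C ^+ 2 / (N%:R * eta2 ^+ 2))%:E) +
      (8 * (1 + K) * 1 ^+ 2 / (N%:R * eta2 ^+ 2))%:E)%E).
    by rewrite leeD2r//; apply: lee_sum => p _; apply: Pbad => // e; exact: phiC.
  rewrite sumEFin -EFinD lee_fin sumr_const card_prod card_ord -[X in X + _]mulr_natl natrM.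
  rewrite le_eqVlt; apply/orP; left; apply/eqP; rewrite /K'.
  by field; rewrite !gt_eqF// ?ltr0n.
move=> w Bw x y Xx Xy.
have [p pl /interior_subset px] := lnet x Xx.
have [p' p'l /interior_subset p'y] := lnet y Xy.
have il : (index p l < n)%N by rewrite index_mem.
have il' : (index p' l < n)%N by rewrite index_mem.
pose ij := (Ordinal il, Ordinal il').
have ptp : pt ij.1 = p by rewrite /pt/= nth_index.
have ptp' : pt ij.2 = p' by rewrite /pt/= nth_index.
have close e : `|phi (g x e - g y e) - psi ij e| <= L * (2 * eta1) + 2 * C * chi e.
  rewrite /psi ptp ptp' /chi indicE.
  have [Ae|nAe] := boolP (e \in ~` A) => /=.
    rewrite mulr1; apply: (le_trans (ler_normB _ _)).
    have := phiC (g x e - g y e); have := phiC (g p e - g p' e).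
    have : 0 <= L * (2 * eta1) by rewrite mulr_ge0// mulr_ge0// ltW.
    lra.
  rewrite mulr0 addr0; apply: (le_trans (phiL _ _)); rewrite ler_wpM2l//.
  have {}Ae : A e by move: nAe; rewrite notin_setE /= => /contrapT.
  rewrite (_ : _ - _ - _ = (g p' e - g y e) - (g p e - g x e)); last by ring.
  apply: (le_trans (ler_normB _ _)); rewrite (_ : 2 * eta1 = eta1 + eta1) ?lerD//; last by ring.
    by apply: modA => //; rewrite -ptp'; exact: ptX.
  by apply: modA => //; rewrite -ptp; exact: ptX.
have mclose := pair_mean_dist (fun i b => z i b w) N0 close.
have ip : mu.-integrable setT (EFin \o (fun e => phi (g x e - g y e))).
  by apply: (@bounded_integrable _ _ _ mu _ C) => //; exact: mpsi0.
have ipsi : mu.-integrable setT (EFin \o psi ij).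
  by apply: (@bounded_integrable _ _ _ mu _ C) => // e; exact: phiC.
have ichi : mu.-integrable setT (EFin \o chi).
  by apply: (@bounded_integrable _ _ _ mu _ 1) => // e; have /andP[h0 h1] := chi01 e; rewrite ger0_norm.
have intchi : \int[mu]_e chi e <= eta2.
  have mAC : measurable (~` A) by exact: measurableC.
  by rewrite /Rintegral /chi integral_indic// setIT -lee_fin fineK// fin_num_measure.
have iclose : `|\int[mu]_e phi (g x e - g y e) - \int[mu]_e psi ij e| <=
    L * (2 * eta1) + 2 * C * \int[mu]_e chi e.
  rewrite -RintegralB//; apply: le_trans (le_normr_Rintegral _ _) _ => //.
    exact: (integrableB measurableT ip ipsi).
  have i1 : mu.-integrable setT (EFin \o (fun=> L * (2 * eta1))).
    by apply: (@bounded_integrable _ _ _ mu _ `|L * (2 * eta1)|).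
  have i2 : mu.-integrable setT (EFin \o (fun e => 2 * C * chi e)).
    exact: (integrableZl measurableT (2 * C) ichi).
  rewrite -RintegralZl// -[X in X + _](Rintegral_prob_cst mu) -RintegralD//.
  apply: Rintegral_le.
  - exact: (integrable_norm (integrableB measurableT ip ipsi)).
  - exact: (integrableD measurableT i1 i2).
  - exact: close.
have b1 : `|pair_mean N (psi ij) (fun i b => z i b w) - \int[mu]_e psi ij e| < eta2.
  by rewrite ltNge; apply/negP => H; apply: Bw; left; exists ij.
have b2 : `|pair_mean N chi (fun i b => z i b w) - \int[mu]_e chi e| < eta2.
  by rewrite ltNge; apply/negP => H; apply: Bw; right.
have tri (r1 r2 r3 r4 : R) : `|r1 - r4| <= `|r1 - r2| + `|r2 - r3| + `|r4 - r3|.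
  rewrite (_ : r1 - r4 = (r1 - r2) + (r2 - r3) - (r4 - r3)); last by ring.
  by rewrite (le_trans (ler_normB _ _))// lerD2r ler_normD.
apply: le_trans (tri _ (pair_mean N (psi ij) (fun i b => z i b w))
  (\int[mu]_e psi ij e) _) _.
have mchi2 : pair_mean N chi (fun i b => z i b w) <= 2 * eta2.
  by have := ler_norm (pair_mean N chi (fun i b => z i b w) - \int[mu]_e chi e); lra.
have e1 : 4 * (L * eta1) <= eta / 2.
  have : eta1 * (8 * (L + 1)) = eta by rewrite divfK// gt_eqF// mulr_gt0// ltr_wpDl.
  by move: eta10; lra.
have e2 : 6 * (C * eta2) + eta2 <= eta / 2.
  have : eta2 * (2 * (6 * C + 1)) = eta.
    by rewrite divfK// gt_eqF// mulr_gt0// ltr_wpDl// mulr_ge0.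
  lra.
have m1 : 2 * C * pair_mean N chi (fun i b => z i b w) <= 4 * (C * eta2).
  rewrite (_ : 4 * _ = 2 * C * (2 * eta2)); last by ring.
  by rewrite ler_wpM2l// mulr_ge0.
have m2 : 2 * C * (\int[mu]_e chi e) <= 2 * (C * eta2).
  by rewrite -mulrA !ler_wpM2l.
lra.
Qed.

End random_functions_lln.

(** * Truncation and the stopping criterion *)

Section clamping.
Context {R : realType}.
Variable B : R.

Definition clamp (t : R) : R := Num.max (- B) (Num.min B t).

Lemma clampP (B0 : 0 < B) (t : R) : [\/ (t < - B /\ clamp t = - B), (- B <= t <= B /\ clamp t = t)
  | (B < t /\ clamp t = B)].
Proof.
rewrite /clamp; have [tB|tB] := ltP t (- B).
  have tB' : t <= B by lra.
  by apply: Or31; rewrite (min_idPr tB') (max_idPl _)// ltW.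
have [Bt|Bt] := ltP B t.
  by apply: Or33; rewrite (max_idPr _)//; lra.
by apply: Or32; split; [apply/andP|rewrite (max_idPr tB)].
Qed.

Lemma clamp_norm (B0 : 0 < B) t : `|clamp t| <= B.
Proof.
by rewrite ler_norml; case: (clampP B0 t) => [[_ ->]|[/andP[? ?] ->]|[_ ->]]; apply/andP; split; lra.
Qed.

Lemma clamp_lipschitz (B0 : 0 < B) s t : `|clamp s - clamp t| <= 1 * `|s - t|.
Proof.
rewrite mul1r; case: (ger0P (s - t)) => st;
case: (clampP B0 t) => [[? ->]|[/andP[? ?] ->]|[? ->]];
case: (clampP B0 s) => [[? ->]|[/andP[? ?] ->]|[? ->]];
by rewrite ler_norml; apply/andP; split; lra.
Qed.

Lemma measurable_clamp : measurable_fun setT clamp.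
Proof.
apply: measurable_maxr => //; apply: measurable_minr => //.
Qed.

Lemma clamp_dist (B0 : 0 < B) t : `|t - clamp t| <= t ^+ 2 / B.
Proof.
rewrite ler_pdivlMr//.
case: (clampP B0 t) => [[? ->]|[/andP[? ?] ->]|[? ->]].
- by rewrite ltr0_norm; [nra|lra].
- by rewrite subrr normr0 mul0r sqr_ge0.
- by rewrite gtr0_norm; [nra|lra].
Qed.

(** A Lipschitz majorant of the indicator of the values that the truncation
    changes, so that the uniform law of large numbers applies to it. *)
Definition tail_weight (t : R) : R := (clamp t / B) ^+ 2.

Lemma tail_weight_norm (B0 : 0 < B) t : `|tail_weight t| <= 1.
Proof.
rewrite ger0_norm ?sqr_ge0// /tail_weight -(real_normK (num_real _)).
rewrite exprn_ile1// normrM normfV (gtr0_norm B0) ler_pdivrMr// mul1r.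
exact: clamp_norm.
Qed.

Lemma tail_weight_ge0 t : 0 <= tail_weight t. Proof. exact: sqr_ge0. Qed.

Lemma tail_weight_large (B0 : 0 < B) t : ~ (- B <= t <= B) -> tail_weight t = 1.
Proof.
rewrite /tail_weight; case: (clampP B0 t) => [[_ ->] _|[-> _] //|[_ ->] _].
  by rewrite mulNr divff ?gt_eqF// sqrrN expr1n.
by rewrite divff ?gt_eqF// expr1n.
Qed.

Lemma tail_weight_lipschitz (B0 : 0 < B) s t : `|tail_weight s - tail_weight t| <= 2 / B * `|s - t|.
Proof.
rewrite /tail_weight subr_sqr -mulrBl -mulrDl normrM !normrM normfV (gtr0_norm B0).
have h1 := clamp_lipschitz B0 s t; rewrite mul1r in h1.
have h2 : `|clamp s + clamp t| <= 2 * B.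
  by rewrite (le_trans (ler_normD _ _))//; have := clamp_norm B0 s; have := clamp_norm B0 t; lra.
rewrite [leRHS](_ : _ = (`|s - t| / B) * (2 * B / B)); last by field; rewrite gt_eqF.
by rewrite ler_pM// ?divr_ge0// ?ler_pM2r ?invr_gt0// ltW.
Qed.

Lemma measurable_tail_weight : measurable_fun setT tail_weight.
Proof.
by apply: (measurable_funX 2); apply: measurable_funM => //; exact: measurable_clamp.
Qed.

Lemma tail_weight_le (B0 : 0 < B) t : tail_weight t <= t ^+ 2 / B ^+ 2.
Proof.
rewrite /tail_weight expr_div_n ler_pM2r ?invr_gt0 ?exprn_gt0//.
by case: (clampP B0 t) => [[? ->]|[_ ->]|[? ->]] //; nra.
Qed.

End clamping.

(** If the average of the D_i exceeds epsilon although their clamped average is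
    small, then the average is carried by few indices, and the Cauchy-Schwarz
    inequality forces the variance to be large. *)
Lemma gap_le_sqrt_variance (R : realType) (N : nat) (y : nat -> bool -> R)
    (B rho eps h : R) :
  (2 <= N)%N -> 0 < B -> 0 < rho -> 0 < eps -> 0 < h ->
  2 * rho * B <= eps / 4 -> 8 * rho * (1 + h ^+ 2) <= h ^+ 2 ->
  pair_mean N (clamp B) y <= eps / 4 -> pair_mean N (tail_weight B) y <= rho ->
  let D i := 2^-1 * (y i false + y i true) in
  let m := N%:R^-1 * \sum_(i < N) D i in
  let S := (N%:R - 1)^-1 * \sum_(i < N) (D i - m) ^+ 2 in
  (m <= h * Num.sqrt S + eps : Prop).
Proof.
move=> N2 B0 rho0 eps0 h0 rhoB rhoh clampy taily D m S.
have [meps|meps] := leP m eps.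
  by rewrite ler_wpDl// mulr_ge0 ?sqrtr_ge0// ltW.
have m0 : 0 < m by exact: lt_trans meps.
have NR : 1 < N%:R :> R by rewrite ltr1n.
have N0 : 0 < N%:R :> R by exact: lt_trans NR.
pose V := N%:R^-1 * \sum_(i < N) D i ^+ 2.
pose c i := 2^-1 * (clamp B (y i false) + clamp B (y i true)).
pose p i := tail_weight B (y i false) + tail_weight B (y i true).
(* Either both members are left unchanged by the truncation, or the weight
   p_i is at least 1 and D_i is estimated by the inequality of arithmetic and
   geometric means with parameter t. *)
have key i (t : R) : 0 < t ->
    D i <= c i + (t * D i ^+ 2 + p i / t) / 2 + B * p i.
  move=> t0.
  have c1 : `|c i| <= B.
    rewrite /c normrM ger0_norm// (le_trans (ler_wpM2l _ (ler_normD _ _)))//.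
    by have := clamp_norm B0 (y i false); have := clamp_norm B0 (y i true); lra.
  have tw b : 0 <= tail_weight B (y i b) by exact: tail_weight_ge0.
  have sq : 0 <= t * D i ^+ 2 by rewrite mulr_ge0 ?sqr_ge0// ltW.
  have p0 : 0 <= p i by exact: addr_ge0.
  have pt : 0 <= p i / t by rewrite divr_ge0// ltW.
  have [[yf yt]|nS] := pselect ((- B <= y i false <= B) /\ (- B <= y i true <= B)).
    have -> : D i = c i.
      rewrite /D /c; case: (clampP B0 (y i false)) => [[H _]|[_ ->]|[H _]].
      - by move: yf; rewrite leNgt H.
      - case: (clampP B0 (y i true)) => [[H _]|[_ ->]//|[H _]].
          by move: yt; rewrite leNgt H.
        by move: yt; rewrite andbC leNgt H.
      - by move: yf; rewrite andbC leNgt H.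
    have : 0 <= B * p i by rewrite mulr_ge0// ltW.
    have : t * c i ^+ 2 >= 0 by rewrite mulr_ge0 ?sqr_ge0// ltW.
    lra.
  have p1 : 1 <= p i.
    rewrite /p; have [yf|nyf] := pselect (- B <= y i false <= B).
      by rewrite [X in _ + X](tail_weight_large B0) ?lerDr//; move=> yt; apply: nS.
    by rewrite (tail_weight_large B0)// lerDl.
  have cB : - (B * p i) <= c i.
    rewrite lerNl; apply: (@le_trans _ _ B); last by rewrite ler_peMr// ltW.
    by apply: le_trans c1; rewrite -normrN ler_norm.
  have t1 : t^-1 <= p i / t by rewrite ler_peMl// invr_ge0 ltW.
  have : 2 * D i <= t * D i ^+ 2 + t^-1.
    have : 0 <= (t * D i - 1) ^+ 2 / t by rewrite divr_ge0 ?sqr_ge0// ltW.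
    rewrite (_ : _ / t = t * D i ^+ 2 + t^-1 - 2 * D i); first by lra.
    by field; rewrite gt_eqF.
  lra.
have mkey (t : R) : 0 < t -> m <= eps / 4 + (t * V + 2 * rho / t) / 2 + B * (2 * rho).
  move=> t0.
  have : m <= pair_mean N (clamp B) y + (t * V + 2 * pair_mean N (tail_weight B) y / t) / 2
            + B * (2 * pair_mean N (tail_weight B) y).
    have -> : pair_mean N (tail_weight B) y = N%:R^-1 * (2^-1 * \sum_(i < N) p i).
      by rewrite /pair_mean; congr (_ * _); rewrite mulr_sumr.
    rewrite [leRHS](_ : _ = N%:R^-1 *
      \sum_(i < N) (c i + (t * D i ^+ 2 + p i / t) / 2 + B * p i)); last first.
      have -> : \sum_(i < N) (c i + (t * D i ^+ 2 + p i / t) / 2 + B * p i) =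
          \sum_(i < N) c i + (t * (\sum_(i < N) D i ^+ 2) + (\sum_(i < N) p i) / t) / 2
            + B * \sum_(i < N) p i.
        rewrite [B * _]mulr_sumr [t * _]mulr_sumr [_ / t]mulr_suml -big_split/=.
        by rewrite [_ / 2]mulr_suml -!big_split.
      by rewrite /pair_mean /V; field; rewrite !gt_eqF.
    by rewrite ler_pM2l ?invr_gt0//; apply: ler_sum => i _; exact: key.
  move=> /le_trans; apply; rewrite lerD//; last by rewrite ler_pM2l// ler_pM2l.
  by rewrite lerD// ler_pM2r// lerD2l ler_pM2r ?invr_gt0// ler_pM2l.
have Vm : m ^+ 2 <= 8 * rho * V.
  (* With this t the term 2 rho / t is m/2, and the left-hand side absorbs
     it. *)
  have t0 : 0 < 4 * rho / m by rewrite divr_gt0// mulr_gt0.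
  have := mkey _ t0.
  rewrite (_ : 2 * rho / (4 * rho / m) = m / 2); last by field; rewrite !gt_eqF.
  move=> H; have {}H : m / 4 <= 2 * rho * V / m by move: H; lra.
  have : (m / 4) * m <= 2 * rho * V by rewrite -ler_pdivlMr.
  by rewrite expr2; lra.
have SE : S = N%:R / (N%:R - 1) * (V - m ^+ 2).
  have NV : \sum_(i < N) D i ^+ 2 = N%:R * V by rewrite /V mulVKf// gt_eqF.
  have Nm : \sum_(i < N) D i = N%:R * m by rewrite /m mulVKf// gt_eqF.
  rewrite /S; under eq_bigr do rewrite sqrrB.
  rewrite big_split/= big_split/= NV sumr_const card_ord -(mulr_natl (m ^+ 2)).
  rewrite [X in _ + X + _](_ : _ = - (2 * m * (N%:R * m))); last first.
    by rewrite -Nm mulr_sumr -sumrN; apply: eq_bigr => i _; rewrite -mulr_natr; ring.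
  field; rewrite subr_eq0 gt_eqF//.
have Vm2 : m ^+ 2 / h ^+ 2 <= V - m ^+ 2.
  have V0 : 0 <= V by rewrite mulr_ge0 ?invr_ge0 ?ler0n// sumr_ge0// => i _; exact: sqr_ge0.
  have h20 : 0 < h ^+ 2 by rewrite exprn_gt0.
  have h1 := ler_wpM2r V0 rhoh.
  have h2 : m ^+ 2 * (1 + h ^+ 2) <= 8 * rho * V * (1 + h ^+ 2).
    by rewrite ler_wpM2r// addr_ge0// ltW.
  rewrite ler_pdivrMr//; move: h1 h2; lra.
have mS : m ^+ 2 / h ^+ 2 <= S.
  rewrite SE (le_trans Vm2)// ler_peMl//.
    by apply: le_trans Vm2; rewrite divr_ge0 ?sqr_ge0.
  by rewrite ler_pdivlMr ?subr_gt0// mul1r gerBl.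
have : m / h <= Num.sqrt S.
  rewrite -(ger0_norm (_ : 0 <= m / h)); last by rewrite divr_ge0// ltW.
  by rewrite -sqrtr_sqr ler_wsqrtr// expr_div_n.
rewrite ler_pdivrMr// mulrC => H; apply: le_trans H _.
by rewrite lerDl ltW.
Qed.

Section square_integrable_random_functions.
Context {R : realType} {dx : nat} (X : set 'rV[R]_dx).
Context {dE : measure_display} {E : measurableType dE} (mu : probability E R).
Variable g : 'rV[R]_dx -> E -> R.
Hypotheses (Xc : compact X) (X0 : X !=set0).
Hypothesis mg : forall x, X x -> measurable_fun setT (g x).
Hypothesis gc : forall e, {within X, continuous (fun x => g x e)}.
Variable M : R.
Hypothesis M0 : 0 < M.
Hypothesis gM : forall x, X x -> (\int[mu]_e (g x e ^+ 2)%:E <= M%:E)%E.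

Let int1 x : X x -> mu.-integrable setT (EFin \o g x).
Proof. by move=> Xx; have [] := square_integrable (mg Xx) (gM Xx). Qed.

Let int2 x : X x -> mu.-integrable setT (EFin \o (fun e => g x e ^+ 2)).
Proof. by move=> Xx; have [] := square_integrable (mg Xx) (gM Xx). Qed.

Let M2 x : X x -> \int[mu]_e (g x e ^+ 2) <= M.
Proof.
move=> Xx; rewrite -lee_fin /Rintegral fineK; first exact: gM.
exact: (integrable_fin_num measurableT (int2 Xx)).
Qed.

Let D x y e := g x e - g y e.

Let mD x y : X x -> X y -> measurable_fun setT (D x y).
Proof. by move=> Xx Xy; apply: measurable_funB; exact: mg. Qed.

Let intD x y : X x -> X y -> mu.-integrable setT (EFin \o D x y).
Proof. by move=> Xx Xy; exact: (integrableB measurableT (int1 Xx) (int1 Xy)). Qed.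

Let intDE x y : X x -> X y ->
  \int[mu]_e D x y e = \int[mu]_e g x e - \int[mu]_e g y e.
Proof. by move=> Xx Xy; rewrite RintegralB//; exact: int1. Qed.

Let intD2 x y : X x -> X y ->
  mu.-integrable setT (EFin \o (fun e => D x y e ^+ 2)) /\
  \int[mu]_e (D x y e ^+ 2) <= 4 * M.
Proof.
move=> Xx Xy.
have i4 : mu.-integrable setT (EFin \o (fun e => 2 * g x e ^+ 2 + 2 * g y e ^+ 2)).
  exact: (integrableD measurableT (integrableZl measurableT 2 (int2 Xx))
    (integrableZl measurableT 2 (int2 Xy))).
have D24 e : D x y e ^+ 2 <= 2 * g x e ^+ 2 + 2 * g y e ^+ 2.
  by rewrite /D; have := sqr_ge0 (g x e + g y e); lra.
have iD2 : mu.-integrable setT (EFin \o (fun e => D x y e ^+ 2)).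
  apply: le_integrable i4 => //.
    by apply/measurable_EFinP; apply: (measurable_funX 2); exact: mD.
  move=> e _ /=; rewrite lee_fin ger0_norm ?sqr_ge0//.
  by rewrite ger0_norm// addr_ge0// mulr_ge0// sqr_ge0.
split => //; apply: le_trans (Rintegral_le iD2 i4 D24) _.
rewrite RintegralD//; last 2 first.
- exact: (integrableZl measurableT 2 (int2 Xx)).
- exact: (integrableZl measurableT 2 (int2 Xy)).
rewrite !RintegralZl//; [|exact: int2|exact: int2].
by have := M2 Xx; have := M2 Xy; lra.
Qed.

(** The bound on the second moments makes the family of the g x uniformly
    integrable, so that the event outside the modulus of continuity
    contributes little. *)
Lemma expectation_modulus (eps : R) : 0 < eps -> exists2 delta, 0 < delta &
  forall x y, X x -> X y -> ball x delta y ->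
  `|\int[mu]_e g x e - \int[mu]_e g y e| <= eps.
Proof.
move=> eps0.
(* Truncation at level B changes a difference by at most its square over B,
   whose integral is at most 4 M / B. *)
pose B := 16 * M / eps.
have B0 : 0 < B by rewrite divr_gt0// mulr_gt0.
have e40 : 0 < eps / 4 by rewrite divr_gt0.
have e20 : 0 < eps / (4 * B) by rewrite divr_gt0// mulr_gt0.
have [A [delta [mA delta0 muA modA]]] := stochastic_modulus mu Xc X0 mg gc e40 e20.
exists delta => // x y Xx Xy xy.
pose chi : E -> R := \1_(~` A).
have mAC : measurable (~` A) by exact: measurableC.
have mchi : measurable_fun setT chi by exact: measurable_indic.
have chi01 e : 0 <= chi e <= 1.
  by rewrite /chi indicE; case: (_ \in _) => /=; rewrite ?lexx ?ler01.
have ichi : mu.-integrable setT (EFin \o chi).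
  apply: (@bounded_integrable _ _ _ mu _ 1) => //.
  by move=> e; have /andP[h0 h1] := chi01 e; rewrite ger0_norm.
have intchi : \int[mu]_e chi e <= eps / (4 * B).
  by rewrite /Rintegral /chi integral_indic// setIT -lee_fin fineK// fin_num_measure.
have [iD2 iD2M] := intD2 Xx Xy.
rewrite -intDE//; apply: le_trans (le_normr_Rintegral measurableT (intD Xx Xy)) _.
have i1 : mu.-integrable setT (EFin \o (fun=> eps / 4)).
  by apply: (@bounded_integrable _ _ _ mu _ `|eps / 4|).
have i2 : mu.-integrable setT (EFin \o (fun e => B^-1 * D x y e ^+ 2)).
  exact: (integrableZl measurableT _ iD2).
have i3 : mu.-integrable setT (EFin \o (fun e => B * chi e)).
  exact: (integrableZl measurableT _ ichi).
have i12 := integrableD measurableT i1 i2.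
have bound e : `|D x y e| <= eps / 4 + B^-1 * D x y e ^+ 2 + B * chi e.
  have D2 : 0 <= B^-1 * D x y e ^+ 2 by rewrite mulr_ge0 ?sqr_ge0// invr_ge0 ltW.
  rewrite /chi indicE; have [nAe|Ae] := boolP (e \in ~` A) => /=.
    have := clamp_dist B0 (D x y e); have := clamp_norm B0 (D x y e).
    have := ler_normD (D x y e - clamp B (D x y e)) (clamp B (D x y e)).
    rewrite subrK mulrC; lra.
  have {}Ae : A e by move: Ae; rewrite notin_setE /= => /contrapT.
  by have := modA x y e Xx Xy xy Ae; rewrite -/(D x y e); lra.
apply: (@le_trans _ _ (\int[mu]_e (eps / 4 + B^-1 * D x y e ^+ 2 + B * chi e))).
  apply: Rintegral_le => //.
    exact: (integrable_norm (intD Xx Xy)).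
  exact: (integrableD measurableT i12 i3).
rewrite RintegralD// RintegralD// Rintegral_prob_cst !RintegralZl//.
have h1 : B^-1 * \int[mu]_e (D x y e ^+ 2) <= eps / 4.
  apply: (@le_trans _ _ (B^-1 * (4 * M))); first by rewrite ler_wpM2l// invr_ge0 ltW.
  by rewrite le_eqVlt; apply/orP; left; apply/eqP; rewrite /B; field; rewrite !gt_eqF.
have h2 : B * \int[mu]_e chi e <= eps / 4.
  apply: (@le_trans _ _ (B * (eps / (4 * B)))); first by rewrite ler_wpM2l// ltW.
  by rewrite le_eqVlt; apply/orP; left; apply/eqP; field; rewrite !gt_eqF.
lra.
Qed.

(** With the truncation level B large, truncation changes the integral of g x
    - g y by little and the truncated values are rare, uniformly in x and y;
    the uniform laws of large numbers transfer both facts to the sample, where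
    the deterministic inequality between the average and the variance applies.
    The truncated average of the sample is then at most 3 eps/16, which is
    below the eps/4 that this inequality allows. *)
Lemma small_gap_event (eps h K : R) : 0 < eps -> 0 < h -> 0 <= K ->
  exists2 K', 0 <= K' &
    forall d (Omega : measurableType d) (P : probability Omega R) (N : nat)
      (z : nat -> bool -> Omega -> E),
    (2 <= N)%N -> design P mu N (1 + K / N%:R) z ->
    exists A, [/\ measurable A, (P A <= (K' / N%:R)%:E)%E &
      forall w, ~ A w -> forall x y, X x -> X y ->
      \int[mu]_e g x e - \int[mu]_e g y e <= eps / 16 ->
      let obs v i := 2^-1 * (g v (z i false w) + g v (z i true w)) in
      (srp_gap N obs x y <= h * Num.sqrt (srp_sv N obs x y) + eps : Prop)].
Proof.
move=> eps0 h0 K0.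
have h20 : 0 < h ^+ 2 by rewrite exprn_gt0.
pose r := h ^+ 2 / (8 * (1 + h ^+ 2)).
have r0 : 0 < r by rewrite divr_gt0// mulr_gt0// addr_gt0.
pose B := 1 + 64 * M / eps + 8 * M / r.
have Me0 : 0 < 64 * M / eps by rewrite divr_gt0// mulr_gt0.
have Mr0 : 0 < 8 * M / r by rewrite divr_gt0// mulr_gt0.
have B0 : 0 < B by rewrite /B; lra.
have B1 : 1 <= B by rewrite /B; lra.
pose rho := Num.min (eps / (8 * B)) r.
have rho0 : 0 < rho by rewrite lt_min r0 divr_gt0// mulr_gt0.
have MB : 4 * M / B <= eps / 16.
  rewrite ler_pdivrMr//.
  have : 64 * M / eps <= B by rewrite /B; lra.
  by rewrite ler_pdivrMr//; lra.
have MB2 : 4 * M / B ^+ 2 <= rho / 2.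
  rewrite /rho; case: (leP (eps / (8 * B)) r) => _.
    rewrite ler_pdivrMr ?exprn_gt0//.
    rewrite (_ : eps / (8 * B) / 2 * B ^+ 2 = eps / 16 * B); last by field; rewrite gt_eqF.
    by move: MB; rewrite ler_pdivrMr.
  have : 8 * M / r <= B by rewrite /B; lra.
  rewrite ler_pdivrMr// ler_pdivrMr ?exprn_gt0// => H.
  have : B * r <= B ^+ 2 * r by rewrite ler_pM2r// ler_eXnr.
  lra.
have eta10 : 0 < eps / 16 by rewrite divr_gt0.
have eta20 : 0 < rho / 2 by rewrite divr_gt0.
have [K1 K10 U1] := uniform_lln mu Xc X0 mg gc (measurable_clamp B)
  (clamp_norm B0) (clamp_lipschitz B0) eta10 K0.
have [K2 K20 U2] := uniform_lln mu Xc X0 mg gc (measurable_tail_weight B)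
  (tail_weight_norm B0) (tail_weight_lipschitz B0) eta20 K0.
exists (K1 + K2); first exact: addr_ge0.
move=> d Omega P N z N2 zP; have N0 : (0 < N)%N by exact: leq_trans N2.
have [A1 [mA1 PA1 H1]] := U1 _ _ P N z N0 zP.
have [A2 [mA2 PA2 H2]] := U2 _ _ P N z N0 zP.
exists (A1 `|` A2); split.
- exact: measurableU.
- apply: le_trans (measureU2 _ _ _) _ => //.
  by apply: le_trans (leeD PA1 PA2) _; rewrite -EFinD mulrDl.
move=> w /not_orP[nA1 nA2] x y Xx Xy xy obs.
have {}H1 := H1 w nA1 x y Xx Xy.
have {}H2 := H2 w nA2 x y Xx Xy.
have [iD2 iD2M] := intD2 Xx Xy.
have iclamp : mu.-integrable setT (EFin \o (fun e => clamp B (D x y e))).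
  apply: (@bounded_integrable _ _ _ mu _ B).
    by apply: measurableT_comp (mD Xx Xy); exact: measurable_clamp.
  by move=> e; exact: clamp_norm.
have itail : mu.-integrable setT (EFin \o (fun e => tail_weight B (D x y e))).
  apply: (@bounded_integrable _ _ _ mu _ 1).
    by apply: measurableT_comp (mD Xx Xy); exact: measurable_tail_weight.
  by move=> e; exact: tail_weight_norm.
have clampD : \int[mu]_e clamp B (D x y e) <= eps / 8.
  have i2 : mu.-integrable setT (EFin \o (fun e => B^-1 * D x y e ^+ 2)).
    exact: (integrableZl measurableT _ iD2).
  have i12 := integrableD measurableT (intD Xx Xy) i2.
  have bound e : clamp B (D x y e) <= D x y e + B^-1 * D x y e ^+ 2.
    have := clamp_dist B0 (D x y e); rewrite mulrC.
    by have := ler_norm (- (D x y e - clamp B (D x y e))); rewrite normrN; lra.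
  apply: le_trans (Rintegral_le iclamp i12 bound) _.
  rewrite RintegralD//; last exact: intD.
  rewrite RintegralZl// intDE//.
  have : B^-1 * \int[mu]_e (D x y e ^+ 2) <= 4 * M / B.
    by rewrite [leRHS]mulrC ler_wpM2l// invr_ge0 ltW.
  lra.
have tailD : \int[mu]_e tail_weight B (D x y e) <= rho / 2.
  apply: le_trans MB2.
  have i2 : mu.-integrable setT (EFin \o (fun e => (B ^+ 2)^-1 * D x y e ^+ 2)).
    exact: (integrableZl measurableT _ iD2).
  apply: le_trans (Rintegral_le itail i2 _) _.
    by move=> e; rewrite mulrC; exact: tail_weight_le.
  by rewrite RintegralZl// [leRHS]mulrC ler_wpM2l// invr_ge0 exprn_ge0// ltW.
pose yy i b := D x y (z i b w).
have DE i : 2^-1 * (yy i false + yy i true) = obs x i - obs y i.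
  by rewrite /yy /D /obs; ring.
have := @gap_le_sqrt_variance R N yy B rho eps h N2 B0 rho0 eps0 h0.
rewrite /srp_sv /srp_gap.
under eq_bigr do rewrite DE.
under [X in _ * Num.sqrt (_ * X)]eq_bigr do rewrite DE.
apply.
- rewrite (_ : eps / 4 = 2 * (eps / (8 * B)) * B); last by field; rewrite gt_eqF.
  by rewrite ler_pM2r// ler_pM2l// /rho ge_min lexx.
- rewrite [leRHS](_ : _ = 8 * r * (1 + h ^+ 2)).
    by rewrite ler_pM2r ?addr_gt0// ler_pM2l// /rho ge_min lexx orbT.
  by rewrite /r; field; rewrite gt_eqF// addr_gt0.
- have := ler_norm (pair_mean N (fun e => clamp B (g x e - g y e)) (fun i b => z i b w) -
    \int[mu]_e clamp B (g x e - g y e)).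
  rewrite /pair_mean in H1 *; rewrite /yy /D in clampD *; lra.
- have := ler_norm (pair_mean N (fun e => tail_weight B (g x e - g y e)) (fun i b => z i b w) -
    \int[mu]_e tail_weight B (g x e - g y e)).
  rewrite /pair_mean in H2 *; rewrite /yy /D in tailD *; lra.
Qed.

End square_integrable_random_functions.

(** * A continuous version of the integrand *)

Section regularisation.
Context {R : realType} {dx dxi : nat}.
Variables (X : set 'rV[R]_dx) (mu : probability 'rV[R]_dxi R).
Variable f : 'rV[R]_dx -> 'rV[R]_dxi -> R.
Hypothesis Xc : compact X.

Lemma measurable_compact : measurable X.
Proof.
have cX : closed X by apply: compact_closed Xc; exact: norm_hausdorff.
rewrite -[X in measurable X]setCK; apply: measurableC; apply: sub_sigma_algebra.
exact: closed_openC.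
Qed.

Hypothesis f_borel : measurable_fun (X `*` dsupport mu)
  (fun z : 'rV[R]_dx * 'rV[R]_dxi => f z.1 z.2).

Let F := (fun z : 'rV[R]_dx * 'rV[R]_dxi => f z.1 z.2) \_ (X `*` dsupport mu).

Let measurable_F : measurable_fun setT F.
Proof.
apply/(measurable_restrictT _ _).1 => //.
by apply: measurableX; [exact: measurable_compact|exact: measurable_dsupport].
Qed.

Lemma measurable_fun_pair_f d (T : measurableType d)
    (Y : T -> 'rV[R]_dx) (Z : T -> 'rV[R]_dxi) :
  measurable_fun setT Y -> measurable_fun setT Z ->
  (forall t, X (Y t)) -> (forall t, dsupport mu (Z t)) ->
  measurable_fun setT (fun t => f (Y t) (Z t)).
Proof.
move=> mY mZ YX ZX.
rewrite (_ : (fun t => _) = F \o (fun t => (Y t, Z t))).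
  by apply: measurableT_comp => //; exact: measurable_fun_pair.
by apply/funext => t /=; rewrite /F patchE mem_set//; split; [exact: YX|exact: ZX].
Qed.

Lemma measurable_fun_section_f x : X x -> measurable_fun (dsupport mu) (f x).
Proof.
move=> Xx; apply/(measurable_restrictT _ _).2; first exact: measurable_dsupport.
rewrite (_ : _ \_ _ = F \o (fun z => (x, z))).
  by apply: measurableT_comp => //; apply: measurable_fun_pair => //; exact: measurable_cst.
apply/funext => z /=; rewrite /F !patchE.
case: ifPn => [/set_mem Dz|/negP nDz]; first by rewrite mem_set.
by rewrite memNset// => -[_ Dz]; apply: nDz; exact: mem_set.
Qed.

Hypothesis X0 : X !=set0.
Hypothesis f_cont : {ae mu, forall z, {within X, continuous (fun y => f y z)}}.
Variable s : sampling.
Hypothesis f_moment : moment_condition X mu f s.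

(** On a set of full measure f(., z) is continuous and z is in the support.
    Replacing f by 0 for the other z makes continuity hold everywhere, and the
    exceptional set does not depend on x. *)
Lemma regular_version : exists G, [/\ measurable G, mu (~` G) = 0%E,
  (forall x, X x -> measurable_fun setT (f x \_ G)),
  (forall z, {within X, continuous (fun x => (f x \_ G) z)}) &
  (forall x, X x -> objective mu f x = \int[mu]_z (f x \_ G) z) /\
  exists2 M, 0 < M & forall x, X x -> (\int[mu]_z ((f x \_ G) z ^+ 2)%:E <= M%:E)%E].
Proof.
have [A [mA muA HA]] := f_cont.
have mS := measurable_dsupport mu.
pose G := ~` A `&` dsupport mu.
have mG : measurable G by apply: measurableI => //; exact: measurableC.
have GS : G `<=` dsupport mu by exact: subIsetr.
have muG : mu (~` G) = 0%E.
  apply/eqP; rewrite eq_le measure_ge0 andbT /G setCI setCK.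
  apply: (le_trans (measureU2 _ _ _)) => //; first exact: measurableC.
  rewrite -[leRHS]adde0; apply: leeD; rewrite le_eqVlt; apply/orP; left; apply/eqP.
    exact: muA.
  exact: mu_dsupportC.
have mfS x : X x -> measurable_fun (dsupport mu) (f x).
  exact: measurable_fun_section_f.
have mfG x : X x -> measurable_fun setT (f x \_ G).
  move=> Xx; apply/(measurable_restrictT _ mG); apply: measurable_funS (mfS x Xx) => //.
exists G; split => //.
- move=> z; have [Gz|nGz] := pselect (G z); last first.
    rewrite (_ : (fun x => _) = cst 0); last first.
      by apply/funext => x; rewrite patchE memNset.
    by move=> x; exact: cvg_cst.
  rewrite (_ : (fun x => _) = f^~ z); last first.
    by apply/funext => x; rewrite patchE mem_set.
  by apply: contrapT => H; have [+ _] := Gz; apply; apply: HA.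
split.
  move=> x Xx; rewrite /objective /Rintegral; congr fine.
  rewrite integral_mkcond; apply: ae_eq_integral => //.
  - by apply/(measurable_restrictT _ mS)/measurable_EFinP; exact: mfS.
  - by apply/measurable_EFinP; exact: mfG.
  exists (~` G); split => //; first exact: measurableC.
  move=> z /= H Gz; apply: H => _.
  by rewrite !patchE mem_set ?mem_set//; exact: GS.
have sqE x z : ((f x \_ G) z ^+ 2)%:E = ((fun z => (f x z ^+ 2)%:E) \_ G) z.
  by rewrite !patchE; case: ifP => //; rewrite expr0n.
case: s f_moment => /= [sup|[C [C0 fC]]].
  set S := ereal_sup _ in sup.
  have S0 : (0 <= S)%E.
    case: X0 => y Xy; apply: (@le_trans _ _ (\int[mu]_(z in dsupport mu) ((f y z) ^+ 2)%:E)%E).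
      by apply: integral_ge0 => z _; rewrite lee_fin sqr_ge0.
    by apply: ereal_sup_ubound; exists y.
  have SE : S = (fine S)%:E by rewrite fineK// ge0_fin_numE.
  exists (fine S + 1); first by rewrite ltr_wpDl// fine_ge0.
  move=> x Xx; apply: (@le_trans _ _ S).
    apply: (@le_trans _ _ (\int[mu]_(z in dsupport mu) ((f x z) ^+ 2)%:E)%E); last first.
      by apply: ereal_sup_ubound; exists x.
    under eq_integral do rewrite sqE.
    rewrite -integral_mkcond; apply: ge0_subset_integral => //.
    - by apply/measurable_EFinP; apply: (measurable_funX 2); exact: mfS.
    - by move=> z _; rewrite lee_fin sqr_ge0.
  by rewrite SE lee_fin lerDl.
exists (C ^+ 2); first by rewrite exprn_gt0.
move=> x Xx; apply: (@le_trans _ _ (\int[mu]_z (C ^+ 2)%:E)%E); last first.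
  by rewrite integral_cst//= probability_setT mule1.
apply: ge0_le_integral => //.
- by move=> z _; rewrite lee_fin sqr_ge0.
- by apply/measurable_EFinP; apply: (measurable_funX 2); exact: mfG.
- move=> z _; rewrite lee_fin -(real_normK (num_real (patch _ _ _ _))).
  rewrite ler_pXn2r ?nnegrE ?(ltW C0)// patchE; case: ifP => [/set_mem Gz|_].
    by apply: fC => //; exact: GS.
  by rewrite normr0 ltW.
Qed.

End regularisation.

(** * Random candidates *)

Section candidates.
Context {R : realType} {dx : nat} (X : set 'rV[R]_dx).
Context {dE : measure_display} {E : measurableType dE} (mu : probability E R).
Variable g : 'rV[R]_dx -> E -> R.
Hypotheses (Xc : compact X) (X0 : X !=set0).
Hypothesis mg : forall x, X x -> measurable_fun setT (g x).
Hypothesis gc : forall e, {within X, continuous (fun x => g x e)}.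
Variable M : R.
Hypothesis M0 : 0 < M.
Hypothesis gM : forall x, X x -> (\int[mu]_e (g x e ^+ 2)%:E <= M%:E)%E.

Definition design_sigma d (Omega : measurableType d) (N : nat)
    (z : nat -> bool -> Omega -> E) : set (set Omega) :=
  <<s [set B | exists i b, (i < N)%N /\ sigma_of (z i b) B] >>.

(** The event is measurable for the sigma-algebra that the sample generates,
    as the independence of sample and candidate requires. *)
Lemma pair_mean_sigma d (Omega : measurableType d) (N : nat)
    (z : nat -> bool -> Omega -> E) (phi : E -> R) (m delta : R) :
  measurable_fun setT phi ->
  design_sigma N z [set w | delta <= `|pair_mean N phi (fun i b => z i b w) - m|].
Proof.
move=> mphi.
pose T := g_sigma_algebraType [set B | exists i b, (i < N)%N /\ sigma_of (z i b) B].
have mz i b : (i < N)%N -> measurable_fun setT (z i b : T -> E).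
  move=> iN _ S mS; apply: sub_sigma_algebra; exists i, b; split => //.
  by exists S.
have mp := @measurable_pair_mean _ T _ E R N z phi mphi mz.
suff : @measurable _ T [set w | delta <= `|pair_mean N phi (fun i b => z i b w) - m|] by [].
apply: measurable_set_le => //.
by apply: measurableT_comp => //; apply: measurable_funB.
Qed.

(** The candidate Y is replaced by the point of a finite net whose cell F_i
    contains it. By independence, the probability of a deviation at the point
    of the i-th cell is the product of P(Y in F_i) and a Chebyshev bound; the
    factors P(Y in F_i) add up to at most 1, and so the net may depend on N.
    It is chosen so fine that, with probability at least 1 - 1/N, the modulus
    of continuity is valid at every point of the sample. *)
Lemma candidate_lln (eps K : R) : 0 < eps -> 0 <= K ->
  exists2 K', 0 <= K' &
    forall d (Omega : measurableType d) (P : probability Omega R) (N : nat)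
      (z : nat -> bool -> Omega -> E) (Y : Omega -> 'rV[R]_dx),
    (0 < N)%N -> design P mu N (1 + K / N%:R) z ->
    measurable_fun setT Y -> (forall w, X (Y w)) ->
    independent2 P (sigma_of Y) (design_sigma N z) ->
    exists A, [/\ measurable A, (P A <= (K' / N%:R)%:E)%E &
      forall w, ~ A w ->
      `|pair_mean N (g (Y w)) (fun i b => z i b w) - \int[mu]_e g (Y w) e| <= eps].
Proof.
move=> eps0 K0.
have e40 : 0 < eps / 4 by rewrite divr_gt0.
have e20 : 0 < eps / 2 by rewrite divr_gt0.
have [d1 d10 H1] := expectation_modulus Xc X0 mg gc M0 gM e40.
pose Q := 8 * (1 + K) * M / (eps / 2) ^+ 2.
have Q0 : 0 <= Q.
  by apply: divr_ge0; rewrite ?exprn_ge0 ?(ltW e20)// mulr_ge0 ?(ltW M0)// mulr_ge0 ?addr_ge0.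
exists (1 + Q); first by rewrite addr_ge0.
move=> d Omega P N z Y N0 zP mY XY indep.
have NR : 0 < N%:R :> R by rewrite ltr0n.
have [mz zmu _] := zP.
(* The 2N members of the sample avoid the complement of A0 with probability
   at least 1 - 2 N eta2 = 1 - 1/N. *)
pose eta2 : R := (2 * N%:R ^+ 2)^-1.
have eta20 : 0 < eta2 by rewrite invr_gt0 mulr_gt0// exprn_gt0.
have [A0 [d2 [mA0 d20 muA0 modA0]]] := stochastic_modulus mu Xc X0 mg gc e40 eta20.
have mAC : measurable (~` A0) by exact: measurableC.
pose delta := Num.min d1 d2.
have delta0 : 0 < delta by rewrite lt_min d10.
have [l [lX lcover]] := compact_net Xc delta0.
have [x0 Xx0] := X0.
pose pt i := nth x0 l i.
have Xpt i : X (pt i).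
  rewrite /pt; have [il|il] := ltnP i (size l); last by rewrite nth_default.
  by apply: lX; exact: mem_nth.
pose F := seqDU (fun i => (ball (pt i) delta)°).
have mF i : measurable (F i).
  apply: measurableD; last first.
    apply: bigsetU_measurable => j _; apply: sub_sigma_algebra; exact: open_interior.
  by apply: sub_sigma_algebra; exact: open_interior.
have Fcover x : X x -> exists i, F i x.
  move=> Xx; have [p pl px] := lcover x Xx.
  have : (\bigcup_i (ball (pt i) delta)°) x.
    by exists (index p l) => //; rewrite /pt nth_index.
  by rewrite seqDU_bigcup_eq => -[i _ Fi]; exists i.
have Fball i x : F i x -> ball (pt i) delta x.
  by move=> [/interior_subset].
pose bad i := [set w | eps / 2 <= `|pair_mean N (g (pt i)) (fun i b => z i b w) -
  \int[mu]_e g (pt i) e|].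
have mbad i : measurable (bad i).
  apply: measurable_set_le => //; apply: measurableT_comp => //.
  apply: measurable_funB => //; apply: measurable_pair_mean => //; exact: mg.
have Pbad i : (P (bad i) <= (Q / N%:R)%:E)%E.
  apply: le_trans (design_lln N0 _ zP e20 K0 erefl (mg (Xpt i)) (gM (Xpt i))) _.
    by rewrite ?addr_ge0// ?divr_ge0// ltW.
  by rewrite lee_fin /Q le_eqVlt; apply/orP; left; apply/eqP; field; rewrite !gt_eqF.
pose Z (t : 'I_N * bool) := z t.1 t.2 @^-1` (~` A0).
have mZ t : measurable (Z t).
  by rewrite -[Z t]setTI; apply: mz => //; exact: ltn_ord.
pose A1 := \bigcup_t Z t.
have mA1 : measurable A1 by apply: fin_bigcup_measurable => // t _; exact: mZ.
have PA1 : (P A1 <= (N%:R^-1)%:E)%E.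
  apply: le_trans (le_measure_bigsetU P mA1 mZ (@subset_refl _ _)) _.
  apply: (@le_trans _ _ (\sum_(t : 'I_N * bool) eta2%:E)%E).
    apply: lee_sum => t _; rewrite (le_trans _ muA0)// le_eqVlt; apply/orP; left.
    by apply/eqP; exact: (zmu t.1 t.2 _ (ltn_ord _) mAC).
  rewrite sumEFin lee_fin sumr_const card_prod card_ord card_bool -[leLHS]mulr_natl natrM.
  by rewrite le_eqVlt; apply/orP; left; apply/eqP; rewrite /eta2; field; rewrite gt_eqF.
pose A2 := \bigcup_i (Y @^-1` F i `&` bad i).
have mYF i : measurable (Y @^-1` F i) by rewrite -[_ @^-1` _]setTI; exact: mY.
have mYFb i : measurable (Y @^-1` F i `&` bad i) by exact: measurableI.
have mA2 : measurable A2 by exact: bigcup_measurable.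
have tYF : trivIset setT (fun i => Y @^-1` F i).
  move=> i j _ _ [w [/= Fi Fj]].
  by apply: (trivIset_seqDU (fun i => (ball (pt i) delta)°)) => //; exists (Y w).
have PA2 : (P A2 <= (Q / N%:R)%:E)%E.
  rewrite [leLHS](measure_semi_bigcup P mYFb _ mA2); last first.
    by move=> i j _ _ [w [/= [Fi _] [Fj _]]]; apply: tYF => //; exists w.
  apply: (@le_trans _ _ (\sum_(i <oo) ((Q / N%:R)%:E * P (Y @^-1` F i)))%E).
    apply: lee_nneseries => // i _.
    have E0 : P (Y @^-1` F i `&` bad i) = (P (Y @^-1` F i) * P (bad i))%E.
      apply: indep; first by exists (F i) => //; rewrite setTI.
      by apply: pair_mean_sigma; exact: mg.
    by rewrite [leLHS]E0 muleC; apply: lee_wpmul2r => //; exact: Pbad.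
  rewrite nneseriesZl// -measure_semi_bigcup//; last exact: bigcup_measurable.
  rewrite -[leRHS]mule1; apply: lee_wpmul2l; first by rewrite lee_fin divr_ge0// ltW.
  by apply: probability_le1; exact: bigcup_measurable.
exists (A1 `|` A2); split.
- exact: measurableU.
- apply: le_trans (measureU2 _ _ _) _ => //.
  by apply: le_trans (leeD PA1 PA2) _; rewrite -EFinD mulrDl mul1r.
move=> w /not_orP[nA1 nA2].
have [i Fi] := Fcover _ (XY w).
have /Fball xball := Fi.
have good : `|pair_mean N (g (pt i)) (fun i b => z i b w) - \int[mu]_e g (pt i) e| < eps / 2.
  by rewrite ltNge; apply/negP => H; apply: nA2; exists i.
have b1 : ball (pt i) d1 (Y w) by apply: le_ball xball; rewrite ge_min lexx.
have b2 : ball (pt i) d2 (Y w) by apply: le_ball xball; rewrite ge_min lexx orbT.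
have {}H1 := H1 _ _ (Xpt i) (XY w) b1.
have H2 : `|pair_mean N (g (pt i)) (fun i b => z i b w) -
    pair_mean N (g (Y w)) (fun i b => z i b w)| <= eps / 4.
  rewrite /pair_mean -mulrBr -sumrB normrM ger0_norm ?invr_ge0// ler_pdivrMl//.
  apply: le_trans (ler_norm_sum _ _ _) _.
  apply: (@le_trans _ _ (\sum_(j < N) (eps / 4))); last first.
    by rewrite sumr_const card_ord mulr_natl.
  apply: ler_sum => j _.
  have zA b : A0 (z j b w).
    by apply: contrapT => nA; apply: nA1; exists (j, b).
  have := modA0 _ _ _ (Xpt i) (XY w) b2 (zA false).
  have := modA0 _ _ _ (Xpt i) (XY w) b2 (zA true).
  rewrite !ler_norml => /andP[h1 h2] /andP[h3 h4]; apply/andP; split; lra.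
move: H1 H2 good; rewrite !ler_norml !ltr_norml.
move=> /andP[h1 h2] /andP[h3 h4] /andP[h5 h6]; apply/andP; split; lra.
Qed.

End candidates.

(** * Convergence of the bounds *)

Section series.
Variable R : realType.

(** The logarithm of (k+1)/k is at least 1/(k+1), and exp x is at least 1 + x. *)
Lemma powRV_telescope (s : R) (k : nat) : 0 < s -> (0 < k)%N ->
  s * (k.+1%:R `^ (1 + s))^-1 <= (k%:R `^ s)^-1 - (k.+1%:R `^ s)^-1.
Proof.
move=> s0 k0.
have kR : 0 < k%:R :> R by rewrite ltr0n.
have kR1 : 0 < k.+1%:R :> R by rewrite ltr0n.
have x1 : -1 < - k.+1%:R^-1 :> R by rewrite ltrN2 invf_lt1// ltr1n.
have H1 := le_ln1Dx x1.
have kE : 1 + - k.+1%:R^-1 = k%:R / k.+1%:R :> R.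
  by rewrite -natr1; field; rewrite natr1 gt_eqF.
rewrite kE ln_div ?posrE// in H1.
have H2 := expR_ge1Dx (s * (ln k.+1%:R - ln k%:R) : R).
have E2 : expR (s * (ln k.+1%:R - ln k%:R)) = k.+1%:R `^ s / k%:R `^ s :> R.
  by rewrite mulrBr expRD expRN /powR !gt_eqF.
have p1 : 0 < k.+1%:R `^ s :> R by rewrite powR_gt0.
have p0 : 0 < k%:R `^ s :> R by rewrite powR_gt0.
rewrite powRD; last by rewrite pnatr_eq0 implybT.
rewrite powRr1 ?ler0n//.
have H3 : s * k.+1%:R^-1 <= s * (ln k.+1%:R - ln k%:R) by rewrite ler_pM2l// -(opprB (ln k%:R)) lerNr.
have H4 : 0 <= k.+1%:R `^ s / k%:R `^ s - 1 - s * k.+1%:R^-1 by rewrite -E2 -addrA -opprD subr_ge0 (le_trans _ H2)// lerD2l.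
rewrite -subr_ge0 (_ : _ - _ = (k.+1%:R `^ s)^-1 *
  (k.+1%:R `^ s / k%:R `^ s - 1 - s * k.+1%:R^-1)).
  by rewrite mulr_ge0// invr_ge0 ltW.
by field; rewrite !gt_eqF//= natr1 gt_eqF.
Qed.

(** Comparison with the telescoping sum of the differences of k^(1-q). *)
Lemma sum_powRV_le (q : R) : 1 < q ->
  (\sum_(k <oo) ((k.+1%:R `^ q)^-1)%:E <= (1 + (q - 1)^-1)%:E)%E.
Proof.
move=> q1; have s0 : 0 < q - 1 by rewrite subr_gt0.
have pos k : (0 <= ((k.+1%:R `^ q)^-1)%:E :> \bar R)%E.
  by rewrite lee_fin invr_ge0 powR_ge0.
apply: lime_le; first by apply: is_cvg_nneseries => k _ _; exact: pos.
near=> n.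
rewrite big_mkord sumEFin lee_fin.
have n0 : (0 < n)%N by near: n; exact: nbhs_infty_gt.
apply: (@le_trans _ _ (1 + (q - 1)^-1 * (1 - (n%:R `^ (q - 1))^-1))).
  move: n0; case: {+}n => // m _; elim: m => [|m IH].
    by rewrite big_ord1 /= mulr1n !powR1 invr1 subrr mulr0 addr0.
  rewrite big_ord_recr/=.
  have := @powRV_telescope (q - 1) m.+1 s0 isT.
  rewrite [1 + _]addrC subrK -ler_pdivlMl//; lra.
rewrite lerD2l ler_piMr ?invr_ge0 ?(ltW s0)// gerBl invr_ge0; exact: powR_ge0.
Unshelve. all: by end_near. Qed.

End series.

(** * Stopping times *)

Section first_passage.
Context {R : realType} (C : nat -> Prop).

Lemma first_time_eq k : first_time R C = (k%:R)%:E <->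
  [/\ (1 <= k)%N, C k & forall j, (1 <= j)%N -> (j < k)%N -> ~ C j].
Proof.
split.
  move=> E.
  have lb j : (1 <= j)%N -> C j -> (k <= j)%N.
    move=> j1 Cj; rewrite -(ler_nat R) -lee_fin -E; apply: ereal_inf_lbound.
    by exists j.
  have [j [j1 Cj] jk] : exists2 j, (1 <= j)%N /\ C j & (j <= k)%N.
    apply: contrapT => H.
    have : ((k.+1%:R)%:E <= first_time R C)%E.
      apply: le_ereal_inf_tmp => _ [j [j1 Cj] <-]; rewrite lee_fin ler_nat ltnNge.
      by apply/negP => jk; apply: H; exists j.
    by rewrite E lee_fin ler_nat ltnn.
  have jE : j = k by apply/eqP; rewrite eqn_leq jk lb.
  rewrite -jE; split => // i i1 ij Ci.
  by have := lb i i1 Ci; rewrite -jE leqNgt ij.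
move=> [k1 Ck Cj]; apply/eqP; rewrite eq_le; apply/andP; split.
  by apply: ereal_inf_lbound; exists k.
apply: le_ereal_inf_tmp => _ [j [j1 Cj'] <-]; rewrite lee_fin ler_nat leqNgt.
by apply/negP => jk; exact: Cj Cj'.
Qed.

Lemma first_time_hit : (exists2 k, (1 <= k)%N & C k) ->
  exists k, first_time R C = (k%:R)%:E.
Proof.
move=> [k k1 Ck].
have ex : exists k, (1 <= k)%N && `[< C k >].
  by exists k; rewrite k1; apply/asboolP.
have [j /andP[j1 /asboolP Cj] jmin] := ex_minnP ex.
exists j; apply/first_time_eq; split => // i i1 ij Ci.
by have := jmin i; rewrite i1 leqNgt ij asboolT// => /(_ isT).
Qed.

Lemma first_time_lty : (first_time R C < +oo)%E <-> exists2 k, (1 <= k)%N & C k.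
Proof.
split=> [H|]; last by move=> /first_time_hit[k ->]; exact: ltry.
apply: contrapT => nC; move: H; rewrite /first_time.
have -> : [set (k%:R)%:E | k in [set k | (1 <= k)%N /\ C k]] = set0 :> set (\bar R).
  by rewrite -subset0 => t [k [k1 Ck] _]; apply: nC; exists k.
by rewrite ereal_inf0 ltxx.
Qed.

End first_passage.

(** * The two assessment procedures *)

Section two_replications.
Context {R : realType} {dx : nat} (a : assessment) (N : nat).
Variables (g : nat -> 'rV[R]_dx -> nat -> R) (x : 'rV[R]_dx) (y : nat -> 'rV[R]_dx).

Lemma gap_ge (t : R) :
  (forall r, (r < replications a)%N -> t <= srp_gap N (g r) x (y r)) ->
  t <= gap a N g x y.
Proof.
case: (a) => /= H; first exact: H.
by have := H 0%N isT; have := H 1%N isT; lra.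
Qed.

(** Averaging the two replications preserves the criterion because the square
    root is concave. *)
Lemma gap_le (h eps : R) : 0 <= h -> (2 <= N)%N ->
  (forall r, (r < replications a)%N ->
    srp_gap N (g r) x (y r) <= h * Num.sqrt (srp_sv N (g r) x (y r)) + eps) ->
  gap a N g x y <= h * Num.sqrt (sv a N g x y) + eps.
Proof.
move=> h0 N2; case: (a) => /= H; first exact: H.
have sv0 r : 0 <= srp_sv N (g r) x (y r).
  rewrite mulr_ge0//; last by apply: sumr_ge0 => i _; exact: sqr_ge0.
  by rewrite invr_ge0 subr_ge0 ler1n ltnW.
have H0 := H 0%N isT; have H1 := H 1%N isT.
set s0 := srp_sv N (g 0%N) _ _ in H0 *; set s1 := srp_sv N (g 1%N) _ _ in H1 *.
have c : 2^-1 * (Num.sqrt s0 + Num.sqrt s1) <= Num.sqrt (2^-1 * (s0 + s1)).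
  have e0 := sqr_sqrtr (sv0 0%N); have e1 := sqr_sqrtr (sv0 1%N).
  rewrite -/s0 in e0; rewrite -/s1 in e1.
  rewrite -[leLHS]ger0_norm; last by rewrite mulr_ge0 ?addr_ge0 ?sqrtr_ge0.
  rewrite -sqrtr_sqr ler_wsqrtr// -{2}e0 -{2}e1.
  have := sqr_ge0 (Num.sqrt s0 - Num.sqrt s1); rewrite !expr2; lra.
have := ler_wpM2l h0 c; lra.
Qed.

End two_replications.

Lemma srp_gap_ext {R : realType} {dx : nat} (N : nat)
    (g g' : 'rV[R]_dx -> nat -> R) x y :
  (forall i, (i < N)%N -> forall v, g v i = g' v i) ->
  srp_gap N g x y = srp_gap N g' x y.
Proof.
by move=> H; rewrite /srp_gap; congr (_ * _); apply: eq_bigr => i _; rewrite !H.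
Qed.

Lemma srp_sv_ext {R : realType} {dx : nat} (N : nat)
    (g g' : 'rV[R]_dx -> nat -> R) x y :
  (forall i, (i < N)%N -> forall v, g v i = g' v i) ->
  srp_sv N g x y = srp_sv N g' x y.
Proof.
move=> H; rewrite /srp_sv (srp_gap_ext _ _ H); congr (_ * _).
by apply: eq_bigr => i _; rewrite !H.
Qed.

(** One formula for both sampling methods, because the two members of the pair
    of a Latin hypercube point are equal. *)
Lemma observation_member {R : realType} {dx dxi : nat} (s : sampling)
    (f : 'rV[R]_dx -> 'rV[R]_dxi -> R) (z : nat -> bool -> 'rV[R]_dxi) y i :
  observation s f z y i =
  2^-1 * (f y (z i (member s false)) + f y (z i (member s true))).
Proof. by case: s => //=; field. Qed.

(** * Events for one replication *)

Lemma within_continuous_measurable {R : realType} {dx : nat}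
    (X : set 'rV[R]_dx) (phi : 'rV[R]_dx -> R) d (T : measurableType d)
    (Y : T -> 'rV[R]_dx) : {within X, continuous phi} ->
  measurable_fun setT Y -> (forall t, X (Y t)) ->
  measurable_fun setT (phi \o Y).
Proof.
move=> cphi mY YX.
apply: (measurability _ (measurable_realfun.RGenOpens.measurableE R)).
move=> _ [_ [a [b ->] <-]].
have oab : open (`]a, b[%classic : set R) by exact: interval_open.
have /continuousP/(_ _ oab) := cphi.
rewrite open_subspaceP => -[U oU UE].
rewrite (_ : _ `&` _ = setT `&` Y @^-1` U); last first.
  rewrite !setTI comp_preimage; apply/seteqP; split => t /=.
    move=> H; suff [] : (U `&` X) (Y t) by []. 
    by rewrite UE; split.
  move=> Ut; suff [] : (phi @^-1` `]a, b[%classic `&` X) (Y t) by [].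
  by rewrite -UE; split.
by apply: mY => //; apply: sub_sigma_algebra.
Qed.

Lemma optimal_valueE {R : realType} {dx dxi : nat} (X : set 'rV[R]_dx)
    (mu : probability 'rV[R]_dxi R) (f : 'rV[R]_dx -> 'rV[R]_dxi -> R) v :
  optimal_solutions X mu f v -> optimal_value X mu f = objective mu f v.
Proof.
move=> [Xv vmin]; rewrite /optimal_value; apply/le_anti/andP; split.
  apply: ge_inf; last by exists v.
  by exists (objective mu f v) => _ [y Xy <-]; exact: vmin.
apply: lb_le_inf; first by exists (objective mu f v), v.
by move=> _ [y Xy <-]; exact: vmin.
Qed.

Section replication.
Context {R : realType} {dx dxi : nat}.
Variables (X : set 'rV[R]_dx) (mu : probability 'rV[R]_dxi R).
Variable f : 'rV[R]_dx -> 'rV[R]_dxi -> R.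
Hypotheses (Xc : compact X) (X0 : X !=set0).
Hypothesis f_borel : measurable_fun (X `*` dsupport mu)
  (fun z : 'rV[R]_dx * 'rV[R]_dxi => f z.1 z.2).
Hypothesis f_cont : {ae mu, forall z, {within X, continuous (fun y => f y z)}}.
Variable s : sampling.
Hypothesis f_moment : moment_condition X mu f s.

Lemma objective_continuous : {within X, continuous (objective mu f)}.
Proof.
have [G [mG muG mg gc [objE [M M0 gM]]]] := regular_version Xc f_borel X0 f_cont f_moment.
apply/subspace_continuousP => x Xx; apply/cvgrPdist_le => e e0.
have [delta d0 H] := expectation_modulus Xc X0 mg gc M0 gM e0.
rewrite /within/=; apply/nbhs_ballP; exists delta => //= y xy Xy.
by rewrite /from_subspace !objE//; exact: H.
Qed.

(** The version of the integrand agrees with f at the points of the sample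
    outside a null event. *)
Lemma missed_points d (Omega : measurableType d) (P : probability Omega R)
    (N : nat) (c : R) (z : nat -> bool -> Omega -> 'rV[R]_dxi) (G : set 'rV[R]_dxi) :
  measurable G -> mu (~` G) = 0%E -> design P mu N c z ->
  exists A, [/\ measurable A, (P A <= 0)%E &
    forall w, ~ A w -> forall i b, (i < N)%N -> G (z i b w)].
Proof.
move=> mG muG [mz zmu _].
have mGC : measurable (~` G) by exact: measurableC.
pose Z (t : 'I_N * bool) := z t.1 t.2 @^-1` (~` G).
have mZ t : measurable (Z t).
  by rewrite -[Z t]setTI; apply: mz => //; exact: ltn_ord.
have mA : measurable (\bigcup_t Z t) by apply: fin_bigcup_measurable => // t _; exact: mZ.
exists (\bigcup_t Z t); split => //.
  apply: le_trans (le_measure_bigsetU P mA mZ (@subset_refl _ _)) _.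
  rewrite big1// => t _.
  by have := zmu t.1 t.2 _ (ltn_ord _) mGC; rewrite muG.
move=> w nA i b iN; apply: contrapT => nG; apply: nA.
by exists (Ordinal iN, b).
Qed.

Variable v : 'rV[R]_dx.
Hypothesis v_opt : optimal_solutions X mu f v.

(** The sampling solution y is compared with x through the expectations; as
    the objective at y is at least the optimal value, a small optimality gap
    of x is all that is needed. *)
Lemma stopping_event (eps h K : R) : 0 < eps -> 0 < h -> 0 <= K ->
  exists2 K', 0 <= K' &
    forall d (Omega : measurableType d) (P : probability Omega R) (N : nat)
      (z : nat -> bool -> Omega -> 'rV[R]_dxi),
    (2 <= N)%N -> design P mu N (1 + K / N%:R) z ->
    exists A, [/\ measurable A, (P A <= (K' / N%:R)%:E)%E &
      forall w, ~ A w -> forall x y, X x -> X y ->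
      optimality_gap X mu f x <= eps / 16 ->
      let obs u i := 2^-1 * (f u (z i false w) + f u (z i true w)) in
      (srp_gap N obs x y <= h * Num.sqrt (srp_sv N obs x y) + eps : Prop)].
Proof.
move=> eps0 h0 K0.
have [G [mG muG mg gc [objE [M M0 gM]]]] := regular_version Xc f_borel X0 f_cont f_moment.
have [K' K'0 HK] := small_gap_event Xc X0 mg gc M0 gM eps0 h0 K0.
exists K' => // d Omega P N z N2 zP.
have [A [mA PA HA]] := HK _ _ P N z N2 zP.
have [B [mB PB HB]] := missed_points mG muG zP.
exists (A `|` B); split; first exact: measurableU.
  by apply: le_trans (measureU2 _ _ _) _ => //; rewrite -[leRHS]adde0 leeD.
move=> w /not_orP[nA nB] x y Xx Xy xgap obs.
have := HA w nA x y Xx Xy.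
rewrite -!objE// => /(_ _)/=.
set obs' := fun _ => _.
have E i : (i < N)%N -> forall u, obs' u i = obs u i.
  by move=> iN u; rewrite /obs' /obs !patchE !mem_set//; exact: HB.
rewrite (srp_gap_ext _ _ E) (srp_sv_ext _ _ E); apply.
apply: le_trans xgap; rewrite /optimality_gap (optimal_valueE v_opt) lerD2l lerN2.
by have [_] := v_opt; exact.
Qed.

(** The sampling solution is at least as good on the sample as the optimal
    solution v. Hence the gap estimator is at least the difference of the
    sample means at the candidate and at v, and each of these is within eps/2
    of the objective. *)
Lemma overestimation_event (eps K : R) : 0 < eps -> 0 <= K ->
  exists2 K', 0 <= K' &
    forall d (Omega : measurableType d) (P : probability Omega R) (N : nat)
      (z : nat -> bool -> Omega -> 'rV[R]_dxi) (Y : Omega -> 'rV[R]_dx),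
    (0 < N)%N -> design P mu N (1 + K / N%:R) z ->
    measurable_fun setT Y -> (forall w, X (Y w)) ->
    independent2 P (sigma_of Y) (design_sigma N z) ->
    exists A, [/\ measurable A, (P A <= (K' / N%:R)%:E)%E &
      forall w, ~ A w -> forall y,
      let obs u i := 2^-1 * (f u (z i false w) + f u (z i true w)) in
      saa_optimal X N obs y ->
      (optimality_gap X mu f (Y w) - eps <= srp_gap N obs (Y w) y : Prop)].
Proof.
move=> eps0 K0.
have e20 : 0 < eps / 2 by rewrite divr_gt0.
have [G [mG muG mg gc [objE [M M0 gM]]]] := regular_version Xc f_borel X0 f_cont f_moment.
have [K' K'0 HK] := candidate_lln Xc X0 mg gc M0 gM e20 K0.
have [Xv vmin] := v_opt.
pose Q := 8 * (1 + K) * M / (eps / 2) ^+ 2.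
have Q0 : 0 <= Q.
  by apply: divr_ge0; rewrite ?exprn_ge0 ?(ltW e20)// mulr_ge0 ?(ltW M0)// mulr_ge0 ?addr_ge0.
exists (K' + Q); first exact: addr_ge0.
move=> d Omega P N z Y N0 zP mY XY indep.
have NR : 0 < N%:R :> R by rewrite ltr0n.
have c0 : 0 <= 1 + K / N%:R by rewrite addr_ge0// divr_ge0// ltW.
have [A [mA PA HA]] := HK _ _ P N z Y N0 zP mY XY indep.
have [B [mB PB HB]] := missed_points mG muG zP.
have [mz _ _] := zP.
pose g x := f x \_ G.
pose A' := [set w | eps / 2 <= `|pair_mean N (g v) (fun i b => z i b w) -
  \int[mu]_e g v e|].
have mA' : measurable A'.
  apply: measurable_set_le => //; apply: measurableT_comp => //.
  apply: measurable_funB => //; apply: measurable_pair_mean => //; exact: mg.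
have PA' : (P A' <= (Q / N%:R)%:E)%E.
  apply: le_trans (design_lln N0 c0 zP e20 K0 erefl (mg _ Xv) (gM _ Xv)) _.
  by rewrite lee_fin /Q le_eqVlt; apply/orP; left; apply/eqP; field; rewrite !gt_eqF.
exists (A `|` A' `|` B); split; first by do 2 ? apply: measurableU.
  apply: le_trans (measureU2 _ _ _) _ => //; first exact: measurableU.
  rewrite -[leRHS]adde0 leeD//.
  apply: le_trans (measureU2 _ _ _) _ => //.
  by apply: le_trans (leeD PA PA') _; rewrite -EFinD mulrDl.
move=> w /not_orP[/not_orP[nA nA'] nB] y obs [Xy ymin].
have {}HA := HA w nA.
have {nA'} H' : `|pair_mean N (g v) (fun i b => z i b w) - \int[mu]_e g v e| < eps / 2.
  by rewrite ltNge; apply/negP.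
have ymin' := ymin v Xv.
have mE u : N%:R^-1 * (\sum_(i < N) obs u i) = pair_mean N (g u) (fun i b => z i b w).
  congr (_ * _); apply: eq_bigr => i _.
  by rewrite /obs /g !patchE !mem_set//; apply: HB.
rewrite /srp_gap sumrB mulrBr mE.
rewrite !mE in ymin'; rewrite mE.
rewrite /optimality_gap (optimal_valueE v_opt) !objE//.
move: HA H'; rewrite ler_norml ltr_norml => /andP[h1 h2] /andP[h3 h4].
rewrite -/(g _) in h1 h2 *; lra.
Qed.

End replication.

(** * From single iterations to the whole procedure *)

Section probability_one.
Context d (Omega : measurableType d) (R : realType) (P : probability Omega R).

Lemma ae_exists (Q : Omega -> Prop) : {ae P, forall w, Q w} -> exists w, Q w.
Proof.
move=> [B [mB PB QB]]; apply: contrapT => nQ.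
have BT : B = setT.
  by rewrite -subTset => w _; apply: QB => Qw; apply: nQ; exists w.
by move: PB; rewrite BT probability_setT => /eqP; rewrite onee_eq0.
Qed.

Lemma ae_probability1 (S : set Omega) : measurable S ->
  {ae P, forall w, S w} -> P S = 1%E.
Proof.
move=> mS [B [mB PB SB]].
have PC : P (~` S) = 0%E.
  apply/eqP; rewrite eq_le measure_ge0 andbT -PB.
  by apply: le_measure; rewrite ?inE//; exact: measurableC.
by rewrite -[S]setCK probability_setC ?PC ?sube0//; exact: measurableC.
Qed.

Lemma replications_union (a : assessment) (c : R) (Q : nat -> Omega -> Prop) :
  0 <= c ->
  (forall r, (r < replications a)%N -> exists A,
     [/\ measurable A, (P A <= c%:E)%E & forall w, ~ A w -> Q r w]) ->
  exists A, [/\ measurable A, (P A <= (2 * c)%:E)%E &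
    forall w, ~ A w -> forall r, (r < replications a)%N -> Q r w].
Proof.
move=> c0 H.
have {}H r : exists A, [/\ measurable A, (P A <= c%:E)%E &
    forall w, ~ A w -> (r < replications a)%N -> Q r w].
  have [ra|ra] := ltnP r (replications a).
    by have [A [? ? HA]] := H r ra; exists A; split => // w nA _; exact: HA.
  by exists set0; rewrite measure0 lee_fin.
have [A0 [mA0 PA0 H0]] := H 0%N; have [A1 [mA1 PA1 H1]] := H 1%N.
exists (A0 `|` A1); split; first exact: measurableU.
  apply: le_trans (measureU2 _ _ _) _ => //.
  by apply: le_trans (leeD PA0 PA1) _; rewrite -EFinD lee_fin; lra.
move=> w /not_orP[nA0 nA1] [|[|r]]; [exact: H0|exact: H1|].
by case: (a).
Qed.

(** The failure probability of iteration k is at most K/(D k^q), which is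
    summable as q > 1. The bound is proportional to 1/D, which is what makes
    the sum vanish as h decreases to h'. *)
Lemma summable_events (N : nat -> nat) (q D K : R) (Q : nat -> Omega -> Prop) :
  1 < q -> 0 < D -> 0 <= K ->
  (forall k, (1 <= k)%N -> D * k%:R `^ q <= (N k)%:R) ->
  (forall k, (1 <= k)%N -> exists A,
     [/\ measurable A, (P A <= (K / (N k)%:R)%:E)%E & forall w, ~ A w -> Q k w]) ->
  exists A : nat -> set Omega, [/\ forall k, measurable (A k),
    (\sum_(k <oo) P (A k) <= (K / D * (1 + (q - 1)^-1))%:E)%E &
    forall k w, ~ A k w -> Q k.+1 w].
Proof.
move=> q1 D0 K0 ND H.
have [A HA] := choice (fun k => H k.+1 isT).
exists A; split; [by move=> k; have [] := HA k| |by move=> k; have [_ _] := HA k].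
have KD : 0 <= K / D by rewrite divr_ge0// ltW.
apply: (@le_trans _ _ (\sum_(k <oo) ((K / D)%:E * ((k.+1%:R `^ q)^-1)%:E))%E).
  apply: lee_nneseries => // k _; have [_ PA _] := HA k.
  apply: le_trans PA _; rewrite -EFinM lee_fin -mulrA ler_wpM2l// -invfM.
  have Dk : 0 < D * k.+1%:R `^ q by rewrite mulr_gt0// powR_gt0.
  by have := ND k.+1 isT => NDk; rewrite lef_pV2// posrE; apply: lt_le_trans NDk.
rewrite nneseriesZl; last by move=> k _; rewrite lee_fin invr_ge0 powR_ge0.
rewrite (EFinM (K / D)); apply: lee_wpmul2l; first by rewrite lee_fin.
exact: sum_powRV_le.
Qed.

Lemma eventually_not (A : nat -> set Omega) : (forall k, measurable (A k)) ->
  (\sum_(k <oo) P (A k) < +oo)%E ->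
  {ae P, forall w, \forall k \near \oo, ~ A k w}.
Proof.
move=> mA sA; exists (lim_sup_set A); split.
- by apply: bigcap_measurable => // n _; exact: bigcup_measurable.
- exact: lim_sup_set_cvg0.
move=> w nw n _; apply: contrapT => H; apply: nw; exists n => // k /= nk Ak.
by apply: H; exists k.
Qed.

End probability_one.

Section measurable_estimators.
Context d (Omega : measurableType d) (R : realType) (dx : nat) (N : nat).

Lemma measurable_srp_gap (obs : Omega -> 'rV[R]_dx -> nat -> R)
    (Y Z : Omega -> 'rV[R]_dx) :
  (forall i, (i < N)%N -> measurable_fun setT (fun w => obs w (Y w) i)) ->
  (forall i, (i < N)%N -> measurable_fun setT (fun w => obs w (Z w) i)) ->
  measurable_fun setT (fun w => srp_gap N (obs w) (Y w) (Z w)).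
Proof.
move=> mY mZ; apply: measurable_funM; first exact: measurable_cst.
by apply: measurable_sum => i; apply: measurable_funB; [exact: mY|exact: mZ].
Qed.

Lemma measurable_srp_sv (obs : Omega -> 'rV[R]_dx -> nat -> R)
    (Y Z : Omega -> 'rV[R]_dx) :
  (forall i, (i < N)%N -> measurable_fun setT (fun w => obs w (Y w) i)) ->
  (forall i, (i < N)%N -> measurable_fun setT (fun w => obs w (Z w) i)) ->
  measurable_fun setT (fun w => srp_sv N (obs w) (Y w) (Z w)).
Proof.
move=> mY mZ; apply: measurable_funM; first exact: measurable_cst.
apply: measurable_sum => i; apply: (measurable_funX 2).
apply: measurable_funB; last exact: measurable_srp_gap.
by apply: measurable_funB; [exact: mY|exact: mZ].
Qed.

Variables (a : assessment) (obs : nat -> Omega -> 'rV[R]_dx -> nat -> R).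
Variables (Y : Omega -> 'rV[R]_dx) (Z : nat -> Omega -> 'rV[R]_dx).
Hypothesis mY : forall r i, (r < replications a)%N -> (i < N)%N ->
  measurable_fun setT (fun w => obs r w (Y w) i).
Hypothesis mZ : forall r i, (r < replications a)%N -> (i < N)%N ->
  measurable_fun setT (fun w => obs r w (Z r w) i).

Lemma measurable_gap : measurable_fun setT
  (fun w => gap a N (fun r => obs r w) (Y w) (fun r => Z r w)).
Proof.
have H r : (r < replications a)%N ->
    measurable_fun setT (fun w => srp_gap N (obs r w) (Y w) (Z r w)).
  by move=> ra; apply: measurable_srp_gap => i; [exact: mY|exact: mZ].
case: (a) H => /= H; first exact: H.
apply: measurable_funM; first exact: measurable_cst.
by apply: measurable_funD; exact: H.
Qed.

Lemma measurable_sv : measurable_fun setT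
  (fun w => sv a N (fun r => obs r w) (Y w) (fun r => Z r w)).
Proof.
have H r : (r < replications a)%N ->
    measurable_fun setT (fun w => srp_sv N (obs r w) (Y w) (Z r w)).
  by move=> ra; apply: measurable_srp_sv => i; [exact: mY|exact: mZ].
case: (a) H => /= H; first exact: H.
apply: measurable_funM; first exact: measurable_cst.
by apply: measurable_funD; exact: H.
Qed.

End measurable_estimators.

(** The number of observations in a replication is the effective sample size
    or half of it. *)
Lemma nobs_ge (R : realType) (s : sampling) (a : assessment) (n : nat) (t : R) :
  (sample_divisor s a %| n)%N -> 2 * t <= effective_size R s n ->
  t <= (nobs s a n)%:R.
Proof.
move=> dn; have nE : n = (nobs s a n * sample_divisor s a)%N by rewrite divnK.
set m := nobs s a n in nE *.
have m0 : 0 <= m%:R :> R by [].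
by rewrite nE; case: (s) (a) => -[] /=; rewrite natrM; lra.
Qed.

Lemma design_sigma_sub d (Omega : measurableType d) (R : realType) (dxi : nat)
    (nr : nat) (m : nat -> nat)
    (xi : nat -> nat -> nat -> bool -> Omega -> 'rV[R]_dxi) (s : sampling) k r :
  (1 <= k)%N -> (r < nr)%N ->
  design_sigma (m k) (fun i b => xi k r i (member s b)) `<=`
  samples_sigma nr m xi s.
Proof.
move=> k1 rn; apply: sub_sigma_algebra2 => A [i [b [im iA]]].
by exists k, r, i, (member s b); split => //; case: (s).
Qed.

Lemma limf_einf_ge (R : realType) (phi : R -> \bar R) (t : R) (l : \bar R) :
  (\forall h \near t^'+, (l <= phi h)%E) -> (l <= limf_einf phi t^'+)%E.
Proof.
move=> H; rewrite limf_einfE.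
apply: (@le_trans _ _ (ereal_inf (phi @` [set h | (l <= phi h)%E]))).
  by apply: le_ereal_inf_tmp => _ [h /= lh <-].
by apply: ereal_sup_ubound; exists [set h | (l <= phi h)%E].
Qed.

(** * Finite stopping and coverage *)

Theorem theorem3 (R : realType) (dx dxi : nat)
  (X : set 'rV[R]_dx)
  (mu : probability 'rV[R]_dxi R)
  (f : 'rV[R]_dx -> 'rV[R]_dxi -> R)
  (f_borel : measurable_fun (X `*` dsupport mu)
               (fun z : 'rV[R]_dx * 'rV[R]_dxi => f z.1 z.2))
  (Finv : 'I_dxi -> R -> R)
  (s : sampling) (a : assessment)
  (d : measure_display) (Omega : measurableType d) (P : probability Omega R)
  (x : nat -> {RV P >-> 'rV[R]_dx})
  (x_in_X : forall k w, (1 <= k)%N -> X (x k w))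
  (f_cont : {ae mu, forall z, {within X, continuous (fun y => f y z)}})
  (f_moment : moment_condition X mu f s)
  (X_nonempty : X !=set0) (X_compact : compact X)
  (xi_indep : mutually_independent mu setT
     (fun j : 'I_dxi => sigma_of (coordinate j : 'rV[R]_dxi -> R)))
  (xi_inv : forall j, inverse_cdf (component_cdf mu j) (Finv j))
  (x_limit : {ae P, forall w, exists2 z,
     optimal_solutions X mu f z & cluster ((fun k => x k w) @ \oo) z})
  (* parameters *)
  (h' eps eps' p q alpha : R)
  (h'_gt0 : 0 < h') (eps'_gt0 : 0 < eps') (eps_gt : eps' < eps)
  (p_gt0 : 0 < p) (q_gt1 : 1 < q) (alpha_gt0 : 0 < alpha) (alpha_lt1 : alpha < 1)
  (* sample sizes *)
  (n : R -> nat -> nat)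
  (n_ge2 : forall h, h' < h -> (2 <= n h 1)%N)
  (n_mono : forall h k, h' < h -> (1 <= k)%N -> (n h k <= n h k.+1)%N)
  (n_div : forall h k, h' < h -> (1 <= k)%N -> (sample_divisor s a %| n h k)%N)
  (n_defined : forall h k, h' < h -> (1 <= k)%N -> (2 <= nobs s a (n h k))%N)
  (n_large : forall h k, h' < h -> (1 <= k)%N ->
     (1 / (h - h')) ^+ 2 * (c_const p q alpha + 2 * p * k%:R `^ q)
       <= effective_size R s (n h k))
  (* samples *)
  (xi : R -> nat -> nat -> nat -> bool -> Omega -> 'rV[R]_dxi)
  (xi_scheme : forall h, h' < h ->
     sampling_scheme P Finv (replications a) (fun k => nobs s a (n h k)) (xi h) s)
  (xi_x_indep : forall h, h' < h ->
     independent2 P (candidates_sigma (fun k => x k : Omega -> 'rV[R]_dx))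
       (samples_sigma (replications a) (fun k => nobs s a (n h k)) (xi h) s))
  (* optimal solutions of the sampling problems *)
  (xstar : R -> nat -> nat -> {RV P >-> 'rV[R]_dx})
  (xstar_in_X : forall h k r w, h' < h -> (1 <= k)%N -> (r < replications a)%N ->
     X (xstar h k r w))
  (xstar_opt : forall h k r, h' < h -> (1 <= k)%N -> (r < replications a)%N ->
     {ae P, forall w, saa_optimal X (nobs s a (n h k))
        (observation s f (fun i b => xi h k r i b w)) (xstar h k r w)}) :
  let GAP h k w :=
    gap a (nobs s a (n h k)) (fun r => observation s f (fun i b => xi h k r i b w))
      (x k w) (fun r => xstar h k r w) in
  let SV h k w :=
    sv a (nobs s a (n h k)) (fun r => observation s f (fun i b => xi h k r i b w))
      (x k w) (fun r => xstar h k r w) in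
  let T h w : \bar R :=
    first_time R (fun k => GAP h k w <= h' * Num.sqrt (SV h k w) + eps') in
  (forall h, h' < h -> P [set w | (T h w < +oo)%E] = 1%E) /\
  ((1 - alpha)%:E <=
   limf_einf (fun h => P [set w | exists2 k, T h w = (k%:R)%:E &
      (optimality_gap X mu f (x k w) <= h * Num.sqrt (SV h k w) + eps)%R])
     h'^'+)%E.
Proof.
move=> GAP SV T.
have [w0 [v v_opt _]] := ae_exists x_limit.
pose N h k := nobs s a (n h k).
pose z h k r i b := xi h k r i (member s b).
pose K : R := 2 ^+ dxi.+1.
have K0 : 0 <= K by exact: exprn_ge0.
have zP h k r : h' < h -> (1 <= k)%N -> (r < replications a)%N ->
    design P mu (N h k) (1 + K / (N h k)%:R) (z h k r).
  move=> hh k1 ra.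
  exact: (sampling_design xi_indep xi_inv (xi_scheme h hh) k1 ra (n_defined h k hh k1)).
have [K1 K10 stopP] := stopping_event X_compact X_nonempty f_borel f_cont f_moment
  v_opt eps'_gt0 h'_gt0 K0.
have eps_eps' : 0 < eps - eps' by rewrite subr_gt0.
have [K2 K20 overP] := overestimation_event X_compact X_nonempty f_borel f_cont
  f_moment v_opt eps_eps' K0.
have obsE h k r w : observation s f (fun i b => xi h k r i b w) =
    fun u i => 2^-1 * (f u (z h k r i false w) + f u (z h k r i true w)).
  by apply/funext => u; apply/funext => i; rewrite observation_member.
pose gap_x k w := optimality_gap X mu f (x k w).
pose stop h k w := GAP h k w <= h' * Num.sqrt (SV h k w) + eps'.
have stop_event h k : h' < h -> (1 <= k)%N -> exists A,
    [/\ measurable A, (P A <= ((2 * K1) / (N h k)%:R)%:E)%E &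
      forall w, ~ A w -> gap_x k w <= eps' / 16 -> stop h k w].
  move=> hh k1; have N2 : (2 <= N h k)%N by exact: n_defined.
  have [] := @replications_union _ _ _ P a (K1 / (N h k)%:R) (fun r w =>
    gap_x k w <= eps' / 16 ->
    srp_gap (N h k) (observation s f (fun i b => xi h k r i b w)) (x k w) (xstar h k r w) <=
    h' * Num.sqrt (srp_sv (N h k) (observation s f (fun i b => xi h k r i b w))
      (x k w) (xstar h k r w)) + eps').
  - by rewrite divr_ge0.
  - move=> r ra; have [A [mA PA HA]] := stopP _ _ P _ _ N2 (zP h k r hh k1 ra).
    exists A; split => // w nA gx; rewrite obsE; apply: HA => //; first exact: x_in_X.
    exact: xstar_in_X.
  move=> A [mA PA HA]; exists A; split => //; first by rewrite -mulrA.
  by move=> w nA gx; apply: gap_le => //; [exact: ltW|move=> r ra; exact: HA].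
have over_event h k : h' < h -> (1 <= k)%N -> exists A,
    [/\ measurable A, (P A <= ((2 * K2) / (N h k)%:R)%:E)%E &
      forall w, ~ A w -> gap_x k w - (eps - eps') <= GAP h k w].
  move=> hh k1; have N2 : (2 <= N h k)%N by exact: n_defined.
  have N0 : (0 < N h k)%N by exact: leq_trans N2.
  have [] := @replications_union _ _ _ P a (K2 / (N h k)%:R) (fun r w =>
    gap_x k w - (eps - eps') <=
    srp_gap (N h k) (observation s f (fun i b => xi h k r i b w)) (x k w) (xstar h k r w)).
  - by rewrite divr_ge0.
  - move=> r ra.
    have mx : measurable_fun setT (x k) by [].
    have indep : independent2 P (sigma_of (x k : Omega -> _)) (design_sigma (N h k) (z h k r)).
      move=> A B Ax Bz; apply: (xi_x_indep h hh).
        by apply: sub_sigma_algebra; exists k.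
      by apply: (@design_sigma_sub _ Omega R _ (replications a) (N h)) Bz.
    have [A [mA PA HA]] := overP _ _ P _ _ _ N0 (zP h k r hh k1 ra) mx
      (fun w => x_in_X k w k1) indep.
    have [B [mB PB HB]] := xstar_opt h k r hh k1 ra.
    exists (A `|` B); split; first exact: measurableU.
      apply: le_trans (measureU2 _ _ _) _ => //; rewrite -[leRHS]adde0 leeD//.
      by rewrite le_eqVlt; apply/orP; left; apply/eqP; exact: PB.
    move=> w /not_orP[nA nB]; rewrite obsE; apply: HA => //.
    by rewrite -obsE; apply: contrapT => H; apply: nB; exact: HB.
  move=> A [mA PA HA]; exists A; split => //; first by rewrite -mulrA.
  by move=> w nA; apply: gap_ge => r ra; exact: HA.
(* As c_const is at least 1, the prescribed lower bound exceeds its part 2 p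
   k^q. *)
have N_ge h k : h' < h -> (1 <= k)%N ->
    p / (h - h') ^+ 2 * k%:R `^ q <= (N h k)%:R.
  move=> hh k1; apply: nobs_ge; first exact: n_div.
  apply: le_trans (n_large h k hh k1).
  rewrite expr_div_n expr1n mulrDr.
  rewrite (_ : 2 * _ = 1 / (h - h') ^+ 2 * (2 * p * k%:R `^ q)); last first.
    by field; rewrite subr_eq0 gt_eqF.
  rewrite lerDr mulr_ge0 ?divr_ge0 ?exprn_ge0// ?subr_ge0 ?(ltW hh)//.
  by rewrite /c_const le_max ler01 orbT.
have D_gt0 h : h' < h -> 0 < p / (h - h') ^+ 2.
  by move=> hh; rewrite divr_gt0// exprn_gt0// subr_gt0.
have stop_ae h : h' < h -> {ae P, forall w, exists2 k, (1 <= k)%N & stop h k w}.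
  move=> hh.
  have K10' : 0 <= 2 * K1 by rewrite mulr_ge0.
  have [A [mA sA HA]] := summable_events q_gt1 (D_gt0 h hh) K10'
    (fun k k1 => N_ge h k hh k1) (fun k k1 => stop_event h k hh k1).
  have nA : {ae P, forall w, \forall k \near \oo, ~ A k w}.
    by apply: eventually_not => //; apply: le_lt_trans sA _; exact: ltry.
  apply: filterS2 x_limit nA => w [y y_opt y_cluster] [k0 _ nA].
  have [Xy _] := y_opt.
  have e0 : 0 < eps' / 16 by rewrite divr_gt0.
  have [delta d0 H] := within_continuous_ball
    (objective_continuous X_compact X_nonempty f_borel f_cont f_moment) Xy e0.
  have tail : ((fun k => x k w) @ \oo) [set x k w | k in [set k | (k0 < k)%N]].
    by exists k0.+1 => // k kk; exists k.
  have [u [[k /= k0k <-] yk]] := y_cluster _ _ tail (nbhsx_ballx y delta d0).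
  have k1 : (1 <= k)%N by exact: leq_trans k0k.
  have {}H := H _ (x_in_X k w k1) yk.
  exists k => //; case: k k1 k0k H {yk} => // k _ k0k H.
  apply: HA; first exact: nA.
  rewrite /gap_x /optimality_gap (optimal_valueE y_opt).
  by apply: le_trans (ltW H); rewrite distrC; exact: ler_norm.
have mobs h k r i (Y : Omega -> 'rV[R]_dx) : h' < h -> (1 <= k)%N ->
    (r < replications a)%N -> (i < N h k)%N ->
    measurable_fun setT Y -> (forall w, X (Y w)) ->
    measurable_fun setT (fun w => observation s f (fun i b => xi h k r i b w) (Y w) i).
  move=> hh k1 ra iN mY XY.
  rewrite (_ : (fun w => _) = fun w => 2^-1 *
      (f (Y w) (z h k r i false w) + f (Y w) (z h k r i true w))); last first.
    by apply/funext => w; rewrite obsE.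
  have mfz b : measurable_fun setT (fun w => f (Y w) (z h k r i b w)).
    apply: (measurable_fun_pair_f X_compact f_borel) => //.
      by have [mz _ _] := zP h k r hh k1 ra; exact: mz.
    by move=> w; rewrite /z; apply: (sampling_in_dsupport xi_indep xi_inv (xi_scheme h hh)).
  apply: measurable_funM; first exact: measurable_cst.
  by apply: measurable_funD.
have mGAP h k : h' < h -> (1 <= k)%N -> measurable_fun setT (GAP h k).
  move=> hh k1; apply: measurable_gap => r i ra iN; apply: mobs => // w.
    exact: x_in_X.
  exact: xstar_in_X.
have msqrtSV h k : h' < h -> (1 <= k)%N ->
    measurable_fun setT (fun w => Num.sqrt (SV h k w)).
  move=> hh k1; have mSV : measurable_fun setT (SV h k).
    apply: measurable_sv => r i ra iN; apply: mobs => // w; first exact: x_in_X.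
    exact: xstar_in_X.
  have msqrt : measurable_fun setT (Num.sqrt : R -> R).
    by apply: continuous_measurable_fun; exact: sqrt_continuous.
  exact: measurableT_comp msqrt mSV.
have mstop h k : h' < h -> (1 <= k)%N -> measurable [set w | stop h k w].
  move=> hh k1; apply: measurable_set_le; first exact: mGAP.
  apply: measurable_funD => //; apply: measurable_funM => //; exact: msqrtSV.
have stopped_E h : [set w | (T h w < +oo)%E] = \bigcup_k [set w | stop h k.+1 w].
  apply/seteqP; split => w /=.
    by move=> /first_time_lty[[//|k] _ Sk]; exists k.
  by move=> [k _ Sk]; apply/first_time_lty; exists k.+1.
have mstopped h : h' < h -> measurable [set w | (T h w < +oo)%E].
  by move=> hh; rewrite stopped_E; apply: bigcup_measurable => k _; exact: mstop.
have stopped1 h : h' < h -> P [set w | (T h w < +oo)%E] = 1%E.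
  move=> hh; apply: ae_probability1; first exact: mstopped.
  by apply: filterS (stop_ae h hh) => w H; apply/first_time_lty.
split => //; apply: limf_einf_ge.
(* The events of all the iterations have total probability at most C (h -
   h')^2, which is at most alpha as soon as h - h' is at most 1 and alpha/(C
   + 1). *)
pose C := 2 * K2 / p * (1 + (q - 1)^-1).
have C0 : 0 <= C.
  have q10 : 0 < q - 1 by rewrite subr_gt0.
  by rewrite /C mulr_ge0 ?divr_ge0 ?mulr_ge0 ?addr_ge0 ?invr_ge0// ltW.
have [delta0 delta1 deltaC] : let delta := Num.min 1 (alpha / (C + 1)) in
    [/\ 0 < delta, delta <= 1 & C * delta <= alpha].
  move=> delta; have C1 : 0 < C + 1 by rewrite ltr_wpDl.
  split; rewrite /delta; first by rewrite lt_min ltr01 divr_gt0.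
    by rewrite ge_min lexx.
  apply: (@le_trans _ _ ((C + 1) * (alpha / (C + 1)))); last by rewrite mulrC divfK// gt_eqF.
  apply: ler_pM => //; rewrite ?lerDl// ?ge_min ?lexx ?orbT//.
  by rewrite le_min ler01 divr_ge0// ltW.
near=> h.
have hh : h' < h by near: h; exact: nbhs_right_gt.
have hdelta : h < h' + Num.min 1 (alpha / (C + 1)).
  by near: h; apply: nbhs_right_lt; rewrite ltrDl.
have K20' : 0 <= 2 * K2 by rewrite mulr_ge0.
have [A [mA sA HA]] := summable_events q_gt1 (D_gt0 h hh) K20'
  (fun k k1 => N_ge h k hh k1) (fun k k1 => over_event h k hh k1).
set S := [set w | exists2 k, _ & _].
pose ok k := [set w | gap_x k.+1 w <= h * Num.sqrt (SV h k.+1 w) + eps].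
have S_E : S = \bigcup_k (([set w | stop h k.+1 w] `&`
    \bigcap_(j in `I_k) ~` [set w | stop h j.+1 w]) `&` ok k).
  apply/seteqP; split => w.
    move=> [k /first_time_eq[k1 Sk nS] gk]; case: k k1 Sk nS gk => // k _ Sk nS gk.
    exists k => //; split => //.
    by split => // j /= jk Sj; apply: nS Sj.
  move=> [k _ [[Sk nS] gk]]; exists k.+1 => //; apply/first_time_eq; split => // -[//|j] _ jk.
  exact: nS.
have mgap_x k : (1 <= k)%N -> measurable_fun setT (gap_x k).
  move=> k1; apply: measurable_funB => //.
  apply: (within_continuous_measurable
    (objective_continuous X_compact X_nonempty f_borel f_cont f_moment)) => //.
  by move=> w; exact: x_in_X.
have mS : measurable S.
  rewrite S_E; apply: bigcup_measurable => k _; apply: measurableI.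
    apply: measurableI; first exact: mstop.
    by apply: bigcap_measurableType => j _; apply: measurableC; exact: mstop.
  apply: measurable_set_le; first exact: mgap_x.
  apply: measurable_funD => //; apply: measurable_funM => //; exact: msqrtSV.
pose U := \bigcup_k A k.
have mU : measurable U by exact: bigcup_measurable.
have PU : (P U <= alpha%:E)%E.
  apply: le_trans (@measure_sigma_subadditive _ _ _ P U A mA mU (@subset_refl _ _)) _.
  apply: le_trans sA _; rewrite lee_fin.
  have d0 : 0 < h - h' by rewrite subr_gt0.
  rewrite (_ : _ / _ * _ = C * (h - h') ^+ 2); last first.
    by rewrite /C; field; rewrite !gt_eqF//= subr_gt0.
  apply: le_trans deltaC; rewrite ler_wpM2l// expr2.
  by apply: (@le_trans _ _ (h - h')); rewrite ?ler_piMl//; lra.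
(* At the stopping time k, outside U, the optimality gap is at most the gap
   estimator plus eps - eps', hence at most h' sqrt SV + eps by the stopping
   criterion. *)
have SC : ~` S `<=` ~` [set w | (T h w < +oo)%E] `|` U.
  move=> w nSw; apply: contrapT => /not_orP[/contrapT fin nU]; apply: nSw.
  have hit := (@first_time_lty R _).1 fin.
  have [k Tk] := @first_time_hit R _ hit.
  have /first_time_eq[k1 Sk _] := Tk.
  exists k => //; case: k k1 Sk {Tk} => // k _ Sk.
  have nAk : ~ A k w by move=> Ak; apply: nU; exists k.
  have := HA k w nAk; rewrite /gap_x /stop in Sk *.
  have : h' * Num.sqrt (SV h k.+1 w) <= h * Num.sqrt (SV h k.+1 w).
    by rewrite ler_wpM2r ?sqrtr_ge0// ltW.
  lra.
have PS : (P (~` S) <= alpha%:E)%E.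
  apply: (@le_trans _ _ (P (~` [set w | (T h w < +oo)%E] `|` U))).
    apply: le_measure; rewrite ?inE//; first exact: measurableC.
    by apply: measurableU => //; apply: measurableC; exact: mstopped.
  apply: le_trans (measureU2 _ _ _) _ => //.
    by apply: measurableC; exact: mstopped.
  rewrite -[leRHS]add0e leeD//.
  have E0 := probability_setC P (mstopped h hh).
  by rewrite [leLHS]E0 stopped1// subee.
have E := probability_setC P (measurableC mS).
rewrite setCK in E; rewrite [leRHS]E EFinB; exact: leeB.
Unshelve. all: by end_near. Qed.
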